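(* Let $L>0$, $\mathbb S^1=\mathbb R/2\pi\mathbb Z$, $\mathcal S=[0,L]\times\mathbb S^1$ with coordinates $(s,\theta)$ (so that $\partial\mathcal S=(\{0\}\cup\{L\})\times\mathbb S^1$), and let $\mathfrak f\in C^\infty([0,L])$ (real-valued, viewed as a function of $s$ on $\mathcal S$). Then for any $\gamma>2$ and $\delta_0>0$ there is a constant $C>0$ such that for all $\delta\in(0,\delta_0]$ there exists a smooth function $R_\delta:[0,L]\to(0,\infty)$ such that, with $g_\delta=ds^2+R_\delta(s)^2d\theta^2$: 1. the vector field $X=\nabla_{g_\delta}\mathfrak f\cdot\nabla_{g_\delta}=\mathfrak f'(s)\partial_s$ does not depend on the metric $g_\delta$; 2. $(\mathcal S,\nabla_{g_\delta}\mathfrak f)$ satisfies (FC) if and only if $\mathfrak f'\neq0$ on $[0,L]$, and in this case $T_{FC}(\mathcal S,\nabla_{g_\delta}\mathfrak f)=\big|\int_0^L\frac{ds}{\mathfrak f'(s)}\big|<+\infty$; 3. for the transport equation with viscosity and Dirichlet boundary conditions associated with the metric $g_\delta$, we have $$T_{unif}(\partial\mathcal S)\ \ge\ \Big(\max_{[0,L]}\frac{|\mathfrak f'|^2}{4}\Big)^{-1}\Big(\frac1{\delta^{\gamma/2-1}}\,\frac1{\gamma/2-1}-C\Big);$$ 4. $(s+\delta)^{\gamma/2}(1-C(s+\delta))\le R_\delta(s)\le(s+\delta)^{\gamma/2}$ for $s\in[0,L/4]$, and $(L-s+\delta)^{\gamma/2}(1-C(L-s+\delta))\le R_\delta(s)\le(L-s+\delta)^{\gamma/2}$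 for $s\in[3L/4,L]$.
   Context: (FC): extend $(\mathcal S,g)$ to a slightly larger Riemannian manifold $(\tilde{\mathcal S},\tilde g)$ with $\mathcal S\subset\mathrm{Int}(\tilde{\mathcal S})$ and $\tilde g|_{\mathcal S}=g$, and $\mathfrak f$ to a compactly supported $W^{2,\infty}$ function $\tilde{\mathfrak f}$ on it; let $\dot\gamma_x=-\nabla_{\tilde g}\tilde{\mathfrak f}(\gamma_x)$, $\gamma_x(0)=x$. $(\mathcal S,\nabla_g\mathfrak f)$ satisfies (FC) if there is $T>0$ such that for all $x\in\mathcal S$ there is $t\in(0,T)$ with $\gamma_x(t)\notin\mathcal S$; $T_{FC}(\mathcal S,\nabla_g\mathfrak f)$ is the infimum of such $T$ (independent of the extensions). Equation associated with a metric $g$, for $\varepsilon>0$: $(\partial_t-\nabla_g\mathfrak f\cdot\nabla_g-q-\varepsilon\Delta_g)u=0$ in $(0,T)\times\mathrm{Int}(\mathcal S)$, $u=0$ on $(0,T)\times\partial\mathcal S$, $u|_{t=0}=u_0\in H^1_0(\mathcal S)$, where $q=q(s)$ is a given bounded, real-valued, rotationally invariant potential, $\cdot$ is the inner product given by $g$ and $\Delta_g$ is the Laplace–Beltrami operator. $T_{unif}(\partial\mathcal S)$ is the infimum of all $T>0$ for which there exist $K_0,\varepsilon_0>0$ such that for all $\varepsilon\in(0,\varepsilon_0)$, $\|u(T)\|^2_{H^1_0(\mathcal S)}\le K_0^2\int_0^T\|\varepsilon\,\partial_\nu u|_{\partial\mathcal S}(t)\|^2_{H^{1/2}(\partial\mathcal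 S)}\,dt$ for all $u_0\in H^1_0(\mathcal S)$ and $u$ the associated solution, where $\partial_\nu$ is the unit normal derivative for $g$. *)

(* Defs.v *)
From HB Require Import structures.
From mathcomp Require Import all_boot all_order all_algebra.
From mathcomp Require Import all_classical all_reals all_analysis.

Set Implicit Arguments.
Unset Strict Implicit.
Unset Printing Implicit Defensive.

Import Order.TTheory GRing.Theory Num.Theory.
Import numFieldNormedType.Exports.

Local Open Scope classical_set_scope.
Local Open Scope ring_scope.

(* The cylinder [0, L] x S^1 is handled in its global coordinates x = (s, theta):
   a function on R x S^1 is a function on R * R that is 2pi-periodic in its
   second argument. *)

Section Calculus.
Context {R : realType}.
Implicit Types (f : R -> R) (phi : R * R -> R).

(* C^oo(R); the elements of C^oo([0, L]) are the restrictions of such f. *)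
Definition smooth f := forall n x, derivable (derive1n n f) x 1.

Definition ds phi : R * R -> R := fun x => 'D_((1, 0) : R * R) phi x.
Definition dth phi : R * R -> R := fun x => 'D_((0, 1) : R * R) phi x.

Definition pd (i j : nat) phi : R * R -> R := iter i ds (iter j dth phi).

Definition periodic phi := forall s th, phi (s, th + pi *+ 2) = phi (s, th).

(* C^oo(R x S^1); the elements of C^oo([0, L] x S^1) are the restrictions of
   such phi.  By Schwarz's theorem the ordering of the derivatives in pd is
   harmless. *)
Definition smooth_cyl phi :=
  periodic phi /\ forall i j x, differentiable (pd i j phi) x.

(* W^{2,oo}(R x S^1), identified as usual with C^{1,1}. *)
Definition C11_cyl phi :=
  [/\ periodic phi, forall x, differentiable phi x &
      exists K, K.-lipschitz (ds phi) /\ K.-lipschitz (dth phi)].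

Definition compact_support_cyl phi :=
  exists M, forall x, M <= `|x.1| -> phi x = 0.

End Calculus.

Section Riemannian.
Context {R : realType}.

(* g = gss ds^2 + 2 gst ds dtheta + gtt dtheta^2 *)
Record metric := Metric {
  gss : R * R -> R;
  gst : R * R -> R;
  gtt : R * R -> R }.

Implicit Types (g : metric) (phi : R * R -> R) (x v w : R * R).

Definition rot_metric (Rad : R -> R) :=
  Metric (fun=> 1) (fun=> 0) (fun x => Rad x.1 ^+ 2).

Definition gdet g x := gss g x * gtt g x - gst g x ^+ 2.
Definition gvol g x := Num.sqrt (gdet g x).

(* coefficients of the inverse matrix *)
Definition iss g x := gtt g x / gdet g x.
Definition ist g x := - gst g x / gdet g x.
Definition itt g x := gss g x / gdet g x.

Definition riemannian_cyl g :=
  [/\ smooth_cyl (gss g), smooth_cyl (gst g), smooth_cyl (gtt g) &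
      forall x, 0 < gss g x /\ 0 < gdet g x].

(* index raising: the vector g^{-1} a of a covector a *)
Definition sharp g (a : R * R) x : R * R :=
  (iss g x * a.1 + ist g x * a.2, ist g x * a.1 + itt g x * a.2).

Definition ginner g v w x :=
  gss g x * v.1 * w.1 + gst g x * (v.1 * w.2 + v.2 * w.1) + gtt g x * v.2 * w.2.

Definition grad g phi x : R * R := sharp g (ds phi x, dth phi x) x.

End Riemannian.
Arguments metric : clear implicits.

Section FlushingCondition.
Context {R : realType}.
Variable L : R.

(* the preimage of S in the universal cover R * R *)
Definition cyl : set (R * R) := [set x | 0 <= x.1 <= L].

(* An extension of (S, g, phi).  Up to a diffeomorphism which is the identity
   on S, the open manifold extending S is R x S^1. *)
Definition extension (g : metric R) (phi : R * R -> R)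
    (gt : metric R) (phit : R * R -> R) :=
  [/\ riemannian_cyl gt,
      forall x, cyl x -> [/\ gss gt x = gss g x, gst gt x = gst g x
                           & gtt gt x = gtt g x],
      C11_cyl phit, compact_support_cyl phit &
      forall x, cyl x -> phit x = phi x].

Definition neg_gradient_flow (g : metric R) (phi : R * R -> R)
    (gam : R * R -> R -> R * R) :=
  forall x, gam x 0 = x /\
    forall t : R, is_derive t 1 (gam x) (- grad g phi (gam x t)).

Definition flushes (gam : R * R -> R -> R * R) (T : R) :=
  0 < T /\ forall x, cyl x -> exists t, 0 < t < T /\ ~ cyl (gam x t).

Definition FC gam := exists T, flushes gam T.

Definition T_FC gam : \bar R := ereal_inf [set T%:E | T in flushes gam].

End FlushingCondition.

Section Sobolev.
Context {R : realType}.
Variables (L : R) (g : metric R).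

Local Notation leb := (@lebesgue_measure R).

(* fundamental domains of S^1 and S *)
Definition fcirc : set R := `[0, pi *+ 2].
Definition fdom : set (R * R) := `[0, L] `*` fcirc.

Definition integral_S (v : R * R -> R) : \bar R :=
  \int[(leb \x leb)%E]_(x in fdom) (v x * gvol g x)%:E.

Definition L2sq (v : R * R -> R) : \bar R := integral_S (fun x => v x ^+ 2).

(* A Sobolev function is carried by the jet w of its (weak) derivatives:
   w 0 0 is the function and w i j is its derivative d_s^i d_theta^j. *)
Definition jet := nat -> nat -> R * R -> R.

Definition jet_grad (w : jet) x : R * R := sharp g (w 1%N 0%N x, w 0%N 1%N x) x.

Definition Hlim (m : nat) (phi : nat -> R * R -> R) (w : jet) :=
  forall i j, (i + j <= m)%N ->
    measurable_fun fdom (w i j) /\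
    L2sq (pd i j (phi n) \- w i j) @[n --> \oo] --> 0%E.

(* C^oo_c(Int S) *)
Definition test_function (phi : R * R -> R) :=
  smooth_cyl phi /\
  exists a b, [/\ 0 < a, b < L & forall x, ~~ (a <= x.1 <= b) -> phi x = 0].

(* H^1_0(S) is the closure of C^oo_c(Int S) in H^1 *)
Definition H10_jet (w : jet) :=
  exists phi, (forall n, test_function (phi n)) /\ Hlim 1 phi w.

Definition H10 (v : R * R -> R) := exists2 w, H10_jet w & w 0%N 0%N = v.

(* H^2(S) is the closure of C^oo(S) in H^2 *)
Definition H2_jet (w : jet) :=
  exists phi, (forall n, smooth_cyl (phi n)) /\ Hlim 2 phi w.

Definition H1sq (w : jet) : \bar R :=
  integral_S (fun x => w 0%N 0%N x ^+ 2
                       + ginner g (jet_grad w x) (jet_grad w x) x).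

Definition subj (w1 w2 : jet) : jet := fun i j x => w1 i j x - w2 i j x.

(* Delta_g w = |g|^{-1/2} d_i (|g|^{1/2} g^{ij} d_j w), expanded *)
Definition laplace_beltrami (w : jet) x : R :=
  iss g x * w 2%N 0%N x + ist g x * w 1%N 1%N x *+ 2 + itt g x * w 0%N 2%N x
  + (gvol g x)^-1 *
    ((ds (gvol g \* iss g) x + dth (gvol g \* ist g) x) * w 1%N 0%N x
     + (ds (gvol g \* ist g) x + dth (gvol g \* itt g) x) * w 0%N 1%N x).

(* outward unit normal derivative at the boundary points s = 0 and s = L *)
Definition dnu (phi : R * R -> R) (x : R * R) : R :=
  (if x.1 == 0 then -1 else 1) * (grad g phi x).1 / Num.sqrt (iss g x).

Definition L2sq_bd (b : R * R -> R) : \bar R :=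
  (\sum_(c <- [:: 0%R; L])
    \int[leb]_(th in fcirc)
      ((b (c, th)) ^+ 2 * Num.sqrt (gtt g (c, th)))%:E)%E.

(* normal_trace w b: b is the normal derivative on the boundary of w in H^2,
   i.e. its image by the continuous extension of dnu from C^oo(S) to H^2(S). *)
Definition normal_trace (w : jet) (b : R * R -> R) :=
  (forall c, c \in [:: 0; L] ->
    measurable_fun fcirc (fun th => b (c, th))) /\
  exists phi, [/\ forall n, smooth_cyl (phi n), Hlim 2 phi w &
    L2sq_bd (dnu (phi n) \- b) @[n --> \oo] --> 0%E].

(* arc length distance on R/2piZ, for representatives in [0, 2pi] *)
Definition circ_dist (th th' : R) : R :=
  Num.min `|th - th'| (pi *+ 2 - `|th - th'|).

(* Squared Sobolev-Slobodeckij norm of H^{1/2} on the two boundary circles.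
   If the metric is rotationally invariant, the circle s = c has length
   element r dtheta and distance r circ_dist for a constant r, which cancels
   in the double integral. *)
Definition H12sq_bd (b : R * R -> R) : \bar R :=
  (L2sq_bd b + \sum_(c <- [:: 0%R; L])
    \int[leb \x leb]_(y in fcirc `*` fcirc)
      (((b (c, y.1) - b (c, y.2)) / circ_dist y.1 y.2) ^+ 2)%:E)%E.

End Sobolev.

Section Observability.
Context {R : realType}.
Variables (L : R) (g : metric R) (phi : R * R -> R) (q : R -> R).

Local Notation leb := (@lebesgue_measure R).

(* grad phi . grad w + q w + eps Delta_g w *)
Definition generator (eps : R) (w : jet) x : R :=
  ginner g (grad g phi x) (jet_grad g w x) x + q x.1 * w 0%N 0%N x
  + eps * laplace_beltrami g w x.

(* The solution of the Dirichlet problem with initial datum u0 in H^1_0: u is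
   continuous from [0, T] to H^1_0(S), takes its values in H^2(S) for
   0 < t < T, and is there differentiable in L^2(S), with derivative
   generator eps u.  This is the trajectory of the analytic semigroup. *)
Definition solution (eps T : R) (u0 : R * R -> R) (u : R -> jet) :=
  [/\ L2sq L g (u 0 0%N 0%N \- u0) = 0%E,
      forall t, 0 <= t <= T -> H10_jet L g (u t),
      forall t, 0 <= t <= T ->
        H1sq L g (subj (u r) (u t)) @[r --> within `[0, T] (nbhs t)] --> 0%E,
      forall t, 0 < t < T -> H2_jet L g (u t) &
      forall t, 0 < t < T ->
        L2sq L g (fun x => (u (t + h) 0%N 0%N x - u t 0%N 0%N x) / h
                           - generator eps (u t) x) @[h --> 0^'] --> 0%E].

Definition observable (T K0 eps : R) :=
  forall u0, H10 L g u0 -> forall u, solution eps T u0 u ->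
  forall b : R -> R * R -> R,
    (forall t, 0 < t < T -> normal_trace L g (u t) (b t)) ->
  (H1sq L g (u T) <=
     (K0 ^+ 2)%:E *
     \int[leb]_(t in `]0%R, T[) H12sq_bd L g (fun x => (eps * b t x)%R))%E.

Definition T_unif : \bar R :=
  ereal_inf [set T%:E | T in [set T | 0 < T /\
    exists K0 eps0, [/\ 0 < K0, 0 < eps0 &
      forall eps, 0 < eps < eps0 -> observable T K0 eps]]].

End Observability.

(* Main.v *)
Require Import Defs.
From HB Require Import structures.
From mathcomp Require Import all_boot all_order all_algebra.
From mathcomp Require Import all_classical all_reals all_analysis.
From mathcomp Require Import measurable_realfun ring lra.

Set Implicit Arguments.
Unset Strict Implicit.
Unset Printing Implicit Defensive.

Import Order.TTheory GRing.Theory Num.Theory.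
Import numFieldNormedType.Exports.

Local Open Scope classical_set_scope.
Local Open Scope ring_scope.

(* Write [Z = 1 / R_delta].  For [eps = a / k] the separated function
   [exp (- E t / eps) cos (k theta) v(s)] solves the viscous equation when
   [(p v')' = p Q v] with [p = exp (f / eps) / Z], [eps^2 Q = (a Z)^2 - E - eps q] and
   [v(0) = v(L) = 0]; a shooting argument provides a nonnegative [v] of this kind.  The
   function [Z] is small in the middle of [0, L], so that Sturm comparison gives
   [E <= mu^2 / 2] where [mu >= max |f'|] is proportional to [a].  It blows up like
   [(s + delta)^(- gamma / 2)] at the ends: by an Agmon estimate the normal derivatives of
   [v] are smaller than the norm of [v] by a factor [exp (- (a int_0^s1 Z - mu s1) / eps)],
   whereas the solution decays at most like [exp (- mu^2 T / (2 eps))].  Letting [k] go to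
   infinity, observability in time [T] forces [T mu^2 / 2 >= a int_0^s1 Z - mu s1], and
   [int_0^s1 Z] is of size [delta^(1 - gamma / 2) / (gamma / 2 - 1)].  When [f] is constant,
   the lower bound is [1 / 0 = +oo] times a real number, and [a] can be taken arbitrarily small.

   As for the flushing time, in [S] the coordinate [s] follows [s' = - f'(s)] whatever the
   extension, so that a primitive of [1 / f'] decreases at unit speed; at a zero of [f'] the
   gradient of the extension vanishes, and Gronwall's lemma shows that the flow is stationary. *)

(** * Smooth functions *)

(** Two features shape the proof. The potential q is only bounded and measurable, so the mode v has
    no classical second derivative: the radial equation is posed as a pair of integral equations for
    v and its flux z = p v', and integration by parts, as well as membership in H^2 and H^1_0, go
    through smooth approximations in L^1 that keep the sup bound. Moreover the radius and C have to
    be fixed before the time T is known. Hence the scaling mu = a m: the geometric conditions then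
    involve Z and m alone, and a is chosen last. With m^2 = max |f'|^2 / 4 and a = 2 one has mu =
    max |f'| and T mu^2 / (2 a) = T m^2, which is the constant of the theorem. Keeping eps k = a
    fixed puts the angular barrier (a Z)^2 and the drift term f'^2 / 4 at the same order, so that E
    stays bounded as eps tends to 0. *)

Section Smooth.
Context {R : realType}.
Implicit Types (f g : R -> R) (x : R).

(** Differentiability n times, where only the derivatives below the last one are known to be
    continuous. The recursion peels off the innermost derivative, which suits inductions on
    products, inverses and compositions. *)
Fixpoint Ck (n : nat) f : Prop :=
  if n is m.+1 then (forall x, derivable f x 1) /\ Ck m (derive1 f) else True.

Lemma smoothP f : smooth f <-> forall n, Ck n f.
Proof.
split=> [+ n|].
  elim: n f => [//|n IHn] f hf; split; first exact: (hf 0%N).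
  by apply: IHn => m x; rewrite -derive1Sn; exact: hf.
move=> hf n; elim: n f hf => [|n IHn] f hf x; first by have [] := hf 1%N.
by rewrite derive1Sn; apply: IHn => m; have [] := hf m.+1.
Qed.

Lemma is_derive_derive1 f (x a : R) : is_derive x 1 f a -> (derive1 f) x = a.
Proof. by move=> fa; rewrite derive1E derive_val. Qed.

Lemma is_derive_congr f (x a b : R) : is_derive x 1 f a -> a = b -> is_derive x 1 f b.
Proof. by move=> fa <-. Qed.

Lemma is_derive1M f g (x a b : R) : is_derive x 1 f a -> is_derive x 1 g b ->
  is_derive x 1 (fun y => f y * g y) (a * g x + f x * b).
Proof.
move=> fa gb; apply: is_derive_congr (is_deriveM fa gb) _.
by rewrite addrC /GRing.scale /= [g x * a]mulrC.
Qed.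

Lemma is_derive1D f g (x a b : R) : is_derive x 1 f a -> is_derive x 1 g b ->
  is_derive x 1 (fun y => f y + g y) (a + b).
Proof. by move=> fa gb; exact: is_deriveD. Qed.

Lemma is_derive1N f (x a : R) : is_derive x 1 f a ->
  is_derive x 1 (fun y => - f y) (- a).
Proof. by move=> fa; exact: is_deriveN. Qed.

Lemma is_derive1B f g (x a b : R) : is_derive x 1 f a -> is_derive x 1 g b ->
  is_derive x 1 (fun y => f y - g y) (a - b).
Proof. by move=> fa gb; exact: is_deriveB. Qed.

Lemma is_derive1_cst (c x : R) : is_derive x 1 (fun=> c) (0 : R).
Proof. exact: is_derive_cst. Qed.

Lemma is_derive1_id (x : R) : is_derive x 1 (fun y : R => y) (1 : R).
Proof. exact: is_derive_id. Qed.

Lemma is_derive1Z f (c x a : R) : is_derive x 1 f a ->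
  is_derive x 1 (fun y => c * f y) (c * a).
Proof.
move=> fa; apply: is_derive_congr (is_derive1M (is_derive1_cst c x) fa) _.
by rewrite mul0r add0r.
Qed.

Lemma is_derive1_o f g (x a b : R) : is_derive (g x) 1 f a -> is_derive x 1 g b ->
  is_derive x 1 (fun y => f (g y)) (a * b).
Proof. by move=> fa gb; exact: (is_derive1_comp fa gb). Qed.

Lemma is_derive1V f (x a : R) : f x != 0 -> is_derive x 1 f a ->
  is_derive x 1 (fun y => (f y)^-1) (- a / f x ^+ 2).
Proof.
move=> f0 fa; apply: is_derive_congr (@is_deriveV _ _ _ _ _ f0 fa) _.
by rewrite /GRing.scale /= mulrC mulNr mulrN.
Qed.

Lemma derivable_is_derive1 f x : derivable f x 1 -> is_derive x 1 f ((derive1 f) x).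
Proof. by move=> /derivableP; rewrite derive1E. Qed.

Lemma CkS n f g : (forall x : R, is_derive x 1 f (g x)) -> Ck n g -> Ck n.+1 f.
Proof.
move=> fg cg; split; first by move=> x; have [] := fg x.
by rewrite (_ : (derive1 f) = g)//; apply/funext => x; exact: is_derive_derive1.
Qed.

Lemma CkSP n f : Ck n.+1 f ->
  (forall x : R, is_derive x 1 f ((derive1 f) x)) /\ Ck n (derive1 f).
Proof. by case=> df cf; split=> // x; exact: derivable_is_derive1. Qed.

Lemma CkW n f : Ck n.+1 f -> Ck n f.
Proof. by elim: n f => [//|n IHn] f [df cf]; split=> //; exact: IHn. Qed.

Lemma Ck_cst n (c : R) : Ck n (fun=> c).
Proof.
elim: n c => [//|n IHn] c.
have d0 : forall x : R, is_derive x 1 (fun=> c) (0 : R).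
  by move=> x; exact: is_derive_cst.
exact: CkS d0 (IHn 0).
Qed.

Lemma Ck_id n : Ck n (fun x : R => x).
Proof. by case: n => // n; apply: (@CkS _ _ (fun=> 1)) => //; exact: Ck_cst. Qed.

Lemma CkD n f g : Ck n f -> Ck n g -> Ck n (fun x => f x + g x).
Proof.
elim: n f g => [//|n IHn] f g /CkSP[df cf] /CkSP[dg cg].
have d : forall x : R, is_derive x 1 (fun x => f x + g x) (derive1 f x + derive1 g x).
  by move=> x; exact: is_deriveD.
by apply: CkS d _; exact: IHn.
Qed.

Lemma CkM n f g : Ck n f -> Ck n g -> Ck n (fun x => f x * g x).
Proof.
elim: n f g => [//|n IHn] f g cf cg.
have [df cf'] := CkSP cf; have [dg cg'] := CkSP cg.
have d : forall x : R, is_derive x 1 (fun x => f x * g x)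
    (f x * derive1 g x + g x * derive1 f x).
  by move=> x; exact: is_deriveM.
by apply: CkS d _; apply: CkD; apply: IHn => //; exact: CkW.
Qed.

Lemma CkN n f : Ck n f -> Ck n (fun x => - f x).
Proof.
move=> cf; rewrite (_ : (fun x => - f x) = (fun x => (-1) * f x)); last first.
  by apply/funext => x; rewrite mulN1r.
exact/CkM/cf/Ck_cst.
Qed.

Lemma CkB n f g : Ck n f -> Ck n g -> Ck n (fun x => f x - g x).
Proof. by move=> cf cg; apply: CkD => //; exact: CkN. Qed.

Lemma CkV n f : (forall x, f x != 0) -> Ck n f -> Ck n (fun x => (f x)^-1).
Proof.
move=> f0; elim: n => [//|n IHn] cf; have [df cf'] := CkSP cf.
have cV := IHn (CkW cf).
have d : forall x : R, is_derive x 1 (fun x => (f x)^-1)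
    (- derive1 f x * ((f x)^-1 * (f x)^-1)).
  move=> x; have h := @is_deriveV _ _ _ _ _ (f0 x) (df x).
  by apply: is_derive_eq h _; rewrite /GRing.scale /= -exprVn expr2 mulrC mulNr mulrN.
by apply: CkS d _; apply: CkM; [exact: CkN|exact: CkM].
Qed.

(** The induction has to vary [g], as the derivative of the composite contains the composite of [f]
    with g'. *)
Lemma Ck_comp n f g : (forall m, Ck m g) -> Ck n f -> Ck n (fun x => g (f x)).
Proof.
move=> + cf; elim: n f cf g => [//|n IHn] f cf g cg; have [df cf'] := CkSP cf.
have [dg _] := CkSP (cg 1%N).
have d : forall x : R, is_derive x 1 (fun x => g (f x)) (derive1 g (f x) * derive1 f x).
  by move=> x; exact: (is_derive1_comp (dg (f x)) (df x)).
apply: CkS d _.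
by apply: CkM => //; apply: IHn (CkW cf) _ _ => m; have [] := cg m.+1.
Qed.

Lemma Ck_expR n : Ck n (@expR R).
Proof. by elim: n => // n IHn; exact: CkS (@is_derive_expR R) IHn. Qed.

Lemma Ck_cos_sin n : Ck n (@cos R) /\ Ck n (@sin R).
Proof.
elim: n => // n [c s]; split; last exact: CkS (@is_derive_sin R) c.
exact: CkS (@is_derive_cos R) (CkN s).
Qed.

Lemma Ck_ln n f : (forall x, 0 < f x) -> Ck n f -> Ck n (fun x => ln (f x)).
Proof.
move=> f0; case: n => [//|n] cf; have [df cf'] := CkSP cf.
have cV : Ck n (fun x => (f x)^-1) by apply: CkV (CkW cf) => x; rewrite gt_eqF.
have d : forall x : R, is_derive x 1 (fun x => ln (f x)) ((f x)^-1 * derive1 f x).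
  by move=> x; exact: (is_derive1_comp (is_derive1_ln (f0 x)) (df x)).
by apply: CkS d _; exact: CkM.
Qed.

Lemma Ck_powR n f (a : R) :
  (forall x, 0 < f x) -> Ck n f -> Ck n (fun x => f x `^ a).
Proof.
move=> f0 cf; rewrite (_ : (fun _ => _) = fun x => expR (a * ln (f x))).
  by apply: Ck_comp; [exact: Ck_expR|apply: CkM; [exact: Ck_cst|exact: Ck_ln]].
by apply/funext => x; rewrite /powR gt_eqF.
Qed.

Lemma smooth_Ck n f : smooth f -> Ck n f.
Proof. by move=> /smoothP. Qed.

Lemma smooth_derive1 f : smooth f -> smooth (derive1 f).
Proof. by move=> /smoothP cf; apply/smoothP => n; have [] := cf n.+1. Qed.

Lemma smooth_is_derive f x : smooth f -> is_derive x 1 f ((derive1 f) x).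
Proof. by move=> /(_ 0%N x); exact: derivable_is_derive1. Qed.

Lemma smooth_derivable f x : smooth f -> derivable f x 1.
Proof. by move=> /(_ 0%N x). Qed.

Lemma smooth_continuous f : smooth f -> continuous f.
Proof.
by move=> /smooth_derivable df x; exact/differentiable_continuous/derivable1_diffP.
Qed.

Lemma smooth_derive1n n f : smooth f -> smooth ((derive1n n f)).
Proof.
elim: n f => [f hf|n IHn f hf]; first exact: hf.
by rewrite derive1Sn; exact: IHn (smooth_derive1 hf).
Qed.

End Smooth.

(** * A smooth transition function from 0 to 1 *)

Section SmoothStep.
Context {R : realType}.
Implicit Types (x : R).

Lemma near_gt a x : a < x -> \forall y \near x, a < y.
Proof. by move=> ax; exact: (@cvgr_gt _ _ _ _ id x cvg_id). Qed.

(** The functions x^(-k) exp(-1/x), extended by 0: the family is closed under differentiation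
    ([flat_derive]), so that the smoothness of exp(-1/x) is an induction on the order for all k at
    once. *)
Definition flat k x : R := if 0 < x then x^-1 ^+ k * expR (- x^-1) else 0.

Lemma flat_ge0 k x : 0 <= flat k x.
Proof.
rewrite /flat; case: ltP => // x0.
by rewrite mulr_ge0 ?expR_ge0// exprn_ge0// invr_ge0 ltW.
Qed.

(** The term of order k + 1 in the series of exp(1/x) beats x^(-k) by one factor of x. *)
Lemma flat_le k x : flat k x <= (k.+1)`!%:R * `|x|.
Proof.
rewrite /flat; case: ltP => [x0|_]; last by rewrite mulr_ge0.
have y0 : 0 < x^-1 by rewrite invr_gt0.
rewrite gtr0_norm// expRN ler_pdivrMr ?expR_gt0//.
have := expR_ge1Dxn k (ltW y0).
rewrite -(ler_pM2l (_ : 0 < (k.+1)`!%:R * x)); last first.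
  by rewrite mulr_gt0// ltr0n fact_gt0.
apply: le_trans.
rewrite mulrDr mulr1 exprS.
have -> : k.+1`!%:R * x * (x^-1 * x^-1 ^+ k / k.+1`!%:R) = x^-1 ^+ k.
  have : (k.+1`!%:R : R) != 0 by rewrite pnatr_eq0 -lt0n fact_gt0.
  move: (_%:R : R) (_ ^+ k) => c y c0; field.
  by rewrite c0 gt_eqF.
by rewrite lerDr mulr_ge0// ltW.
Qed.

Lemma flat_derive k x :
  is_derive x 1 (flat k) (flat k.+2 x - k%:R * flat k.+1 x).
Proof.
have [x0|x0|->] := ltgtP x 0.
- have feq : \near x, 0 = flat k x.
    by near=> y; rewrite /flat ltNge ltW//; near: y; exact: lt_nbhsl.
  apply: (near_eq_is_derive feq); apply: is_derive_eq (is_derive_cst 0 _ _) _.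
  by rewrite /flat !ltNge (ltW x0)/= mulr0 subr0.
- have xn0 : x != 0 by rewrite gt_eqF.
  have feq : \near x, x^-1 ^+ k * expR (- x^-1) = flat k x.
    by near=> y; rewrite /flat ifT//; near: y; exact: near_gt.
  have dV : is_derive x 1 (fun y : R => y^-1) (- x^-1 ^+ 2).
    have := is_deriveV xn0 (is_derive_id x 1).
    by move=> h; apply: is_derive_eq h _; rewrite /GRing.scale /= mulr1 exprVn.
  have dE : is_derive x 1 (fun y : R => expR (- y^-1)) (expR (- x^-1) * x^-1 ^+ 2).
    have dN : is_derive x 1 (fun y : R => - y^-1) (x^-1 ^+ 2).
      by have h := is_deriveN dV; apply: is_derive_eq h _; rewrite opprK.
    exact: (is_derive1_comp (is_derive_expR _) dN).
  have dX : is_derive x 1 (fun y : R => y^-1 ^+ k)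
      (k%:R * x^-1 ^+ k.-1 * - x^-1 ^+ 2).
    by have := is_deriveX k dV; rewrite exprfctE.
  have dM := is_deriveM dX dE; apply: (near_eq_is_derive feq).
  apply: is_derive_eq dM _.
  rewrite /flat x0 /GRing.scale /=.
  case: k {dX feq} => [|k]; first by rewrite !expr0 !expr1; ring.
  by rewrite /= !exprS; ring.
- rewrite /flat ltxx mulr0 subr0 -/(flat k).
  have h : h^-1 *: (flat k (h *: 1 + 0) - flat k 0) @[h --> 0^'] --> (0 : R).
    (* At 0 the difference quotient of [flat k] is [flat k.+1], which tends to 0 by [flat_le]. *)
    have e h : h != 0 -> h^-1 *: (flat k (h *: 1 + 0) - flat k 0) = flat k.+1 h.
      move=> h0; rewrite /GRing.scale /= mulr1 addr0 /flat ltxx subr0.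
      by case: ltP => // _; rewrite ?mulr0// exprS mulrA.
    apply/cvgrPdist_le => /= eps e0.
    near=> h; rewrite e; last by near: h; exact: nbhs_dnbhs_neq.
    rewrite sub0r normrN ger0_norm ?flat_ge0// (le_trans (flat_le _ _))//.
    have c0 : 0 < ((k.+2)`!%:R : R) by rewrite ltr0n fact_gt0.
    rewrite mulrC -ler_pdivlMr//.
    near: h; apply: dnbhs0_le; exact: divr_gt0.
  split; first by apply/cvg_ex; exists 0.
  exact: cvg_lim h.
Unshelve. all: by end_near. Qed.

Lemma Ck_flat n k : Ck n (flat k).
Proof.
elim: n k => [//|n IHn] k; apply: (CkS (flat_derive k)).
by apply: CkB; [exact: IHn|apply: CkM; [exact: Ck_cst|exact: IHn]].
Qed.

Definition sstep x : R := flat 0 x / (flat 0 x + flat 0 (1 - x)).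

Lemma flat_gt0 k x : 0 < x -> 0 < flat k x.
Proof. by move=> x0; rewrite /flat x0 mulr_gt0 ?expR_gt0// exprn_gt0// invr_gt0. Qed.

Lemma sstep_den x : 0 < flat 0 x + flat 0 (1 - x).
Proof.
have [x0|x0] := ltP 0 x; first by rewrite ltr_pwDl ?flat_gt0 ?flat_ge0.
by rewrite ltr_pwDr ?flat_ge0// flat_gt0//; lra.
Qed.

Lemma smooth_sstep : smooth sstep.
Proof.
apply/smoothP => n; apply: CkM; first exact: Ck_flat.
apply: CkV => [x|]; first by rewrite gt_eqF ?sstep_den.
apply: CkD; first exact: Ck_flat.
apply: (@Ck_comp _ n (fun x => 1 - x)) => [m|]; first exact: Ck_flat.
by apply: CkB; [exact: Ck_cst|exact: Ck_id].
Qed.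

Lemma sstep0 x : x <= 0 -> sstep x = 0.
Proof. by move=> x0; rewrite /sstep /flat ltNge x0 mul0r. Qed.

Lemma sstep1 x : 1 <= x -> sstep x = 1.
Proof.
move=> x1; rewrite /sstep [flat 0 (1 - x)]/flat ltNge subr_le0 x1 addr0 divff//.
by rewrite gt_eqF// flat_gt0//; lra.
Qed.

Lemma sstep_ge0 x : 0 <= sstep x.
Proof. by rewrite divr_ge0 ?flat_ge0// ltW ?sstep_den. Qed.

Lemma sstep_le1 x : sstep x <= 1.
Proof. by rewrite ler_pdivrMr ?sstep_den// mul1r lerDl flat_ge0. Qed.

End SmoothStep.

(** * Products f(s) c(theta) and their partial derivatives *)

Section Tensor.
Context {R : realType}.
Implicit Types (f c : R -> R) (F : R * R -> R) (x : R * R).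

Lemma dsE F x : ds F x = derive1 (fun s => F (s, x.2)) x.1.
Proof.
rewrite /ds /derive /derive1; apply: (congr1 (fun G => lim (G @ 0^'))); apply/funext => h /=.
case: x => a b /=; rewrite /shift /=.
congr (_ *: (_ - _)).
congr F.
by rewrite /GRing.scale /= /GRing.add /= ; congr (_, _); rewrite /= /GRing.scale /= ?mulr1 ?mulr0 ?add0r.
Qed.

Lemma dthE F x : dth F x = derive1 (fun t => F (x.1, t)) x.2.
Proof.
rewrite /dth /derive /derive1; apply: (congr1 (fun G => lim (G @ 0^'))); apply/funext => h /=.
case: x => a b /=; rewrite /shift /=.
congr (_ *: (_ - _)).
congr F.
by rewrite /GRing.scale /= /GRing.add /= ; congr (_, _); rewrite /= /GRing.scale /= ?mulr1 ?mulr0 ?add0r.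
Qed.

Definition tens f c : R * R -> R := fun x => f x.1 * c x.2.

Lemma ds_tens f c : smooth f -> ds (tens f c) = tens (derive1 f) c.
Proof.
move=> hf; apply/funext => x; rewrite dsE /tens /=; apply: is_derive_derive1.
apply: is_derive_congr (is_derive1M (smooth_is_derive x.1 hf) (is_derive1_cst (c x.2) x.1)) _.
by rewrite mulr0 addr0.
Qed.

Lemma dth_tens f c : smooth c -> dth (tens f c) = tens f (derive1 c).
Proof.
move=> hc; apply/funext => x; rewrite dthE /tens /=; apply: is_derive_derive1.
exact: is_derive1Z (smooth_is_derive x.2 hc).
Qed.

Lemma pd_tens i j f c : smooth f -> smooth c ->
  pd i j (tens f c) = tens (derive1n i f) (derive1n j c).
Proof.
move=> hf hc; rewrite /pd.
have -> : iter j dth (tens f c) = tens f (derive1n j c).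
  by elim: j => [//|j IH]; rewrite iterS IH (dth_tens _ (smooth_derive1n hc)).
by elim: i => [//|i IH]; rewrite iterS IH (ds_tens _ (smooth_derive1n hf)).
Qed.

Lemma differentiable_fst x : differentiable (fst : R * R -> R) x.
Proof. by apply: linear_differentiable => -[a b]; exact: cvg_fst. Qed.

Lemma differentiable_snd x : differentiable (snd : R * R -> R) x.
Proof. by apply: linear_differentiable => -[a b]; exact: cvg_snd. Qed.

Lemma differentiable_tens f c x :
  smooth f -> smooth c -> differentiable (tens f c) x.
Proof.
move=> hf hc; apply: differentiableM.
  apply: (@differentiable_comp _ _ _ _ fst f); first exact: differentiable_fst.
  exact/derivable1_diffP/smooth_derivable.
apply: (@differentiable_comp _ _ _ _ snd c); first exact: differentiable_snd.
exact/derivable1_diffP/smooth_derivable.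
Qed.

Lemma smooth_cyl_tens f c : smooth f -> smooth c ->
  (forall th, c (th + pi *+ 2) = c th) -> smooth_cyl (tens f c).
Proof.
move=> hf hc pc; split; first by move=> s th; rewrite /tens /= pc.
move=> i j x; rewrite pd_tens//.
by apply: differentiable_tens; exact: smooth_derive1n.
Qed.

Definition ckt (k : nat) (t : R) : R := cos (k%:R * t).

Lemma smooth_ckt k : smooth (ckt k).
Proof.
apply/smoothP => n; apply: (@Ck_comp _ n (fun t => k%:R * t)).
  by move=> m; have [] := @Ck_cos_sin R m.
by apply: CkM; [exact: Ck_cst|exact: Ck_id].
Qed.

Lemma periodic_ckt k th : ckt k (th + pi *+ 2) = ckt k th.
Proof.
rewrite /ckt mulrDr; elim: k (k%:R * th) => [|k IH] y; first by rewrite mul0r addr0.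
by rewrite -natr1 mulrDl mul1r addrA cosD2pi.
Qed.

Lemma is_derive1_mulr (a x : R) : is_derive x 1 (fun y => a * y) a.
Proof. by apply: is_derive_congr (is_derive1Z a (is_derive1_id x)) _; rewrite mulr1. Qed.

Lemma derive1_ckt k : derive1 (ckt k) = fun t => - k%:R * sin (k%:R * t).
Proof.
apply/funext => t; apply: is_derive_derive1.
apply: is_derive_congr (is_derive1_o (is_derive_cos _) (is_derive1_mulr k%:R t)) _.
by rewrite mulrC mulrN mulNr.
Qed.

Lemma derive1n2_ckt k : derive1n 2 (ckt k) = fun t => - k%:R ^+ 2 * ckt k t.
Proof.
rewrite /derive1n/= derive1_ckt.
apply/funext => t; apply: is_derive_derive1.
have d := is_derive1_o (is_derive_sin _) (is_derive1_mulr k%:R t).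
apply: is_derive_congr (is_derive1Z (- k%:R) d) _.
by rewrite /ckt; ring.
Qed.

End Tensor.

(** * Integrals over subintervals of [0, L] *)

Section Integral.
Context {R : realType}.
Implicit Types (f g : R -> R) (L K x y z s : R).

Local Notation leb := (@lebesgue_measure R).

(** The common class of integrands: it contains q and all continuous functions and, unlike
    integrability, is stable under products, so that the rules for [Rint] apply to every expression
    below. *)
Definition bm L f :=
  measurable_fun `[0, L] f /\ exists K, forall s, 0 <= s <= L -> `|f s| <= K.

Definition Rint x y f : R := \int[leb]_(s in `[x, y]) f s.

Lemma bm_integrable L f x y : bm L f -> 0 <= x -> y <= L ->
  leb.-integrable `[x, y] (EFin \o f).
Proof.
move=> [mf [K fK]] x0 yL.
have sub : `[x, y]%classic `<=` `[0, L]%classic by apply: subset_itv; rewrite bnd_simp.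
suff : leb.-integrable `[0, L] (EFin \o f) by exact: integrableS.
apply: measurable_bounded_integrable => //.
  by rewrite /= lebesgue_measure_itv /= lte_fin; case: ifP => _; rewrite ltry.
exists K; split; first exact: num_real.
by move=> M KM s /=; rewrite in_itv /= => sL; exact: le_trans (fK _ sL) (ltW KM).
Qed.

Lemma bm_cst L (c : R) : bm L (fun=> c).
Proof. by split; [exact: measurable_cst|exists `|c|]. Qed.

Lemma bmD L f g : bm L f -> bm L g -> bm L (fun s => f s + g s).
Proof.
move=> [mf [K fK]] [mg [M gM]]; split; first exact: measurable_funD.
by exists (K + M) => s sL; rewrite (le_trans (ler_normD _ _))// lerD ?fK ?gM.
Qed.

Lemma bmM L f g : bm L f -> bm L g -> bm L (fun s => f s * g s).
Proof.
move=> [mf [K fK]] [mg [M gM]]; split; first exact: measurable_funM.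
by exists (K * M) => s sL; rewrite normrM ler_pM ?fK ?gM.
Qed.

Lemma bmN L f : bm L f -> bm L (fun s => - f s).
Proof.
move=> bf; rewrite (_ : (fun s => - f s) = (fun s => (-1) * f s)).
  by apply: bmM => //; exact: bm_cst.
by apply/funext => s; rewrite mulN1r.
Qed.

Lemma bmB L f g : bm L f -> bm L g -> bm L (fun s => f s - g s).
Proof. by move=> bf bg; apply: bmD => //; exact: bmN. Qed.

Lemma bm_norm L f : bm L f -> bm L (fun s => `|f s|).
Proof.
move=> [mf [K fK]]; split; first exact: measurableT_comp.
by exists K => s sL; rewrite normr_id fK.
Qed.

Lemma continuous_bounded f x y : continuous f ->
  exists2 K, 0 < K & forall s, x <= s <= y -> `|f s| <= K.
Proof.
move=> cf; have cfw : {within `[x, y], continuous f} by exact: continuous_subspaceT.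
have := continuous_compact cfw (segment_compact (a := x) (b := y)).
move=> /compact_bounded [M [_ Mb]].
exists (`|M| + 1); first by rewrite ltr_wpDl.
move=> s sxy; apply: (Mb (`|M| + 1)).
  by rewrite (le_lt_trans (ler_norm M))// ltrDl.
by exists s => //=; rewrite in_itv.
Qed.

Lemma ctsD f g : continuous f -> continuous g -> continuous (fun s => f s + g s).
Proof. by move=> cf cg s; exact: (cvgD (cf s) (cg s)). Qed.

Lemma ctsB f g : continuous f -> continuous g -> continuous (fun s => f s - g s).
Proof. by move=> cf cg s; exact: (cvgB (cf s) (cg s)). Qed.

Lemma ctsM f g : continuous f -> continuous g -> continuous (fun s => f s * g s).
Proof. by move=> cf cg s; exact: (cvgM (cf s) (cg s)). Qed.

Lemma ctsC (c : R) : continuous (fun _ : R => c).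
Proof. by move=> s; exact: cvg_cst. Qed.

Lemma bm_continuous L f : continuous f -> bm L f.
Proof.
move=> cf; split.
  by apply: measurable_funS (continuous_measurable_fun cf).
by have [K K0 fK] := continuous_bounded 0 L cf; exists K.
Qed.

Lemma RintD L f g x y : bm L f -> bm L g -> 0 <= x -> y <= L ->
  Rint x y (fun s => f s + g s) = Rint x y f + Rint x y g.
Proof. by move=> bf bg x0 yL; rewrite /Rint RintegralD//; exact: bm_integrable yL. Qed.

Lemma RintB L f g x y : bm L f -> bm L g -> 0 <= x -> y <= L ->
  Rint x y (fun s => f s - g s) = Rint x y f - Rint x y g.
Proof. by move=> bf bg x0 yL; rewrite /Rint RintegralB//; exact: bm_integrable yL. Qed.

Lemma RintZ L c f x y : bm L f -> 0 <= x -> y <= L ->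
  Rint x y (fun s => c * f s) = c * Rint x y f.
Proof. by move=> bf x0 yL; rewrite /Rint RintegralZl//; exact: bm_integrable yL. Qed.

Lemma le_Rint L f g x y : bm L f -> bm L g -> 0 <= x -> y <= L ->
  (forall s, x <= s <= y -> f s <= g s) -> Rint x y f <= Rint x y g.
Proof.
move=> bf bg x0 yL fg; rewrite /Rint; apply: le_Rintegral => //.
- exact: (bm_integrable bf).
- exact: (bm_integrable bg).
Qed.

Lemma eq_Rint f g x y : (forall s, x <= s <= y -> f s = g s) -> Rint x y f = Rint x y g.
Proof.
by move=> fg; rewrite /Rint; apply: eq_Rintegral => s; rewrite inE /= in_itv; exact: fg.
Qed.

Lemma Rint_cst x y c : x <= y -> Rint x y (fun=> c) = c * (y - x).
Proof.
move=> xy; rewrite /Rint Rintegral_cst//= lebesgue_measure_itv /= lte_fin.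
move: xy; rewrite le_eqVlt => /predU1P[->|->] //; by rewrite ltxx subrr.
Qed.

Lemma Rint_ge0 f x y : (forall s, x <= s <= y -> 0 <= f s) -> 0 <= Rint x y f.
Proof. by move=> f0; apply: Rintegral_ge0 => s /=; rewrite in_itv; exact: f0. Qed.

Lemma le_cst_Rint L f c x y : bm L f -> 0 <= x -> x <= y -> y <= L ->
  (forall s, x <= s <= y -> c <= f s) -> c * (y - x) <= Rint x y f.
Proof.
by move=> bf x0 xy yL fc; rewrite -Rint_cst//; apply: (@le_Rint L) => //; exact: bm_cst.
Qed.

Lemma Rint_le_cst L f c x y : bm L f -> 0 <= x -> x <= y -> y <= L ->
  (forall s, x <= s <= y -> f s <= c) -> Rint x y f <= c * (y - x).
Proof.
by move=> bf x0 xy yL fc; rewrite -Rint_cst//; apply: (@le_Rint L) => //; exact: bm_cst.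
Qed.

Lemma Rint_same x f : Rint x x f = 0.
Proof. by rewrite /Rint set_itv1 Rintegral_set1. Qed.

Lemma le_norm_Rint L f K x y : bm L f -> 0 <= x -> x <= y -> y <= L ->
  (forall s, x <= s <= y -> `|f s| <= K) -> `|Rint x y f| <= K * (y - x).
Proof.
move=> bf x0 xy yL fK; rewrite ler_norml -mulNr -!Rint_cst//.
apply/andP; split; apply: (@le_Rint L) => //; try exact: bm_cst.
  by move=> s /fK; rewrite ler_norml => /andP[].
by move=> s /fK; rewrite ler_norml => /andP[].
Qed.

Lemma Rint_chasles L f x y z : bm L f -> 0 <= x -> x <= y -> y <= z -> z <= L ->
  Rint x z f = Rint x y f + Rint y z f.
Proof.
move=> bf x0 xy yz zL; rewrite /Rint.
have := @Rintegral_itvB R f (BLeft x) (BRight z) y.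
move=> /(_ (bm_integrable bf x0 zL)); rewrite !bnd_simp => /(_ xy yz) /eqP.
rewrite subr_eq addrC => /eqP ->; congr (_ + _).
rewrite Rintegral_itv_obnd_cbnd//; 
have sub : `]y, z]%classic `<=` `[y, z]%classic by apply: subset_itv; rewrite bnd_simp.
by apply: integrableS (bm_integrable bf (le_trans x0 xy) zL).
Qed.

Lemma le_Rint_norm L f x y : bm L f -> 0 <= x -> y <= L ->
  `|Rint x y f| <= Rint x y (fun s => `|f s|).
Proof.
by move=> bf x0 yL; apply: le_normr_Rintegral => //; exact: bm_integrable yL.
Qed.

Lemma Rint_FTC f F x y : x <= y -> continuous f ->
  (forall s, is_derive s 1 F (f s)) -> Rint x y f = F y - F x.
Proof.
rewrite le_eqVlt => /predU1P[->|xy] cf dF; first by rewrite Rint_same subrr.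
have dF1 s : derivable F s 1 by have [] := dF s.
have cF : continuous F.
  by move=> s; exact/differentiable_continuous/derivable1_diffP.
rewrite /Rint /Rintegral (@continuous_FTC2 _ f F)//.
- exact: continuous_subspaceT.
- split; first by move=> *.
    exact: cvg_at_right_filter (cF _).
  exact: cvg_at_left_filter (cF _).
- by move=> s _; exact: is_derive_derive1.
Qed.

Definition clamp L s := Num.max 0 (Num.min s L).

Lemma clampE L s : 0 <= s <= L -> clamp L s = s.
Proof. by rewrite /clamp => /andP[s0 sL]; rewrite min_l// max_r. Qed.

Lemma clamp_in L s : 0 <= L -> 0 <= clamp L s <= L.
Proof. by move=> L0; rewrite /clamp le_max lexx ge_max L0 ge_min lexx orbT. Qed.

Lemma clamp_mono L s y : s <= y -> clamp L s <= clamp L y <= clamp L s + (y - s).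
Proof. by rewrite /clamp !maxEle !minEle => sy; do !case: ifP; lra. Qed.

(** Clamping the upper end makes the primitive Lipschitz on all of R, although [f] is only
    controlled on [0, L]; the Picard iterates are thus continuous functions on R. *)
Definition prim L f s := Rint 0 (clamp L s) f.

Lemma primE L f s : 0 <= s <= L -> prim L f s = Rint 0 s f.
Proof. by move=> sL; rewrite /prim clampE. Qed.

Lemma prim_lip L f K : 0 <= L -> bm L f -> (forall s, 0 <= s <= L -> `|f s| <= K) ->
  forall s y, s <= y -> `|prim L f y - prim L f s| <= K * (y - s).
Proof.
move=> L0 bf fK s y sy; rewrite /prim.
have /andP[s0 sL] := clamp_in s L0; have /andP[y0 yL] := clamp_in y L0.
have /andP[c1 c2] := clamp_mono L sy.
rewrite (@Rint_chasles L f 0 (clamp L s) (clamp L y))// addrAC subrr add0r.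
apply: (@le_trans _ _ (K * (clamp L y - clamp L s))).
  apply: (@le_norm_Rint L) => // t /andP[t0 tL]; apply: fK; lra.
apply: ler_wpM2l; last lra.
by apply: le_trans (fK 0 _) => //; rewrite lexx.
Qed.

Lemma lip_continuous f K : (forall s y, s <= y -> `|f y - f s| <= K * (y - s)) ->
  continuous f.
Proof.
move=> fK; have fK' s y : `|f s - f y| <= (`|K| + 1) * `|s - y|.
  have KK : K <= `|K| + 1 by rewrite (le_trans (ler_norm _))// lerDl.
  have [sy|ys] := leP s y.
    rewrite distrC (distrC s) (ger0_norm (_ : 0 <= y - s)) ?subr_ge0//.
    by apply: le_trans (fK _ _ sy) _; apply: ler_wpM2r => //; rewrite subr_ge0.
  have {}ys := ltW ys.
  rewrite (ger0_norm (_ : 0 <= s - y)) ?subr_ge0//.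
  by apply: le_trans (fK _ _ ys) _; apply: ler_wpM2r => //; rewrite subr_ge0.
have K0 : 0 < `|K| + 1 by rewrite ltr_wpDl.
move=> s; apply/cvgrPdist_le => /= e e0; near=> y.
apply: le_trans (fK' _ _) _; rewrite mulrC -ler_pdivlMr//.
near: y; apply: cvgr_dist_le; [exact: cvg_id|exact: divr_gt0].
Unshelve. all: by end_near. Qed.

Lemma prim_continuous L f : 0 <= L -> bm L f -> continuous (prim L f).
Proof.
by move=> L0 bf; have [_ [K fK]] := bf; exact: lip_continuous (prim_lip L0 bf fK).
Qed.

End Integral.

(** * Approximation by smooth functions, and integration by parts for primitives of bounded
    functions *)

Section Density.
Context {R : realType}.
Implicit Types (f g t h : R -> R) (L K x y z s e : R).
Local Notation leb := (@lebesgue_measure R).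

(** The value is a convex combination of [t x] and [t y], since [sstep] lies in [0, 1]. *)
Lemma sstep_lip t K (x y : R) : x < y -> (forall s, `|t s| <= K) -> forall s,
  `|t x + (t y - t x) * sstep ((s - x) / (y - x))| <= K.
Proof.
move=> xy tK s; set c := sstep _.
have c0 : 0 <= c := sstep_ge0 _; have c1 : c <= 1 := sstep_le1 _.
move: (tK x) (tK y); rewrite !ler_norml => /andP[? ?] /andP[? ?].
by apply/andP; split; nra.
Qed.

(** By continuous induction: [P x] asks for a smooth approximation on [0, x] which is frozen at the
    value [t x] beyond x. A smooth step glues on a further interval where t oscillates by at most e,
    so the supremum of such x cannot be smaller than L. *)
Lemma smooth_unif L t K e : 0 <= L -> continuous t -> (forall s, `|t s| <= K) ->
  0 < e -> exists S, [/\ smooth S, forall s, `|S s| <= K &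
    forall s, 0 <= s <= L -> `|S s - t s| <= e].
Proof.
move=> L0 ct tK e0.
pose P x := 0 <= x <= L /\ exists S, [/\ smooth S, forall s, `|S s| <= K,
  (forall s, 0 <= s <= x -> `|S s - t s| <= e) & forall s, x <= s -> S s = t x].
have P0 : P 0.
  split; first by rewrite lexx.
  exists (fun=> t 0); split => //.
  - by apply/smoothP => n; exact: Ck_cst.
  - by move=> s /andP[s0 s1]; rewrite (_ : s = 0) ?subrr ?normr0 ?ltW//; lra.
have step x y : P x -> x < y -> y <= L ->
    (forall r r', x <= r <= y -> x <= r' <= y -> `|t r - t r'| <= e) -> P y.
  move=> [/andP[x0 xL] [S [sS SK St Sx]]] xy yL osc; split; first lra.
  exists (fun s => S s + (t y - t x) * sstep ((s - x) / (y - x))); split.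
  - apply/smoothP => n; apply: CkD; first exact: smooth_Ck.
    apply: CkM; first exact: Ck_cst.
    apply: (@Ck_comp _ n (fun s => (s - x) / (y - x))); first by move=> m; apply: smooth_Ck; exact: smooth_sstep.
    by apply: CkM; [apply: CkB; [exact: Ck_id|exact: Ck_cst]|exact: Ck_cst].
  - move=> s; have [sx|xs] := leP s x.
      rewrite sstep0 ?mulr0 ?addr0//.
      by rewrite ler_pdivrMr ?mul0r ?subr_le0// subr_gt0.
    by rewrite Sx; [exact: sstep_lip|exact: ltW].
  - move=> s /andP[s0 sy]; have [sx|xs] := leP s x.
      rewrite sstep0 ?mulr0 ?addr0 ?St ?s0//.
      by rewrite ler_pdivrMr ?mul0r ?subr_le0// subr_gt0.
    rewrite Sx; last exact: ltW.
    set c := sstep _.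
    have c0 : 0 <= c := sstep_ge0 _; have c1 : c <= 1 := sstep_le1 _.
    have h1 := osc x s; have h2 := osc y s.
    have sI : x <= s <= y by rewrite (ltW xs).
    have {}h1 := h1 ltac:(by rewrite lexx ltW) sI; have {}h2 := h2 ltac:(by rewrite lexx ltW) sI.
    move: h1 h2; clear -c0 c1; rewrite !ler_norml => /andP[? ?] /andP[? ?].
    by apply/andP; split; nra.
  - move=> s ys; rewrite Sx ?sstep1 ?mulr1; try lra.
    by rewrite ler_pdivlMr; lra.
suff : P L by move=> [_ [S [sS SK St _]]]; exists S.
have PB : has_sup [set x | P x].
  by split; [exists 0|exists L => x [/andP[]]].
pose c := sup [set x | P x].
have c0 : 0 <= c by apply: sup_ubound => //; case: PB.
have cL : c <= L by apply: ge_sup; [exists 0|move=> x [/andP[]]].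
have [d d0 td] : exists2 d : R, 0 < d & forall r, `|r - c| < d -> `|t r - t c| <= e / 2.
  have /cvgrPdist_le /(_ (e / 2)) := ct c.
  move=> /(_ ltac:(lra)) [d /= d0 hd]; exists d => // r rd.
  by rewrite distrC; apply: hd; rewrite /= distrC.
have osc r r' : `|r - c| < d -> `|r' - c| < d -> `|t r - t r'| <= e.
  move=> /td h1 /td h2.
  have -> : t r - t r' = (t r - t c) - (t r' - t c) by lra.
  by rewrite (le_trans (ler_normB _ _))//; clear -h1 h2; lra.
have [x Px cx] : exists2 x, P x & c - d < x by exact: sup_adherent.
have xc : x <= c by apply: sup_ubound => //; case: PB.
have [_ _] := Px.
have [Lc|cltL] := leP L (c + d / 2).
  have [xL|Lx] := ltP x L.
    apply: step Px xL _ _ => // r r' rx r'x.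
    by apply: osc; rewrite ltr_norml; clear -rx r'x xc cx Lc d0 cL; apply/andP; split; lra.
  by have -> // : L = x by (case: Px => /andP[]; lra).
have Py : P (c + d / 2).
  apply: step Px _ _ _ => //; try lra.
  by move=> r r' rx r'x; apply: osc; rewrite ltr_norml; clear -rx r'x xc cx d0; apply/andP; split; lra.
have : c + d / 2 <= c by apply: sup_ubound => //; case: PB.
by lra.
Qed.

(** The projection onto [-K, K] does not increase distances and fixes [u]. *)
Lemma clip_dist (u v K : R) : `|u| <= K ->
  `|u - Num.max (- K) (Num.min K v)| <= `|u - v|.
Proof.
rewrite ler_norml => /andP[g1 g2]; rewrite ler_norml !maxEle !minEle.
by case: (ger0P (u - v)); do ?case: ifP; move=> *; apply/andP; split; lra.
Qed.

(** A continuous approximation in L^1 is clipped to [-K, K], then smoothed uniformly. Keeping the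
    bound K later turns smallness in L^1 into smallness in L^2. *)
Lemma smooth_L1_dense L g K e : 0 <= L -> bm L g ->
  (forall s, 0 <= s <= L -> `|g s| <= K) -> 0 < e ->
  exists h, [/\ smooth h, forall s, `|h s| <= K &
    Rint 0 L (fun s => `|g s - h s|) <= e].
Proof.
move=> L0 bg gK e0.
have K0 : 0 <= K by apply: le_trans (gK 0 _); rewrite ?lexx.
have := @approximation_continuous_integrable R `[0, L] g.
have fin : (leb `[0%R, L]%classic < +oo)%E.
  by rewrite /= lebesgue_measure_itv /= lte_fin; case: ifP => _; rewrite ltry.
have ig : leb.-integrable `[0, L] (EFin \o g) by exact: bm_integrable bg _ _.
move=> /(_ (measurable_itv _) fin ig) [h [ch ih]].
move=> /fine_cvgP[_ /cvgrPdist_lt /(_ (e / 2))].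
move=> /(_ ltac:(lra)) [n _ /(_ n (leqnn n)) /=]; rewrite sub0r normrN => hn.
have bh : bm L (h n) by exact: bm_continuous.
have e1 : Rint 0 L (fun s => `|g s - h n s|) <= e / 2.
  by apply: ltW; apply: le_lt_trans hn; exact: ler_norm.
pose t s := Num.max (- K) (Num.min K (h n s)).
have tc : continuous t.
  move=> s; apply: (@continuous_max _ _ (fun=> - K) (fun s => Num.min K (h n s)) s).
    exact: cvg_cst.
  apply: (@continuous_min _ _ (fun=> K) (h n) s); [exact: cvg_cst|exact: ch].
have tK s : `|t s| <= K.
  by rewrite /t maxEle minEle ler_norml; do !case: ifP; lra.
have [S [sS SK St]] := @smooth_unif L t K (e / 2 / (L + 1)) L0 tc tK ltac:(by rewrite !divr_gt0//; lra).
exists S; split => //.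
have bt : bm L t by exact: bm_continuous.
have bS : bm L S by apply: bm_continuous; exact: smooth_continuous.
apply: (@le_trans _ _ (Rint 0 L (fun s => `|g s - h n s| + e / 2 / (L + 1)))).
  apply: (@le_Rint _ L) => //.
  - by apply: bm_norm; exact: bmB.
  - by apply: bmD; [apply: bm_norm; exact: bmB|exact: bm_cst].
  move=> s sL; have -> : g s - S s = (g s - t s) - (S s - t s) by lra.
  apply: le_trans (ler_normB _ _) _; apply: lerD; last exact: St.
  by apply: clip_dist; exact: gK.
rewrite (@RintD _ L) => //; last 2 first.
- by apply: bm_norm; exact: bmB.
- exact: bm_cst.
rewrite Rint_cst// subr0.
have : e / 2 / (L + 1) * L <= e / 2.
  rewrite -mulrA ler_piMr; [by []|lra|].
  by rewrite mulrC ler_pdivrMr; lra.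
by lra.
Qed.

Lemma primitive_exists h c : continuous h ->
  exists F, F 0 = c /\ forall s, is_derive s 1 F (h s).
Proof.
move=> ch.
have ih a b : leb.-integrable `[a, b] (EFin \o h).
  apply: continuous_compact_integrable; first exact: segment_compact.
  exact: continuous_subspaceT.
have chas a x y : a <= x -> x <= y -> Rint a y h = Rint a x h + Rint x y h.
  move=> ax xy; rewrite /Rint.
  have := @Rintegral_itvB R h (BLeft a) (BRight y) x (ih _ _).
  rewrite !bnd_simp => /(_ ax xy) /eqP; rewrite subr_eq addrC => /eqP ->.
  congr (_ + _); rewrite Rintegral_itv_obnd_cbnd//.
  have sub : `]x, y]%classic `<=` `[x, y]%classic by apply: subset_itv; rewrite bnd_simp.
  by apply: integrableS (ih x y).
(* [Rint] vanishes over reversed intervals, so both integrals start from a point to the left of 0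
   and of [s]; by [FN] their difference does not depend on that point. *)
pose N s := - (`|s| + 1) : R.
pose F s := c + (Rint (N s) s h - Rint (N s) 0 h).
have FN a s : a <= N s -> F s = c + (Rint a s h - Rint a 0 h).
  move=> aN; have := ler_norm s; have := ler_norm (- s); have := normr_ge0 s.
  rewrite normrN /F /N in aN * => n0 n1 n2.
  by rewrite (chas a (- (`|s| + 1)) s) ?(chas a (- (`|s| + 1)) 0); lra.
exists F; split; first by rewrite /F subrr addr0.
move=> s.
pose a := - (`|s| + 2).
have nF : \near s, c + (Rint a s h - Rint a 0 h) = F s.
  near=> r; rewrite -FN// /a /N lerN2.
  have : `|s - r| <= 1 by near: r; apply: cvgr_dist_le; [exact: cvg_id|].
  have := ler_distD s r 0; rewrite !subr0 (distrC r); lra.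
apply: (near_eq_is_derive nF).
have sa : a < s.
  by rewrite /a ltrNl; have := ler_norm (- s); rewrite normrN; lra.
have [] := @continuous_FTC1 R h (BLeft a) s (s + 1) ltac:(lra) (ih _ _) _ (ch s).
  by rewrite lte_fin.
move=> d1 d2.
have dd : is_derive s 1 (fun x => Rint a x h) (h s).
  by rewrite -d2; exact: derivable_is_derive1.
apply: is_derive_congr (is_derive1D (is_derive1_cst c s) (is_derive1B dd (is_derive1_cst (Rint a 0 h) s))) _.
by rewrite subr0 add0r.
Unshelve. all: by end_near. Qed.

Lemma smooth_primitive h F : smooth h -> (forall s, is_derive s 1 F (h s)) -> smooth F.
Proof.
move=> /smoothP sh dF; apply/smoothP => -[//|n]; exact: CkS dF (sh n).
Qed.

Lemma is_derive_continuous F h : (forall s : R, is_derive s 1 F (h s)) -> continuous F.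
Proof.
by move=> dF s; apply/differentiable_continuous/derivable1_diffP; case: (dF s).
Qed.

(** Here G is only a primitive of a bounded measurable function. Replacing g by a smooth h close to
    it in L^1 moves the primitive uniformly little, and the classical formula holds for h. *)
Lemma Rint_ibp L g G phi psi x y : bm L g ->
  (forall s, 0 <= s <= L -> G s = G 0 + Rint 0 s g) -> bm L G ->
  continuous psi -> (forall s, is_derive s 1 phi (psi s)) ->
  0 <= x -> x <= y -> y <= L ->
  Rint x y (fun s => g s * phi s) =
    G y * phi y - G x * phi x - Rint x y (fun s => G s * psi s).
Proof.
move=> bg Gg bG cpsi dphi x0 xy yL.
have L0 : 0 <= L by lra.
have cphi := is_derive_continuous dphi.
have [K1 K10 K1P] := continuous_bounded 0 L cphi.
have [K2 K20 K2P] := continuous_bounded 0 L cpsi.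
have [_ [K gK]] := bg.
(* Error budget: K1 for each of the two end points and for the integral of (g - h) phi, L K2 for the
   integral of (G - H) psi. *)
suff main e : 0 < e -> `|Rint x y (fun s => g s * phi s) -
    (G y * phi y - G x * phi x - Rint x y (fun s => G s * psi s))| <=
    e * (3 * K1 + L * K2).
  apply/eqP; rewrite -subr_eq0 -normr_le0; apply/ler_addgt0Pl => e e0; rewrite addr0.
  have D0 : 0 < 3 * K1 + L * K2 by rewrite ltr_pwDl ?mulr_ge0 ?mulr_gt0// ltW.
  by apply: le_trans (main (e / (3 * K1 + L * K2)) (divr_gt0 e0 D0)) _; rewrite divfK// gt_eqF.
move=> e0.
have [h [sh hK he]] := smooth_L1_dense L0 bg gK e0.
have ch := smooth_continuous sh.
have [H [H0 dH]] := primitive_exists (G 0) ch.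
have cH := is_derive_continuous dH.
have bh := bm_continuous L ch; have bH := bm_continuous L cH.
have bphi := bm_continuous L cphi; have bpsi := bm_continuous L cpsi.
have HG s : 0 <= s <= L -> `|H s - G s| <= e.
  move=> sL; have /andP[s0 sL'] := sL.
  have -> : H s = G 0 + Rint 0 s h by rewrite (Rint_FTC s0 ch dH) H0; lra.
  rewrite (Gg s sL) opprD addrACA subrr add0r -(@RintB _ L)//.
  apply: le_trans (le_Rint_norm (L := L) _ _ _) _ => //; first exact: bmB.
  apply: le_trans he.
  have bn : bm L (fun s => `|g s - h s|) by apply: bm_norm; exact: bmB.
  rewrite (@Rint_chasles _ L _ 0 s L) => //.
  under eq_Rint do rewrite distrC.
  rewrite lerDl; apply: Rintegral_ge0 => ? _; exact: normr_ge0.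
have FT : Rint x y (fun s => h s * phi s + H s * psi s) = H y * phi y - H x * phi x.
  apply: (Rint_FTC (F := fun s => H s * phi s)) => //.
    by apply: ctsD; exact: ctsM.
  by move=> s; exact: is_derive1M.
have bhp := bmM bh bphi; have bHp := bmM bH bpsi.
have bgp := bmM bg bphi; have bGp := bmM bG bpsi.
rewrite (@RintD _ L) // in FT.
have D1 : Rint x y (fun s => g s * phi s) - Rint x y (fun s => h s * phi s) =
    Rint x y (fun s => (g s - h s) * phi s).
  by rewrite -(@RintB _ L)//; apply: eq_Rint => s _; rewrite mulrBl.
have D2 : Rint x y (fun s => G s * psi s) - Rint x y (fun s => H s * psi s) =
    Rint x y (fun s => (G s - H s) * psi s).
  by rewrite -(@RintB _ L)//; apply: eq_Rint => s _; rewrite mulrBl.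
have bgh := bmB bg bh.
have bn := bm_norm bgh.
have E1 : `|Rint x y (fun s => (g s - h s) * phi s)| <= e * K1.
  apply: le_trans (le_Rint_norm (L := L) _ _ _) _ => //; first exact: bmM.
  apply: (@le_trans _ _ (Rint x y (fun s => K1 * `|g s - h s|))).
    apply: (@le_Rint _ L) => //.
    - by apply: bm_norm; exact: bmM.
    - by apply: bmM => //; exact: bm_cst.
    move=> s sxy; rewrite normrM mulrC; apply: ler_wpM2r => //; apply: K1P; lra.
  rewrite (@RintZ _ L)// mulrC; apply: ler_wpM2r; first exact: ltW.
  apply: le_trans he.
  have ge0 a b : 0 <= Rint a b (fun s => `|g s - h s|) by apply: Rintegral_ge0.
  rewrite (@Rint_chasles _ L _ 0 x L)//; try lra.
  by rewrite (@Rint_chasles _ L _ x y L)//; have := ge0 0 x; have := ge0 y L; clear; lra.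
have E2 : `|Rint x y (fun s => (G s - H s) * psi s)| <= e * (L * K2).
  apply: le_trans (_ : _ <= (e * K2) * (y - x)) _.
    apply: (@le_norm_Rint _ L) => //; first by apply: bmM => //; exact: bmB.
    move=> s sxy; rewrite normrM distrC; apply: ler_pM => //; [apply: HG|apply: K2P]; lra.
  rewrite -mulrA; apply: ler_wpM2l; first exact: ltW.
  by rewrite mulrC; apply: ler_wpM2r; [exact: ltW|lra].
have E3 a : 0 <= a <= L -> `|H a * phi a - G a * phi a| <= e * K1.
  by move=> aL; rewrite -mulrBl normrM; apply: ler_pM => //; [exact: HG|exact: K1P].
have := E3 y ltac:(lra); have := E3 x ltac:(lra).
rewrite -D1 in E1; rewrite -D2 in E2.
move: E1 E2; have K10' := ltW K10; clear -FT e0 K10'; rewrite !ler_norml => /andP[? ?] /andP[? ?] /andP[? ?] /andP[? ?].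
by apply/andP; split; lra.
Qed.

End Density.

(** * Linear systems with bounded measurable coefficients *)

Section Volterra.
Context {R : realType}.
Implicit Types (D v z alpha beta : R -> R) (L K c s : R).

Lemma one_le_expR (x : R) : 0 <= x -> 1 <= expR x.
Proof. by move=> x0; rewrite -[leLHS]expR0 ler_expR. Qed.

Lemma Rint_expR (k s : R) : 0 < k -> 0 <= s ->
  Rint 0 s (fun r => expR (k * r)) = (expR (k * s) - 1) / k.
Proof.
move=> k0 s0.
have dF (r : R) : is_derive r 1 (fun r => k^-1 * expR (k * r)) (expR (k * r)).
  apply: is_derive_congr (is_derive1Z k^-1
    (is_derive1_o (is_derive_expR _) (is_derive1_mulr k r))) _.
  by rewrite mulrCA mulVf ?mulr1// gt_eqF.
rewrite (Rint_FTC s0 _ dF); first by rewrite mulr0 expR0 -mulrBr mulrC.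
have d (r : R) : is_derive r 1 (fun r => expR (k * r)) (expR (k * r) * k).
  exact: is_derive1_o (is_derive_expR _) (is_derive1_mulr k r).
exact: is_derive_continuous d.
Qed.

Lemma bm_expR L (k : R) : bm L (fun r => expR (k * r)).
Proof.
apply: bm_continuous.
have d (r : R) : is_derive r 1 (fun r => expR (k * r)) (expR (k * r) * k).
  exact: is_derive1_o (is_derive_expR _) (is_derive1_mulr k r).
exact: is_derive_continuous d.
Qed.

(* The weight [e^{2 K s}] makes the integral operator a contraction of rate 1/2. *)
Lemma Rint_weight L K D m s : 0 < K -> bm L D -> 0 <= s <= L -> 0 <= m ->
  (forall r, 0 <= r <= s -> D r <= m * expR (2 * K * r)) ->
  K * Rint 0 s D <= m / 2 * expR (2 * K * s) - m / 2.
Proof.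
move=> K0 bD /andP[s0 sL] m0 Dm; have K20 : 0 < 2 * K by lra.
apply: (@le_trans _ _ (K * Rint 0 s (fun r => m * expR (2 * K * r)))).
  rewrite ler_pM2l//; apply: (@le_Rint _ L) => //.
  by apply: bmM; [exact: bm_cst|exact: bm_expR].
rewrite (@RintZ _ L)//; last exact: bm_expR.
rewrite Rint_expR// le_eqVlt; apply/orP; left; apply/eqP.
by field; rewrite gt_eqF.
Qed.

(** Let m be the supremum of [D s] divided by the weight. Then [Rint_weight] gives m <= c + m / 2,
    whence the factor 2 and the doubled rate. *)
Lemma gronwall L K D c : 0 < K -> 0 <= c -> bm L D -> (forall s, 0 <= D s) ->
  (forall s, 0 <= s <= L -> D s <= c + K * Rint 0 s D) ->
  forall s, 0 <= s <= L -> D s <= 2 * c * expR (2 * K * s).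
Proof.
move=> K0 c0 bD D0 Dc s sL; have [_ [B DB]] := bD.
pose W := [set D r / expR (2 * K * r) | r in [set r | 0 <= r <= L]].
have supW : has_sup W.
  split; first by exists (D s / expR (2 * K * s)), s.
  exists B => _ [r /= rL <-]; rewrite ler_pdivrMr ?expR_gt0//.
  have B0 : 0 <= B by apply: le_trans (DB _ rL).
  apply: (le_trans (le_trans (ler_norm _) (DB _ rL))).
  rewrite ler_peMr// one_le_expR// !mulr_ge0//; lra.
pose m := sup W.
have Dm r : 0 <= r <= L -> D r <= m * expR (2 * K * r).
  move=> rL; rewrite -ler_pdivrMr ?expR_gt0//.
  by apply: sup_upper_bound => //; exists r.
have m0 : 0 <= m.
  apply: le_trans (_ : D s / expR (2 * K * s) <= _).
    by rewrite divr_ge0 ?expR_ge0.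
  by apply: sup_upper_bound => //; exists s.
have : m <= c + m / 2.
  apply: ge_sup; first by case: supW.
  move=> _ [r /= rL <-]; rewrite ler_pdivrMr ?expR_gt0//.
  have rL' := rL; move: rL' => /andP[r0 rL'].
  apply: le_trans (Dc _ rL) _.
  have := @Rint_weight L K D m r K0 bD rL m0 ltac:(move=> t tr; apply: Dm; lra).
  have : 1 <= expR (2 * K * r) by rewrite one_le_expR// !mulr_ge0//; lra.
  by nra.
move=> mc; apply: le_trans (Dm _ sL) _; apply: ler_wpM2r; first exact: expR_ge0.
by lra.
Qed.

Lemma cvg_half_pow (C : R) : C / 2 ^+ n @[n --> \oo] --> (0 : R).
Proof.
have h := @cvg_geometric R C 2^-1.
have -> : (fun n => C / 2 ^+ n) = geometric C 2^-1.
  by apply/funext => n; rewrite /geometric /= exprVn.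
by apply: h; rewrite ger0_norm ?invr_ge0// invf_lt1// ltr1n.
Qed.

Lemma le_half_pow (a C : R) : (forall n, a <= C / 2 ^+ n) -> a <= 0.
Proof.
move=> aC; apply: (@ler_cvg_to _ _ _ _ (fun=> a) (fun n => C / 2 ^+ n) a 0 (cvg_cst _) (cvg_half_pow C)).
by near=> n; exact: aC.
Unshelve. all: by end_near. Qed.

(* Sandwiches the limit between [u_n - 2C/2^n] and [u_n + 2C/2^n]. *)
Lemma half_pow_limit (u : nat -> R) (C : R) :
  (forall n, `|u n.+1 - u n| <= C / 2 ^+ n) ->
  exists l, forall n, `|u n - l| <= 2 * C / 2 ^+ n.
Proof.
move=> uC.
have C0 : 0 <= C by move: (uC 0%N); rewrite expr0 divr1; exact: le_trans.
pose a n := u n - 2 * C / 2 ^+ n; pose b n := u n + 2 * C / 2 ^+ n.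
have pS n : 2 * C / 2 ^+ n.+1 = C / 2 ^+ n :> R.
  by rewrite exprS -mulf_div divff ?mul1r// pnatr_eq0.
have pD n : 2 * C / 2 ^+ n = C / 2 ^+ n + C / 2 ^+ n :> R by rewrite -mulrA mulrDl !mul1r.
have aS n : a n <= a n.+1.
  by move: (uC n); rewrite ler_norml /a pS pD => /andP[? ?]; lra.
have bS n : b n.+1 <= b n.
  by move: (uC n); rewrite ler_norml /b pS pD => /andP[? ?]; lra.
have am : nondecreasing_seq a by apply/nondecreasing_seqP.
have bm' : nonincreasing_seq b by apply/nonincreasing_seqP.
have ab n m : a n <= b m.
  have h0 k : a k <= b k.
    rewrite /a /b lerD2l; apply: (@le_trans _ _ 0); first by rewrite oppr_le0 divr_ge0 ?mulr_ge0// exprn_ge0.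
    by rewrite divr_ge0 ?mulr_ge0// exprn_ge0.
  apply: le_trans (am _ _ (leq_maxl n m)) _.
  by apply: le_trans (h0 _) _; apply: bm'; exact: leq_maxr.
have sA : has_sup (range a).
  by split; [exists (a 0%N), 0%N|exists (b 0%N) => _ [n _ <-]].
exists (sup (range a)) => n; rewrite ler_norml; apply/andP; split.
  have : sup (range a) <= b n by apply: ge_sup; [case: sA|move=> _ [m _ <-]].
  by rewrite /b; lra.
have : a n <= sup (range a) by apply: sup_upper_bound => //; exists n.
by rewrite /a; lra.
Qed.

End Volterra.

Section LinearSystem.
Context {R : realType}.
Implicit Types (v z alpha beta : R -> R) (L K s : R).

(* Carathéodory solution of [v' = alpha z], [z' = beta v] with [v(0) = 0], [z(0) = 1]. *)
Definition ivp L alpha beta v z :=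
  [/\ continuous v, continuous z,
      forall s, 0 <= s <= L -> v s = Rint 0 s (fun r => alpha r * z r) &
      forall s, 0 <= s <= L -> z s = 1 + Rint 0 s (fun r => beta r * v r)].

Section Estimates.
Variables (L K : R) (alpha beta : R -> R).
Hypotheses (K0 : 0 < K) (L0 : 0 <= L) (balpha : bm L alpha) (bbeta : bm L beta).
Hypothesis alphaK : forall s, 0 <= s <= L -> `|alpha s| <= K.
Hypothesis betaK : forall s, 0 <= s <= L -> `|beta s| <= K.

Lemma le_Rint_mul (c f : R -> R) s : bm L c -> (forall s, 0 <= s <= L -> `|c s| <= K) ->
  bm L f -> 0 <= s <= L ->
  `|Rint 0 s (fun r => c r * f r)| <= K * Rint 0 s (fun r => `|f r|).
Proof.
have K1 : 0 < K := K0; have L1 : 0 <= L := L0.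
move=> bc cK bf /andP[s0 sL]; have bcf := bmM bc bf.
have bnf := bm_norm bf.
apply: le_trans (le_Rint_norm bcf _ sL) _ => //.
rewrite -(@RintZ _ L)//; apply: (@le_Rint _ L) => //.
- exact: bm_norm.
- by apply: bmM => //; exact: bm_cst.
move=> r rs; rewrite normrM; apply: ler_wpM2r => //; apply: cK; lra.
Qed.

Let step (u : (R -> R) * (R -> R)) : (R -> R) * (R -> R) :=
  (prim L (fun r => alpha r * u.2 r), fun s => 1 + prim L (fun r => beta r * u.1 r) s).

Let seq (n : nat) := iter n step (fun=> 0, fun=> 1).

Let seq_cts n : continuous (seq n).1 /\ continuous (seq n).2.
Proof.
have K1 : 0 < K := K0; have L1 : 0 <= L := L0.
elim: n => [|n [c1 c2]]; first by split; exact: ctsC.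
split; first by apply: prim_continuous => //; apply: bmM => //; exact: bm_continuous.
apply: ctsD; first exact: ctsC.
by apply: prim_continuous => //; apply: bmM => //; exact: bm_continuous.
Qed.

Let D n s := `|(seq n.+1).1 s - (seq n).1 s| + `|(seq n.+1).2 s - (seq n).2 s|.

Let bmD' n : bm L (D n).
Proof.
have K1 : 0 < K := K0; have L1 : 0 <= L := L0.
have [a1 a2] := seq_cts n; have [b1 b2] := seq_cts n.+1.
by apply: bmD; apply: bm_norm; apply: bmB; exact: bm_continuous.
Qed.

(** In the weighted norm of [Rint_weight] the Picard map is a contraction of rate 1/2, so the
    iterates converge geometrically, uniformly on [0, L]. *)
Let D_bound : exists2 C, 0 <= C &
  forall n s, 0 <= s <= L -> D n s <= C / 2 ^+ n * expR (2 * K * s).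
Proof.
have K1 : 0 < K := K0; have L1 : 0 <= L := L0.
have [_ [C DC]] := bmD' 0.
have C0 : 0 <= C by apply: le_trans (DC 0 _); rewrite ?lexx.
exists C => // n; elim: n => [|n IH] s sL.
  rewrite expr0 divr1; apply: (le_trans (le_trans (ler_norm _) (DC _ sL))).
  by rewrite ler_peMr// one_le_expR// !mulr_ge0//; lra.
have [a1 a2] := seq_cts n; have [b1 b2] := seq_cts n.+1.
have [sl sr] := andP sL.
have d1 : bm L (fun r => (seq n.+1).1 r - (seq n).1 r).
  by apply: bmB; exact: bm_continuous.
have d2 : bm L (fun r => (seq n.+1).2 r - (seq n).2 r).
  by apply: bmB; exact: bm_continuous.
have e1 : (seq n.+2).1 s - (seq n.+1).1 s =
    Rint 0 s (fun r => alpha r * ((seq n.+1).2 r - (seq n).2 r)).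
  rewrite /= !primE// -(@RintB _ L)//.
  - by apply: eq_Rint => r _; rewrite mulrBr.
  - by apply: bmM => //; exact: bm_continuous.
  - by apply: bmM => //; exact: bm_continuous.
have e2 : (seq n.+2).2 s - (seq n.+1).2 s =
    Rint 0 s (fun r => beta r * ((seq n.+1).1 r - (seq n).1 r)).
  rewrite /= !primE// opprD addrACA subrr add0r -(@RintB _ L)//.
  - by apply: eq_Rint => r _; rewrite mulrBr.
  - by apply: bmM => //; exact: bm_continuous.
  - by apply: bmM => //; exact: bm_continuous.
have := le_Rint_mul balpha alphaK d2 sL; rewrite -e1.
have := le_Rint_mul bbeta betaK d1 sL; rewrite -e2.
have CC : 0 <= C / 2 ^+ n by rewrite divr_ge0// exprn_ge0.
have IH' r : 0 <= r <= s -> D n r <= C / 2 ^+ n * expR (2 * K * r).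
  by move=> rs; apply: IH; lra.
have H := Rint_weight K0 (bmD' n) sL CC IH'.
rewrite /D (@RintD _ L) in H; [|exact: bm_norm|exact: bm_norm|by []|by []].
have : C / 2 ^+ n.+1 = C / 2 ^+ n / 2 by rewrite exprS invfM mulrA mulrAC.
move=> ->; rewrite /D.
have : 0 <= C / 2 ^+ n / 2 by rewrite !divr_ge0// exprn_ge0.
lra.
Qed.

Lemma ivp_exists : exists v z, ivp L alpha beta v z.
Proof.
have K1 : 0 < K := K0; have L1 : 0 <= L := L0.
have [C C0 DC] := D_bound.
pose C1 := C * expR (2 * K * L).
have DC1 n s : 0 <= s <= L -> D n s <= C1 / 2 ^+ n.
  move=> sL; apply: le_trans (DC n s sL) _.
  rewrite /C1 mulrAC ler_wpM2r ?invr_ge0 ?exprn_ge0// ler_wpM2l// ler_expR.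
  apply: ler_wpM2l; lra.
have lim1 s : exists l, 0 <= s <= L -> forall n, `|(seq n).1 s - l| <= 2 * C1 / 2 ^+ n.
  case: (boolP (0 <= s <= L)) => [sL|_]; last by exists 0.
  have [|l lP] := @half_pow_limit R (fun n => (seq n).1 s) C1; last by exists l.
  by move=> n; apply: le_trans (DC1 n s sL); rewrite lerDl.
have lim2 s : exists l, 0 <= s <= L -> forall n, `|(seq n).2 s - l| <= 2 * C1 / 2 ^+ n.
  case: (boolP (0 <= s <= L)) => [sL|_]; last by exists 0.
  have [|l lP] := @half_pow_limit R (fun n => (seq n).2 s) C1; last by exists l.
  by move=> n; apply: le_trans (DC1 n s sL); rewrite lerDr.
have {lim1} [v vP] := choice lim1.
have {lim2} [z zP] := choice lim2.
have bml (f : R -> R) (g : nat -> R -> R) : (forall n, continuous (g n)) ->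
    (forall s, 0 <= s <= L -> forall n, `|g n s - f s| <= 2 * C1 / 2 ^+ n) -> bm L f.
  move=> cg gf; split; last first.
    have [_ [B gB]] := bm_continuous L (cg 0%N); exists (B + 2 * C1 / 2 ^+ 0) => s sL.
    have -> : f s = g 0%N s - (g 0%N s - f s) by lra.
    by apply: le_trans (ler_normB _ _) _; apply: lerD; [exact: gB|exact: gf].
  apply: (@measurable_fun_cvg _ _ _ _ g).
    by move=> n; apply: measurable_funS (continuous_measurable_fun (cg n)).
  move=> s; rewrite /= in_itv /= => sL; apply/cvgrPdist_le => e e0.
  have /cvgrPdist_le /(_ e e0) := cvg_half_pow (2 * C1).
  apply: filterS => n; rewrite sub0r normrN => h.
  by rewrite distrC; apply: le_trans (gf s sL n) _; apply: le_trans h; exact: ler_norm.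
have bv : bm L v by apply: (bml v (fun n => (seq n).1)) => // n; have [] := seq_cts n.
have bz : bm L z by apply: (bml z (fun n => (seq n).2)) => // n; have [] := seq_cts n.
have baz := bmM balpha bz; have bbv := bmM bbeta bv.
have fix_eq (c f g : R -> R) (gn fn : nat -> R -> R) (a : R) :
    bm L c -> (forall s, 0 <= s <= L -> `|c s| <= K) -> bm L g -> (forall n, continuous (gn n)) ->
    (forall s, 0 <= s <= L -> forall n, `|gn n s - g s| <= 2 * C1 / 2 ^+ n) ->
    (forall s, 0 <= s <= L -> forall n, `|fn n s - f s| <= 2 * C1 / 2 ^+ n) ->
    (forall n s, 0 <= s <= L -> fn n.+1 s = a + Rint 0 s (fun r => c r * gn n r)) ->
    forall s, 0 <= s <= L -> f s = a + Rint 0 s (fun r => c r * g r).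
  move=> bc cK bg cg gn_g fn_f fnS s sL; have [s0 sl] := andP sL.
  apply/eqP; rewrite -subr_eq0 -normr_le0.
  apply: (@le_half_pow _ _ (2 * C1 + K * (2 * C1 * L))) => n.
  have bgn : bm L (gn n) by exact: bm_continuous.
  have -> : f s - (a + Rint 0 s (fun r => c r * g r)) =
     Rint 0 s (fun r => c r * (gn n r - g r)) - (fn n.+1 s - f s).
    rewrite fnS//.
    have -> : Rint 0 s (fun r => c r * (gn n r - g r)) =
      Rint 0 s (fun r => c r * gn n r) - Rint 0 s (fun r => c r * g r).
      rewrite -(@RintB _ L)//; [|exact: bmM|exact: bmM].
      by apply: eq_Rint => r _; rewrite mulrBr.
    by lra.
  apply: le_trans (ler_normB _ _) _.
  have h1 : `|fn n.+1 s - f s| <= 2 * C1 / 2 ^+ n.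
    apply: le_trans (fn_f s sL n.+1) _.
    rewrite ler_wpM2l//; first by rewrite !mulr_ge0// expR_ge0.
    by rewrite lef_pV2 ?posrE ?exprn_gt0// exprS ler_peMl ?exprn_ge0// ler1n.
  have h2 := @le_Rint_mul c (fun r => gn n r - g r) s bc cK (bmB bgn bg) sL.
  have h3 : Rint 0 s (fun r => `|gn n r - g r|) <= 2 * C1 / 2 ^+ n * L.
    apply: (@le_trans _ _ (2 * C1 / 2 ^+ n * (s - 0))).
      apply: le_trans (ler_norm _) _; apply: (@le_norm_Rint _ L) => //.
        by apply: bm_norm; exact: bmB.
      by move=> r rs; rewrite normr_id; apply: gn_g; lra.
    rewrite subr0 ler_wpM2l// divr_ge0 ?exprn_ge0// !mulr_ge0// expR_ge0//.
  have h4 : K * Rint 0 s (fun r => `|gn n r - g r|) <= K * (2 * C1 / 2 ^+ n * L).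
    by rewrite ler_pM2l.
  rewrite mulrDl addrC.
  have -> : K * (2 * C1 * L) / 2 ^+ n = K * (2 * C1 / 2 ^+ n * L) by rewrite -!mulrA (mulrC L).
  by lra.
have ev s : 0 <= s <= L -> v s = 0 + Rint 0 s (fun r => alpha r * z r).
  apply: (fix_eq alpha v z (fun n => (seq n).2) (fun n => (seq n).1)) => //.
    by move=> n; have [] := seq_cts n.
  by move=> n s' sL'; rewrite /= primE// add0r.
have ez s : 0 <= s <= L -> z s = 1 + Rint 0 s (fun r => beta r * v r).
  apply: (fix_eq beta z v (fun n => (seq n).1) (fun n => (seq n).2)) => //.
    by move=> n; have [] := seq_cts n.
  by move=> n s' sL'; rewrite /= primE.
(* The pointwise limits are known on [0, L] only; these primitives agree with them there and are
   continuous on R. *)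
exists (prim L (fun r => alpha r * z r)), (fun s => 1 + prim L (fun r => beta r * v r) s).
split.
- exact: prim_continuous.
- by apply: ctsD; [exact: ctsC|exact: prim_continuous].
- move=> s sL; rewrite primE//; apply: eq_Rint => r rs.
  by rewrite primE -?ez//; lra.
- move=> s sL; rewrite primE//; congr (1 + _); apply: eq_Rint => r rs.
  by rewrite primE ?ev ?add0r//; lra.
Qed.

Lemma ivp_bound v z : ivp L alpha beta v z -> forall s, 0 <= s <= L ->
  `|v s| + `|z s| <= 2 * expR (2 * K * s).
Proof.
have K1 : 0 < K := K0; have L1 : 0 <= L := L0.
move=> [cv cz vE zE] s sL.
have bv := bm_continuous L cv; have bz := bm_continuous L cz.
have := @gronwall R L K (fun s => `|v s| + `|z s|) 1 K0 ltac:(lra).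
rewrite mulr1; apply => //; first by apply: bmD; exact: bm_norm.
move=> r rL; rewrite (@RintD _ L); [|exact: bm_norm|exact: bm_norm|lra|lra].
have := le_Rint_mul balpha alphaK bz rL; rewrite -vE//.
have := le_Rint_mul bbeta betaK bv rL.
have : `|z r| <= 1 + `|Rint 0 r (fun r => beta r * v r)|.
  by rewrite (zE _ rL); apply: le_trans (ler_normD _ _) _; rewrite normr1.
by lra.
Qed.

(** The factor [s] in the bound matters: it makes the infimum of v(s) / s over (0, L], used in
    [shooting], Lipschitz in the energy. *)
Lemma ivp_perturb beta' v z v' z' eta : bm L beta' -> 0 <= eta ->
  (forall s, 0 <= s <= L -> `|beta' s| <= K) ->
  (forall s, 0 <= s <= L -> `|beta s - beta' s| <= eta) ->
  ivp L alpha beta v z -> ivp L alpha beta' v' z' ->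
  (forall s, 0 <= s <= L -> `|v' s| <= 2 * expR (2 * K * L)) ->
  forall s, 0 <= s <= L ->
  `|v s - v' s| <= eta * (K * (4 * L * expR (2 * K * L) ^+ 2)) * s.
Proof.
have K1 : 0 < K := K0; have L1 : 0 <= L := L0.
move=> bbeta' eta0 beta'K bb' [cv cz vE zE] [cv' cz' vE' zE'] v'B.
set E := expR (2 * K * L) in v'B *.
have E0 : 0 < E := expR_gt0 _.
have bv := bm_continuous L cv; have bz := bm_continuous L cz.
have bv' := bm_continuous L cv'; have bz' := bm_continuous L cz'.
have bdv := bmB bv bv'; have bdz := bmB bz bz'.
have Ev s : 0 <= s <= L -> v s - v' s = Rint 0 s (fun r => alpha r * (z r - z' r)).
  move=> sL; have [? ?] := andP sL; rewrite vE// vE'// -(@RintB _ L)//; [|exact: bmM|exact: bmM].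
  by apply: eq_Rint => r _; rewrite mulrBr.
have Ez s : 0 <= s <= L -> z s - z' s = Rint 0 s (fun r => beta r * (v r - v' r)) +
    Rint 0 s (fun r => (beta r - beta' r) * v' r).
  move=> sL; have [? ?] := andP sL; rewrite zE// zE'// opprD addrACA subrr add0r.
  rewrite -(@RintB _ L)//; [|exact: bmM|exact: bmM].
  rewrite -(@RintD _ L)//; [|exact: bmM|by apply: bmM => //; exact: bmB].
  by apply: eq_Rint => r _; lra.
have G := @gronwall R L K (fun s => `|v s - v' s| + `|z s - z' s|) (eta * (2 * E) * L) K0.
have G' s : 0 <= s <= L -> `|z s - z' s| <= eta * (4 * L * E ^+ 2).
  move=> sL; apply: le_trans (_ : _ <= `|v s - v' s| + `|z s - z' s|) _; first by rewrite lerDr.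
  apply: (@le_trans _ _ (2 * (eta * (2 * E) * L) * expR (2 * K * s))).
    apply: G => //.
    - by rewrite !mulr_ge0// ltW.
    - by apply: bmD; exact: bm_norm.
    move=> r rL; rewrite (@RintD _ L); [|exact: bm_norm|exact: bm_norm|lra|lra].
    have := le_Rint_mul balpha alphaK bdz rL; rewrite -Ev//.
    have := le_Rint_mul bbeta betaK bdv rL.
    have h : `|Rint 0 r (fun r => (beta r - beta' r) * v' r)| <= eta * (2 * E) * L.
      apply: (@le_trans _ _ (eta * (2 * E) * (r - 0))).
        apply: (@le_norm_Rint _ L); [by apply: bmM => //; exact: bmB|by []|lra|lra|].
        by move=> t tr; rewrite normrM; apply: ler_pM => //; [apply: bb'|apply: v'B]; lra.
      by apply: ler_wpM2l; [rewrite !mulr_ge0// ltW|lra].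
    have : `|z r - z' r| <= `|Rint 0 r (fun r => beta r * (v r - v' r))| +
      `|Rint 0 r (fun r => (beta r - beta' r) * v' r)| by rewrite Ez//; exact: ler_normD.
    by lra.
  have -> : eta * (4 * L * E ^+ 2) = 2 * (eta * (2 * E) * L) * E by ring.
  apply: ler_wpM2l; first by rewrite !mulr_ge0// ltW.
  by rewrite ler_expR; apply: ler_wpM2l; lra.
move=> s sL; have [s0 sl] := andP sL; rewrite Ev//.
have -> : eta * (K * (4 * L * E ^+ 2)) * s = K * (eta * (4 * L * E ^+ 2)) * (s - 0) by ring.
apply: (@le_norm_Rint _ L) => //; first exact: bmM.
by move=> r rs; rewrite normrM; apply: ler_pM => //; [apply: alphaK|apply: G']; lra.
Qed.

(** Gronwall's argument run backwards from [s0], with the inverse weight, makes v and z vanish on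
    [0, s0], against z(0) = 1. *)
Lemma ivp_no_double_zero v z s0 : ivp L alpha beta v z -> 0 <= s0 <= L ->
  v s0 = 0 -> z s0 = 0 -> False.
Proof.
have K1 : 0 < K := K0; have L1 : 0 <= L := L0.
move=> [cv cz vE zE] s0L v0 z0; have [s00 s0l] := andP s0L.
have bv := bm_continuous L cv; have bz := bm_continuous L cz.
have baz := bmM balpha bz; have bbv := bmM bbeta bv.
pose D' s := `|v s| + `|z s|.
have bD : bm L D' by apply: bmD; exact: bm_norm.
have D'0 s : 0 <= D' s by rewrite addr_ge0.
have bnv := bm_norm bv; have bnz := bm_norm bz.
have Db s : 0 <= s <= s0 -> D' s <= K * Rint s s0 D'.
  move=> /andP[s0' ss0]; rewrite (@RintD _ L)// mulrDr addrC.
  have sL : 0 <= s <= L by lra.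
  have ev : v s = - Rint s s0 (fun r => alpha r * z r).
    have := vE _ s0L; rewrite v0 (@Rint_chasles _ L _ 0 s s0)// -vE//; lra.
  have ez : z s = - Rint s s0 (fun r => beta r * v r).
    have := zE _ s0L; rewrite z0 (@Rint_chasles _ L _ 0 s s0)// addrA -zE//; lra.
  have gen (c f : R -> R) : bm L c -> (forall s, 0 <= s <= L -> `|c s| <= K) -> bm L f ->
      `|Rint s s0 (fun r => c r * f r)| <= K * Rint s s0 (fun r => `|f r|).
    move=> bc cK bf; have bcf := bmM bc bf; have bnf := bm_norm bf.
    apply: le_trans (le_Rint_norm bcf _ s0l) _ => //.
    rewrite -(@RintZ _ L)//; apply: (@le_Rint _ L) => //; [exact: bm_norm|by apply: bmM => //; exact: bm_cst|].
    move=> r rs; rewrite normrM; apply: ler_wpM2r => //; apply: cK; lra.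
  rewrite /D' ev ez !normrN addrC addrC; apply: lerD.
    exact: gen.
  exact: gen.
pose W := [set D' r * expR (2 * K * r) | r in [set r | 0 <= r <= s0]].
have K2 : 0 < 2 * K by lra.
have supW : has_sup W.
  split; first by exists (D' 0 * expR (2 * K * 0)), 0 => //=; rewrite lexx.
  have [_ [B DB]] := bD.
  exists (B * expR (2 * K * s0)) => _ [r /= rs <-]; apply: ler_pM => //.
  - by apply: le_trans (ler_norm _) (DB _ _); lra.
  - by rewrite ler_expR ler_pM2l//; lra.
pose m := sup W.
have Dm r : 0 <= r <= s0 -> D' r * expR (2 * K * r) <= m.
  by move=> rs; apply: sup_upper_bound => //; exists r.
have m0 : 0 <= m.
  apply: le_trans (Dm 0 _); last by rewrite lexx.
  by rewrite mulr_ge0// expR_ge0.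
have Dm' r : 0 <= r <= s0 -> D' r <= m * expR (- (2 * K) * r).
  by move=> rs; rewrite mulNr expRN ler_pdivlMr ?expR_gt0//; exact: Dm.
have m_half : m <= m / 2.
  apply: ge_sup; first by case: supW.
  move=> _ [r /= rs <-].
  have [r0 rs0] := andP rs.
  rewrite -ler_pdivlMr ?expR_gt0//; apply: le_trans (Db r rs) _.
  apply: (@le_trans _ _ (K * Rint r s0 (fun t => m * expR (- (2 * K) * t)))).
    rewrite ler_pM2l//; apply: (@le_Rint _ L) => //.
      by apply: bmM; [exact: bm_cst|exact: bm_expR].
    by move=> t tr; apply: Dm'; lra.
  rewrite (@RintZ _ L)//; last exact: bm_expR.
  have dF (t : R) : is_derive t 1 (fun t => (- (2 * K))^-1 * expR (- (2 * K) * t)) (expR (- (2 * K) * t)).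
    apply: is_derive_congr (is_derive1Z _
      (is_derive1_o (is_derive_expR _) (is_derive1_mulr (- (2 * K)) t))) _.
    by rewrite mulrCA mulVf ?mulr1// oppr_eq0 gt_eqF.
  have ce : continuous (fun t => expR (- (2 * K) * t)).
    have d (t : R) : is_derive t 1 (fun r => expR (- (2 * K) * r)) (expR (- (2 * K) * t) * - (2 * K)).
      exact: is_derive1_o (is_derive_expR _) (is_derive1_mulr _ t).
    exact: is_derive_continuous d.
  rewrite (Rint_FTC rs0 ce dF) -expRN -(mulNr (2 * K) r).
  have -> : m / 2 * expR (- (2 * K) * r) =
     K * (m * ((- (2 * K))^-1 * 0 - (- (2 * K))^-1 * expR (- (2 * K) * r))).
    by field; rewrite gt_eqF.
  rewrite ler_pM2l// ler_wpM2l// lerD2r ler_nM2l ?expR_ge0//.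
  by rewrite invr_lt0 oppr_lt0.
have mz : m = 0 by lra.
have := Dm 0 ltac:(by rewrite lexx); rewrite mz mulr0 expR0 mulr1 /D'.
have := zE 0 ltac:(by rewrite lexx); rewrite Rint_same addr0 => ->.
by rewrite normr1; have := normr_ge0 (v 0); lra.
Qed.

End Estimates.
End LinearSystem.

(** * The ground state *)

Section Comparison.
Context {R : realType}.
Implicit Types (f v z alpha beta d e : R -> R) (L K s : R).

Definition negp (x : R) := Num.max 0 (- x).

Lemma negp_ge0 x : 0 <= negp x. Proof. by rewrite /negp le_max lexx. Qed.

Lemma negp_geN x : - x <= negp x. Proof. by rewrite /negp le_max lexx orbT. Qed.

Lemma bm_negp L f : bm L f -> bm L (fun s => negp (f s)).
Proof.
move=> [mf [K fK]]; split.
  by apply: measurable_maxr; [exact: measurable_cst|exact: measurable_funN].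
exists K => s sL; rewrite ger0_norm ?negp_ge0// /negp ge_max.
have := fK s sL; rewrite ler_norml => /andP[? ?].
by apply/andP; split; lra.
Qed.

(** As the coefficients are nonnegative, only negative values pull the integrals down: the sum of
    the negative parts of [d] and [e] satisfies the inequality of [gronwall] with c = 0. *)
Lemma comparison L K alpha beta d e : 0 < K -> 0 <= L -> bm L alpha -> bm L beta ->
  (forall s, 0 <= s <= L -> 0 <= alpha s <= K) ->
  (forall s, 0 <= s <= L -> 0 <= beta s <= K) ->
  bm L d -> bm L e ->
  (forall s, 0 <= s <= L -> Rint 0 s (fun r => alpha r * e r) <= d s) ->
  (forall s, 0 <= s <= L -> Rint 0 s (fun r => beta r * d r) <= e s) ->
  forall s, 0 <= s <= L -> 0 <= d s /\ 0 <= e s.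
Proof.
move=> K0 L0 ba bb aK bK bd be dE eE s sL.
have bnd := bm_negp bd; have bne := bm_negp be.
have key c g h : bm L c -> (forall s, 0 <= s <= L -> 0 <= c s <= K) -> bm L g ->
    (forall s, 0 <= s <= L -> Rint 0 s (fun r => c r * g r) <= h s) ->
    forall s, 0 <= s <= L -> negp (h s) <= K * Rint 0 s (fun r => negp (g r)).
  move=> bc cK bg gh r rL; have [r0 rl] := andP rL.
  have bng := bm_negp bg.
  rewrite {1}/negp ge_max; apply/andP; split.
    by rewrite mulr_ge0 ?(ltW K0)//; apply: Rintegral_ge0 => ? _; exact: negp_ge0.
  have := gh r rL.
  have : - (K * Rint 0 r (fun t => negp (g t))) <= Rint 0 r (fun t => c t * g t).
    rewrite -mulN1r -(@RintZ _ L)//.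
    rewrite -(@RintZ _ L)//; last by apply: bmM => //; exact: bm_cst.
    apply: (@le_Rint _ L) => //; first by do 2 (apply: bmM; first exact: bm_cst).
      exact: bmM.
    move=> t tr; have := cK t ltac:(lra) => /andP[c0 c1].
    have := negp_ge0 (g t); have := negp_geN (g t).
    by nra.
  by lra.
have G := @gronwall R L K (fun s => negp (d s) + negp (e s)) 0 K0 (lexx 0) (bmD bnd bne).
have : negp (d s) + negp (e s) <= 2 * 0 * expR (2 * K * s).
  apply: G => // [r|r rL]; first by rewrite addr_ge0// negp_ge0.
  rewrite (@RintD _ L); [|by []|by []|by []|lra].
  have := key alpha e d ba aK be dE r rL; have := key beta d e bb bK bd eE r rL.
  by lra.
rewrite mulr0 mul0r.
have := negp_ge0 (d s); have := negp_ge0 (e s); have := negp_geN (d s); have := negp_geN (e s).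
by move=> *; split; lra.
Qed.

Lemma bm_reflect L f : bm L f -> bm L (fun s => f (L - s)).
Proof.
move=> [mf [K fK]]; split; last by exists K => s sL; apply: fK; lra.
have mphi : measurable_fun `[0, L]%classic (fun s : R => L - s).
  by apply: measurable_funB; [exact: measurable_cst|exact: measurable_id].
have := @measurable_comp _ _ _ _ _ _ `[0, L]%classic f `[0, L]%classic (fun s => L - s).
by apply => //; move=> _ [s /= + <-]; rewrite !in_itv /=; lra.
Qed.

(** The image of Lebesgue measure under s -> L - s has the same value on half-open intervals, hence
    is Lebesgue measure. Extending f by 0 outside [0, L] first makes it measurable on the whole
    line. *)
Lemma Rint_reflect L f x y : bm L f -> 0 <= x -> x <= y -> y <= L ->
  Rint x y (fun s => f (L - s)) = Rint (L - y) (L - x) f.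
Proof.
move=> bf x0 xy yL.
wlog mf : f bf / measurable_fun setT f.
  move=> H; pose g := f \_ `[0, L]%classic.
  have gE s : 0 <= s <= L -> g s = f s.
    by move=> sL; rewrite /g patchE ifT// inE /= in_itv.
  have mg : measurable_fun setT g.
    by have [mf _] := bf; apply/(measurable_restrictT _ _).1.
  have bg : bm L g.
    split; first exact: measurable_funTS.
    by have [_ [K fK]] := bf; exists K => s sL; rewrite gE// fK.
  transitivity (Rint x y (fun s => g (L - s))).
    by apply: eq_Rint => s sL; rewrite gE//; lra.
  by rewrite (H g bg mg); apply: eq_Rint => s sL; rewrite gE//; lra.
rewrite /Rint /Rintegral; congr fine.
have ar1 (s a b : R) : (a < L - s <= b) = (L - b <= s < L - a) by apply/idP/idP; lra.
have ar2 (s a b : R) : (L - b <= L - s <= L - a) = (a <= s <= b) by apply/idP/idP; lra.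
have ar3 (a b : R) : (L - b < L - a) = (a < b) by apply/idP/idP; lra.
have ar4 (a b : R) : L - a - (L - b) = b - a by lra.
pose phi (s : measurableTypeR R) : measurableTypeR R := L - s.
have mphi : measurable_fun setT phi.
  by apply: measurable_funB; [exact: measurable_cst|exact: measurable_id].
have pushE A : measurable A -> pushforward lebesgue_measure phi A = lebesgue_measure A.
  move=> mA; apply/esym/lebesgue_measure_unique => //= _ [[a b]] _ <-.
  rewrite /pushforward.
  have -> : phi @^-1` `]a, b]%classic = `[L - b, L - a[%classic.
    by apply/seteqP; split => s; rewrite /= !in_itv /phi /= ar1.
  rewrite !lebesgue_measure_itv /= !lte_fin.
  by rewrite ar3; case: ifP => // _; rewrite -!EFinB ar4.
have preE : phi @^-1` `[L - y, L - x]%classic = `[x, y]%classic.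
  by apply/seteqP; split => s; rewrite /= !in_itv /phi /= ar2.
transitivity (\int[pushforward lebesgue_measure phi]_(s in `[(L - y)%R, (L - x)%R]%classic) (f s)%:E)%E.
  rewrite integral_pushforward//=.
  - by rewrite preE.
  - exact/measurable_EFinP.
  - rewrite preE.
    exact: bm_integrable (bm_reflect bf) x0 yL.
by apply: eq_measure_integral => A mA _; exact: pushE.
Qed.

End Comparison.

(** * The radial equation as a first order system, and the Agmon lower bound near an end *)

Section Weight.
Context {R : realType}.
Implicit Types (f Z q v z zeta : R -> R) (L a mu eps E B s : R).

(** p = [wgt] is the integrating factor of v'' + (f' / eps - Z' / Z) v', the radial part of the
    operator divided by eps. With the flux z = p v', the equation (p v')' = p Q v becomes the system
    v' = [wgtV] z, z' = [wpot] v of [ivp], in which q enters undifferentiated. *)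
Definition wgt f Z eps s := expR (f s / eps) / Z s.
Definition wgtV f Z eps s := Z s * expR (- (f s / eps)).
Definition pot Z q a E eps s := (a * Z s) ^+ 2 - E - eps * q s.
Definition wpot f Z q a E eps s := wgt f Z eps s * (pot Z q a E eps s / eps ^+ 2).

Lemma wgtK f Z eps s : Z s != 0 -> wgtV f Z eps s * wgt f Z eps s = 1.
Proof.
by move=> Z0; rewrite /wgtV /wgt expRN; field; rewrite Z0 gt_eqF// expR_gt0.
Qed.

Lemma wgt_gt0 f Z eps s : 0 < Z s -> 0 < wgt f Z eps s.
Proof. by move=> Z0; rewrite divr_gt0// expR_gt0. Qed.

Lemma wgtV_gt0 f Z eps s : 0 < Z s -> 0 < wgtV f Z eps s.
Proof. by move=> Z0; rewrite mulr_gt0// expR_gt0. Qed.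

Lemma smooth_mul f g : smooth f -> smooth g -> smooth (fun s => f s * g s).
Proof. by move=> /smoothP sf /smoothP sg; apply/smoothP => n; exact: CkM. Qed.

Lemma smooth_add f g : smooth f -> smooth g -> smooth (fun s => f s + g s).
Proof. by move=> /smoothP sf /smoothP sg; apply/smoothP => n; exact: CkD. Qed.

Lemma smooth_cst (c : R) : smooth (fun=> c).
Proof. by apply/smoothP => n; exact: Ck_cst. Qed.

Lemma smooth_opp f : smooth f -> smooth (fun s => - f s).
Proof. by move=> /smoothP sf; apply/smoothP => n; exact: CkN. Qed.

Lemma smooth_expR f : smooth f -> smooth (fun s => expR (f s)).
Proof.
by move=> /smoothP sf; apply/smoothP => n; apply: Ck_comp => // m; exact: Ck_expR.
Qed.

Lemma smooth_inv f : (forall s, 0 < f s) -> smooth f -> smooth (fun s => (f s)^-1).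
Proof.
by move=> f0 /smoothP sf; apply/smoothP => n; apply: CkV => // s; rewrite gt_eqF.
Qed.

Lemma smooth_wgt f Z eps : smooth f -> smooth Z -> (forall s, 0 < Z s) ->
  smooth (wgt f Z eps).
Proof.
move=> sf sZ Z0.
exact: (smooth_mul (smooth_expR (smooth_mul sf (@smooth_cst eps^-1))) (smooth_inv Z0 sZ)).
Qed.

Lemma smooth_wgtV f Z eps : smooth f -> smooth Z -> smooth (wgtV f Z eps).
Proof.
move=> sf sZ.
exact: (smooth_mul sZ (smooth_expR (smooth_opp (smooth_mul sf (@smooth_cst eps^-1))))).
Qed.

Lemma bm_smooth L f : smooth f -> bm L f.
Proof. by move=> /smooth_continuous; exact: bm_continuous. Qed.

Lemma bm_pot L Z q a E eps : smooth Z -> bm L q -> bm L (pot Z q a E eps).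
Proof.
move=> sZ bq; apply: bmB; last by apply: bmM => //; exact: bm_cst.
apply: bmB; last exact: bm_cst.
have bZ := bm_smooth L sZ.
have baZ : bm L (fun s => a * Z s) by apply: bmM => //; exact: bm_cst.
rewrite (_ : (fun s => (a * Z s) ^+ 2) = fun s => (a * Z s) * (a * Z s)); first exact: bmM.
by apply/funext => s; rewrite expr2.
Qed.

Lemma bm_wpot L f Z q a E eps : smooth f -> smooth Z -> (forall s, 0 < Z s) ->
  bm L q -> bm L (wpot f Z q a E eps).
Proof.
move=> sf sZ Z0 bq; apply: bmM; first by apply: bm_smooth; exact: smooth_wgt.
by apply: bmM; [exact: bm_pot|exact: bm_cst].
Qed.

Lemma wgt_derive f Z eps s : smooth f -> smooth Z -> (forall s, 0 < Z s) ->
  is_derive s 1 (wgt f Z eps)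
    (wgt f Z eps s * (derive1 f s / eps - derive1 Z s / Z s)).
Proof.
move=> sf sZ Z0; have Zn0 : Z s != 0 by rewrite gt_eqF.
have df : is_derive s 1 (fun s => f s / eps) (derive1 f s / eps).
  apply: is_derive_congr (is_derive1M (smooth_is_derive s sf) (is_derive1_cst eps^-1 s)) _.
  by rewrite mulr0 addr0.
apply: is_derive_congr (is_derive1M (is_derive1_o (is_derive_expR _) df)
  (is_derive1V Zn0 (smooth_is_derive s sZ))) _.
by rewrite /wgt; move: (eps^-1) => ie; field.
Qed.

(* [y] is a subsolution of [(p y')' = p Q y] which vanishes at [0] like the solution. *)
Lemma agmon f Z q v z zeta (x a mu eps E B Lam z0 : R) :
  0 <= x -> 0 < eps -> 0 < a -> 0 <= mu ->
  smooth f -> smooth Z -> (forall s, 0 < Z s) -> bm x q ->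
  (forall s, 0 <= s <= x -> [/\ `|derive1 f s| <= mu, `|q s| <= B,
     `|derive1 Z s / Z s| <= Lam, mu <= a * Z s &
     `|E| + eps * (B + mu * Lam) <= a * mu * Z s /\ E + eps * B <= (a * Z s) ^+ 2]) ->
  zeta 0 = 0 -> (forall s, is_derive s 1 zeta (Z s)) ->
  bm x v -> bm x z -> 0 <= z0 ->
  (forall s, 0 <= s <= x -> v s = Rint 0 s (fun r => wgtV f Z eps r * z r)) ->
  (forall s, 0 <= s <= x -> z s = z0 + Rint 0 s (fun r => wpot f Z q a E eps r * v r)) ->
  forall s, 0 <= s <= x ->
    z0 / wgt f Z eps 0 * (eps / (2 * a * Z 0)) *
      (expR ((a * zeta s - mu * s) / eps) - expR ((- (a * zeta s) - mu * s) / eps)) <= v s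
    /\ 0 <= z s.
Proof.
move=> x0 eps0 a0 mu0 sf sZ Z0 bq H zeta0 dzeta bv bz z00 vE zE.
set p := wgt f Z eps; set pV := wgtV f Z eps; set beta := wpot f Z q a E eps.
(* The WKB exponents plus and minus a zeta, lowered by mu s to beat the drift: with u = a Z, (u -
   mu)^2 + f' (u - mu) <= u^2 - mu u and (u + mu)^2 - f' (u + mu) >= u^2 + mu u. The gain mu u pays
   for E, q and Z' / Z. Subtracting [e2] makes [y] vanish at 0, and [zy] is its flux p y'. *)
pose e1 (s : R) : R := expR ((a * zeta s - mu * s) / eps).
pose e2 (s : R) : R := expR ((- (a * zeta s) - mu * s) / eps).
pose y (s : R) : R := e1 s - e2 s.
pose zy (s : R) : R := p s / eps * ((a * Z s - mu) * e1 s + (a * Z s + mu) * e2 s).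
pose N (s : R) : R := derive1 Z s / Z s.
pose zy' (s : R) : R := p s / eps ^+ 2 *
  (((a * Z s - mu) ^+ 2 + derive1 f s * (a * Z s - mu) + eps * mu * N s) * e1 s -
   ((a * Z s + mu) ^+ 2 - derive1 f s * (a * Z s + mu) + eps * mu * N s) * e2 s).
have epsn0 : eps != 0 by rewrite gt_eqF.
have Zn0 s : Z s != 0 by rewrite gt_eqF.
have p0 s : 0 < p s := wgt_gt0 f eps (Z0 s).
have dp s : is_derive s 1 p (p s * (derive1 f s / eps - derive1 Z s / Z s)) := wgt_derive eps s sf sZ Z0.
have daz s : is_derive s 1 (fun s => a * zeta s) (a * Z s) := is_derive1Z a (dzeta s).
have dms s : is_derive s 1 (fun s => mu * s) mu := is_derive1_mulr mu s.
have de1 s : is_derive s 1 e1 (e1 s * ((a * Z s - mu) / eps)).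
  have d1 := is_derive1M (is_derive1B (daz s) (dms s)) (is_derive1_cst eps^-1 s).
  apply: is_derive_congr (is_derive1_o (is_derive_expR _) d1) _.
  by rewrite mulr0 addr0.
have de2 s : is_derive s 1 e2 (- e2 s * ((a * Z s + mu) / eps)).
  have d1 := is_derive1M (is_derive1B (is_derive1N (daz s)) (dms s)) (is_derive1_cst eps^-1 s).
  apply: is_derive_congr (is_derive1_o (is_derive_expR _) d1) _.
  by rewrite mulr0 addr0 -/(e2 s); field.
have dy s : is_derive s 1 y (pV s * zy s).
  apply: is_derive_congr (is_derive1B (de1 s) (de2 s)) _.
  have pK : pV s * p s = 1 := wgtK f eps (Zn0 s).
  by rewrite /zy [pV s * _]mulrA [pV s * (_ / _)]mulrA pK; field.
have dZ s := smooth_is_derive s sZ.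
have dzy s : is_derive s 1 zy (zy' s).
  have dA := is_derive1B (is_derive1Z a (dZ s)) (is_derive1_cst mu s).
  have dB := is_derive1D (is_derive1Z a (dZ s)) (is_derive1_cst mu s).
  apply: is_derive_congr (is_derive1M
    (is_derive1M (dp s) (is_derive1_cst eps^-1 s))
    (is_derive1D (is_derive1M dA (de1 s)) (is_derive1M dB (de2 s)))) _.
  by rewrite /zy' /N; field; rewrite Zn0 epsn0.
have cp := is_derive_continuous dp.
have ce1 := is_derive_continuous de1; have ce2 := is_derive_continuous de2.
have cZ := smooth_continuous sZ.
have caZ : continuous (fun s => a * Z s) by apply: ctsM => //; exact: ctsC.
have czy := is_derive_continuous dzy; have cy := is_derive_continuous dy.
have spV : smooth pV by exact: smooth_wgtV.
have cpV := smooth_continuous spV.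
have cdf : continuous (derive1 f) by apply: smooth_continuous; exact: smooth_derive1.
have sZ' := smooth_derive1 sZ.
have cN : continuous N.
  exact: smooth_continuous (smooth_mul sZ' (smooth_inv Z0 sZ)).
have czy' : continuous zy'.
  have c1 : continuous (fun s => a * Z s - mu) by apply: ctsB => //; exact: ctsC.
  have c2 : continuous (fun s => a * Z s + mu) by apply: ctsD => //; exact: ctsC.
  have c3 : continuous (fun s => eps * mu * N s) by apply: ctsM => //; exact: ctsC.
  have sq (g : R -> R) : continuous g -> continuous (fun s => g s ^+ 2).
    move=> cg; rewrite (_ : (fun s => _) = fun s => g s * g s); first exact: ctsM.
    by apply/funext => s; rewrite expr2.
  apply: ctsM; first by apply: ctsM => //; exact: ctsC.
  apply: ctsB; apply: ctsM => //; apply: ctsD => //.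
    by apply: ctsD; [exact: sq|exact: ctsM].
  by apply: ctsB; [exact: sq|exact: ctsM].
have byx := bm_continuous x cy; have bzy := bm_continuous x czy; have bzy' := bm_continuous x czy'.
have bpV := bm_continuous x cpV.
have bb : bm x beta by exact: bm_wpot.
have y0 : y 0 = 0 by rewrite /y /e1 /e2 zeta0 !mulr0 !oppr0 !addr0 subrr.
have yE s : 0 <= s <= x -> y s = Rint 0 s (fun r => pV r * zy r).
  by move=> /andP[s0 _]; have := Rint_FTC s0 (ctsM cpV czy) dy; rewrite y0; lra.
have zyE s : 0 <= s <= x -> zy s = zy 0 + Rint 0 s zy'.
  by move=> /andP[s0 _]; rewrite (Rint_FTC s0 czy' dzy); lra.
have zy0 : zy 0 = p 0 * (2 * a * Z 0) / eps.
  by rewrite /zy /e1 /e2 zeta0 !mulr0 !oppr0 !addr0 mul0r expR0; field.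
(* The multiple of [y] whose flux at 0 equals that of v. *)
set k := z0 / p 0 * (eps / (2 * a * Z 0)).
have k0 : 0 <= k.
  by rewrite /k !mulr_ge0 ?invr_ge0 ?(ltW (p0 _)) ?(ltW eps0)// !mulr_ge0// ltW.
have kzy : k * zy 0 = z0.
  rewrite zy0 /k; field.
  by rewrite (gt_eqF a0) (gt_eqF (p0 0)) (gt_eqF (Z0 0)) epsn0.
have beta_ge0 s : 0 <= s <= x -> 0 <= beta s.
  move=> sx; have [_ qB _ _ [_ h]] := H s sx.
  apply: mulr_ge0; first exact/ltW/p0.
  rewrite divr_ge0 ?sqr_ge0// /pot.
  have : eps * q s <= eps * B by rewrite ler_pM2l// (le_trans (ler_norm _)).
  by lra.
have sub s : 0 <= s <= x -> zy' s <= beta s * y s.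
  move=> sx; have [f1 q1 N1 m1 [h1 h2]] := H s sx.
  rewrite /zy' /beta /wpot -/p /pot /y.
  have -> : p s * (((a * Z s) ^+ 2 - E - eps * q s) / eps ^+ 2) * (e1 s - e2 s) =
      p s / eps ^+ 2 * (((a * Z s) ^+ 2 - E - eps * q s) * (e1 s - e2 s)) by field.
  rewrite ler_pM2l; last by rewrite divr_gt0// exprn_gt0.
  rewrite -/(N s) in N1.
  move: f1 q1 N1; rewrite !ler_norml => /andP[f1 f2] /andP[q1 q2] /andP[N1 N2].
  have E1 := expR_gt0 ((a * zeta s - mu * s) / eps); rewrite -/(e1 s) in E1.
  have E2 := expR_gt0 ((- (a * zeta s) - mu * s) / eps); rewrite -/(e2 s) in E2.
  have En := ler_norm E; have En' := ler_norm (- E); rewrite normrN in En'.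
  have aZ0 : 0 < a * Z s by rewrite mulr_gt0.
  clear -eps0 mu0 aZ0 f1 f2 q1 q2 N1 N2 E1 E2 En En' m1 h1 h2.
  have eN1 : eps * mu * N s <= eps * (mu * Lam).
    by rewrite -mulrA ler_pM2l// ler_wpM2l.
  have eN2 : - (eps * (mu * Lam)) <= eps * mu * N s.
    by rewrite -mulrA -mulrN ler_pM2l// -mulrN ler_wpM2l.
  have eq1 : eps * q s <= eps * B by rewrite ler_pM2l.
  have eq2 : - (eps * B) <= eps * q s by rewrite -mulrN ler_pM2l.
  have fA : derive1 f s * (a * Z s - mu) <= mu * (a * Z s - mu).
    by apply: ler_wpM2r => //; lra.
  have fB : derive1 f s * (a * Z s + mu) <= mu * (a * Z s + mu).
    by apply: ler_wpM2r => //; lra.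
  rewrite mulrDr in h1.
  set u := a * Z s in fA fB h2 *.
  have hu : a * mu * Z s = mu * u by rewrite /u; ring.
  rewrite hu in h1; clear hu; clearbody u.
  have A1 : (u - mu) ^+ 2 + derive1 f s * (u - mu) + eps * mu * N s <= u ^+ 2 - E - eps * q s.
    rewrite sqrrB; lra.
  have A2 : u ^+ 2 - E - eps * q s <= (u + mu) ^+ 2 - derive1 f s * (u + mu) + eps * mu * N s.
    rewrite sqrrD; lra.
  by rewrite [leRHS]mulrBr; apply: lerB; apply: ler_wpM2r => //; exact: ltW.
have [_ [K1 K1P]] := bpV; have [_ [K2 K2P]] := bb.
have K1x := le_trans (normr_ge0 _) (K1P 0 ltac:(by rewrite lexx)).
have K2x := le_trans (normr_ge0 _) (K2P 0 ltac:(by rewrite lexx)).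
move=> s sx.
have bky : bm x (fun s => k * y s) by apply: bmM => //; exact: bm_cst.
have bkzy : bm x (fun s => k * zy s) by apply: bmM => //; exact: bm_cst.
have [] := @comparison R x (K1 + K2 + 1) pV beta (fun s => v s - k * y s)
  (fun s => z s - k * zy s) ltac:(lra) x0 bpV bb _ _ (bmB bv bky) (bmB bz bkzy) _ _ s sx.
- move=> r rx; have := K1P r rx; have := wgtV_gt0 f eps (Z0 r); rewrite -/(pV r) => h.
  by rewrite ger0_norm ?(ltW h)// => h1; clear -h1 K2x; lra.
- move=> r rx; have := K2P r rx; have h := beta_ge0 r rx.
  by rewrite ger0_norm// => h1; rewrite h; clear -h1 K1x; lra.
- move=> r rx; have [r0 rx'] := andP rx.
  rewrite vE// yE// -(@RintZ _ x)//; last exact: bmM.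
  rewrite -(@RintB _ x)//; [|exact: bmM|by apply: bmM; [exact: bm_cst|exact: bmM]].
  rewrite le_eqVlt; apply/orP; left; apply/eqP; apply: eq_Rint => t _.
  by rewrite -/pV; ring.
- move=> r rx; have [r0 rx'] := andP rx.
  rewrite zE// zyE// mulrDr kzy opprD addrACA subrr add0r.
  rewrite -(@RintZ _ x)// -(@RintB _ x)//; [|exact: bmM|by apply: bmM => //; exact: bm_cst].
  apply: (@le_Rint _ x) => //.
  + by apply: bmM => //; exact: bmB.
  + by apply: bmB; [exact: bmM|apply: bmM => //; exact: bm_cst].
  move=> t tr; rewrite -/beta mulrBr; apply: lerB => //.
  rewrite [leRHS]mulrCA; apply: ler_wpM2l => //; apply: sub; lra.
move=> h1 h2; split; first by rewrite -subr_ge0.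
have : 0 <= k * zy s.
  have [_ _ _ m1 _] := H s sx; apply: mulr_ge0 => //; apply: mulr_ge0.
    by rewrite divr_ge0// ltW.
  clear -m1 mu0; apply: addr_ge0; apply: mulr_ge0; rewrite ?expR_ge0//; lra.
by lra.
Qed.

End Weight.

(** * Sturm comparison in the middle of the interval *)

Section Sturm.
Context {R : realType}.
Implicit Types (f Z q v z zeta : R -> R) (L a mu eps E B s : R).

(** Half of p' / p. Calling it m, the Liouville substitution v = p^(-1/2) w turns (p v')' = p Q v
    into w'' = (Q + m^2 + m') w. *)
Definition half_log_derive f Z eps s := (derive1 f s / eps - derive1 Z s / Z s) / 2.

Lemma smooth_half_log_derive f Z eps : smooth f -> smooth Z -> (forall s, 0 < Z s) ->
  smooth (half_log_derive f Z eps).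
Proof.
move=> sf sZ Z0; have s1 := smooth_mul (smooth_derive1 sf) (@smooth_cst R eps^-1).
have s2 := smooth_opp (smooth_mul (smooth_derive1 sZ) (smooth_inv Z0 sZ)).
exact: (smooth_mul (smooth_add s1 s2) (@smooth_cst R 2^-1)).
Qed.

(* The test function [p^{-1/2} sin] solves the equation with a less negative potential. *)
Lemma sturm f Z q v z (L x y a eps E : R) :
  0 < eps -> 0 <= x -> x < y -> y <= L ->
  smooth f -> smooth Z -> (forall s, 0 < Z s) -> bm L q ->
  ivp L (wgtV f Z eps) (wpot f Z q a E eps) v z ->
  (forall s, x <= s <= y -> pot Z q a E eps s +
     eps ^+ 2 * (half_log_derive f Z eps s ^+ 2 + derive1 (half_log_derive f Z eps) s
                 + (pi / (y - x)) ^+ 2) <= 0) ->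
  exists2 s, x <= s <= y & v s <= 0.
Proof.
move=> eps0 x0 xy yL sf sZ Z0 bq [cv cz vE zE] H.
apply: contrapT => nv.
have vpos s : x <= s <= y -> 0 < v s.
  by move=> sxy; rewrite ltNge; apply/negP => vs; apply: nv; exists s.
have L0 : 0 <= L by lra.
have epsn0 : eps != 0 by rewrite gt_eqF.
set m := half_log_derive f Z eps in H.
have sm : smooth m := smooth_half_log_derive sf sZ Z0.
pose k : R := pi / (y - x).
have k0 : 0 < k by rewrite divr_gt0 ?pi_gt0// subr_gt0.
(* [P] is p^(-1/2) and [W] below is p^(1/2); [phi] is the test function, [psi] its derivative, and
   [eta] its flux p psi. *)
pose P s := expR (- (f s / eps - ln (Z s)) / 2).
pose chi s := sin (k * (s - x)).
pose chi' s := k * cos (k * (s - x)).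
pose p := wgt f Z eps; pose pV := wgtV f Z eps.
pose W s := p s * P s.
have dm s := smooth_is_derive s sm.
have dP s : is_derive s 1 P (- m s * P s).
  have d1 := is_derive1M (smooth_is_derive s sf) (is_derive1_cst eps^-1 s).
  have d2 := is_derive1_o (is_derive1_ln (Z0 s)) (smooth_is_derive s sZ).
  have d3 := is_derive1M (is_derive1N (is_derive1B d1 d2)) (is_derive1_cst 2^-1 s).
  apply: is_derive_congr (is_derive1_o (is_derive_expR _) d3) _.
  by rewrite -/(P s) /m /half_log_derive; field; rewrite epsn0 gt_eqF.
have dk s : is_derive s 1 (fun s => k * (s - x)) k.
  apply: is_derive_congr (is_derive1Z k (is_derive1B (is_derive1_id s) (is_derive1_cst x s))) _.
  by rewrite subr0 mulr1.
have dchi s : is_derive s 1 chi (chi' s).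
  apply: is_derive_congr (is_derive1_o (is_derive_sin _) (dk s)) _.
  by rewrite mulrC.
have dchi' s : is_derive s 1 chi' (- k ^+ 2 * chi s).
  apply: is_derive_congr (is_derive1Z k (is_derive1_o (is_derive_cos _) (dk s))) _.
  by rewrite /chi; ring.
pose phi s := P s * chi s.
pose psi s := P s * (chi' s - m s * chi s).
pose eta s := W s * (chi' s - m s * chi s).
pose eta' s := - (W s * chi s * (m s ^+ 2 + derive1 m s + k ^+ 2)).
have dphi s : is_derive s 1 phi (psi s).
  apply: is_derive_congr (is_derive1M (dP s) (dchi s)) _.
  by rewrite /psi; ring.
have dp s : is_derive s 1 p (p s * (2 * m s)).
  apply: is_derive_congr (wgt_derive eps s sf sZ Z0) _.
  by rewrite -/p /m /half_log_derive; field; rewrite epsn0 gt_eqF.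
have deta s : is_derive s 1 eta (eta' s).
  apply: is_derive_congr (is_derive1M (is_derive1M (dp s) (dP s))
    (is_derive1B (dchi' s) (is_derive1M (dm s) (dchi s)))) _.
  by rewrite /eta' /W; ring.
have cP := is_derive_continuous dP; have cp := is_derive_continuous dp.
have cchi := is_derive_continuous dchi; have cchi' := is_derive_continuous dchi'.
have cm := smooth_continuous sm; have cdm := smooth_continuous (smooth_derive1 sm).
have cW : continuous W by exact: ctsM.
have csub : continuous (fun s => chi' s - m s * chi s) by apply: ctsB => //; exact: ctsM.
have cpsi : continuous psi by exact: ctsM.
have ceta' : continuous eta'.
  have -> : eta' = fun s => (-1) * (W s * chi s * (m s * m s + derive1 m s + k ^+ 2)).
    by apply/funext => s; rewrite /eta'; ring.
  apply: ctsM; first exact: ctsC.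
  apply: ctsM; first exact: ctsM.
  apply: ctsD; last exact: ctsC.
  by apply: ctsD => //; exact: ctsM.
have bv := bm_continuous L cv; have bz := bm_continuous L cz.
have bbeta : bm L (wpot f Z q a E eps) by exact: bm_wpot.
have bpV : bm L pV by apply: bm_smooth; exact: smooth_wgtV.
have z0 : z 0 = 1 by rewrite zE ?lexx// Rint_same addr0.
have v0 : v 0 = 0 by rewrite vE ?lexx// Rint_same.
have I1 := @Rint_ibp R L (fun r => wpot f Z q a E eps r * v r) z phi psi x y
  (bmM bbeta bv) ltac:(by move=> s sL; rewrite z0 zE) bz cpsi dphi x0 (ltW xy) yL.
have I2 := @Rint_ibp R L (fun r => pV r * z r) v eta eta' x y
  (bmM bpV bz) ltac:(by move=> s sL; rewrite v0 add0r vE) bv ceta' deta x0 (ltW xy) yL.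
have chix : chi x = 0 by rewrite /chi subrr mulr0 sin0.
have kpi : k * (y - x) = pi by rewrite divfK// subr_eq0 gt_eqF.
have chiy : chi y = 0 by rewrite /chi kpi sinpi.
have e1 : Rint x y (fun r => pV r * z r * eta r) = Rint x y (fun r => z r * psi r).
  apply: eq_Rint => r _; rewrite /eta /psi /W.
  have pK : pV r * p r = 1 by apply: wgtK; rewrite gt_eqF.
  by transitivity (pV r * p r * (z r * (P r * (chi' r - m r * chi r)))); [ring|rewrite pK mul1r].
have etax : eta x = k * W x by rewrite /eta /chi' chix subrr mulr0 cos0; ring.
have etay : eta y = - (k * W y) by rewrite /eta /chi' chiy kpi cospi; ring.
have W0 s : 0 < W s by rewrite mulr_gt0 ?expR_gt0// wgt_gt0.
have bphi : bm L phi by apply: bm_continuous; exact: ctsM.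
have beta' := bm_continuous L ceta'.
(* Lagrange's identity: the two integrations by parts share the integral of z psi, and their
   difference leaves boundary terms, which are positive if v > 0. The hypothesis [H] makes the
   integrand nonpositive, a contradiction. *)
have D : Rint x y (fun r => wpot f Z q a E eps r * v r * phi r - v r * eta' r) =
    k * (W y * v y + W x * v x).
  rewrite (@RintB _ L)//; [|by apply: bmM => //; exact: bmM|exact: bmM].
  rewrite I1; move: I2; rewrite e1 etax etay /phi chix chiy.
  by rewrite !mulr0; lra.
have : 0 < k * (W y * v y + W x * v x).
  by rewrite mulr_gt0// addr_gt0// mulr_gt0// vpos// lexx ltW.
rewrite -D ltNge => /negP; apply.
rewrite -(mul0r (y - x)) -(Rint_cst 0 (ltW xy)).
apply: (@le_Rint _ L) => //; last 1 first.
- move=> s sxy; have vs := vpos s sxy.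
  have chis : 0 <= chi s.
    apply: sin_ge0_pi; apply/andP; split; first by rewrite mulr_ge0 ?(ltW k0)//; lra.
    by rewrite -kpi ler_pM2l//; lra.
  rewrite /wpot -/p /eta' /phi.
  have -> : p s * (pot Z q a E eps s / eps ^+ 2) * v s * (P s * chi s) -
     v s * - (W s * chi s * (m s ^+ 2 + derive1 m s + k ^+ 2)) =
     v s * W s * chi s / eps ^+ 2 *
     (pot Z q a E eps s + eps ^+ 2 * (m s ^+ 2 + derive1 m s + k ^+ 2)).
    by rewrite /W; field.
  apply: mulr_ge0_le0; last exact: H.
  by rewrite divr_ge0 ?sqr_ge0// mulr_ge0// mulr_ge0// ltW.
- apply: bmB; last exact: bmM.
  by apply: bmM => //; exact: bmM.
- exact: bm_cst.
Qed.

End Sturm.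

(** * The shooting argument for the ground state *)

Section Shooting.
Context {R : realType}.
Implicit Types (f Z q v z zeta : R -> R) (L a mu eps E B s : R).

Lemma continuous_pos_min f (x y : R) : x <= y -> continuous f ->
  (forall s, x <= s <= y -> 0 < f s) ->
  exists2 c, 0 < c & forall s, x <= s <= y -> c <= f s.
Proof.
move=> xy cf fp.
have [c cxy cmin] := EVT_min xy (continuous_subspaceT cf).
exists (f c); first by apply: fp; move: cxy; rewrite in_itv.
by move=> s sxy; apply: cmin; rewrite in_itv.
Qed.

(** For the lower end of the energies: a nonnegative potential keeps the flux above its initial
    value 1, so that v(s) / s stays away from 0. *)
Lemma ivp_linear_growth L alpha beta v z c : 0 < L -> 0 < c -> bm L alpha -> bm L beta ->
  (forall s, 0 <= s <= L -> c <= alpha s) -> (forall s, 0 <= s <= L -> 0 <= beta s) ->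
  ivp L alpha beta v z -> forall s, 0 <= s <= L -> c * s <= v s.
Proof.
move=> L0 c0 ba bb ac b0 [cv cz vE zE].
have bv := bm_continuous L cv; have bz := bm_continuous L cz.
have [_ [K1 K1P]] := ba; have [_ [K2 K2P]] := bb.
have K1x := le_trans (normr_ge0 _) (K1P 0 ltac:(rewrite lexx ltW//)).
have K2x := le_trans (normr_ge0 _) (K2P 0 ltac:(rewrite lexx ltW//)).
have pos s : 0 <= s <= L -> 0 <= v s /\ 0 <= z s.
  apply: (@comparison R L (K1 + K2 + 1) alpha beta) => //.
  - lra.
  - lra.
  - move=> r rL; have := K1P r rL; have := ac r rL => h1.
    by rewrite ger0_norm; lra.
  - move=> r rL; have := K2P r rL; have := b0 r rL => h1.
    by rewrite ger0_norm; lra.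
  - by move=> r rL; rewrite vE.
  - by move=> r rL; rewrite zE// lerDr.
have z1 s : 0 <= s <= L -> 1 <= z s.
  move=> sL; rewrite zE// lerDl; apply: Rint_ge0.
  by move=> r rs; rewrite mulr_ge0 ?b0//; [lra|have [] := pos r ltac:(lra)].
move=> s sL; rewrite vE//; have -> : c * s = c * (s - 0) by lra.
apply: (@le_cst_Rint _ L) => //; [exact: bmM|lra|lra|].
move=> r rs; have h1 := ac r ltac:(lra); have h2 := z1 r ltac:(lra).
by nra.
Qed.

Section BoundaryPoint.
Variables (L K c : R) (alpha beta v z : R -> R).
Hypotheses (L0 : 0 < L) (K0 : 0 < K) (c0 : 0 < c) (ba : bm L alpha) (bb : bm L beta).
Hypothesis aK : forall s, 0 <= s <= L -> c <= alpha s <= K.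
Hypothesis bK : forall s, 0 <= s <= L -> `|beta s| <= K.
Hypothesis vz : ivp L alpha beta v z.

Lemma ivp_increment (x y : R) : 0 <= x -> x <= y -> y <= L ->
  v y - v x = Rint x y (fun r => alpha r * z r).
Proof.
move=> x0 xy yL; have [cv cz vE zE] := vz.
rewrite !vE ?x0 ?yL ?(le_trans x0 xy) ?(le_trans xy yL)//.
by rewrite (@Rint_chasles _ L _ 0 x y) ?(addrC (Rint 0 x _)) ?addrK//; apply: bmM => //; exact: bm_continuous.
Qed.

Lemma ivp_increment_ge (x y e : R) : 0 <= x -> x <= y -> y <= L -> 0 <= e ->
  (forall r, x <= r <= y -> e <= z r) -> c * e * (y - x) <= v y - v x.
Proof.
move=> x0 xy yL e0 ez; have [_ cz _ _] := vz.
rewrite ivp_increment//; apply: (@le_cst_Rint _ L) => //; first exact: bmM ba (bm_continuous L cz).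
move=> r rI; have /andP[ca _] : c <= alpha r <= K.
  by apply: aK; case/andP: rI => xr ry; rewrite (le_trans x0) ?(le_trans ry).
by apply: ler_pM => //; [exact: ltW|exact: ez].
Qed.

Lemma ivp_increment_le (x y e : R) : 0 <= x -> x <= y -> y <= L -> 0 <= e ->
  (forall r, x <= r <= y -> z r <= - e) -> v y - v x <= - (c * e * (y - x)).
Proof.
move=> x0 xy yL e0 ez; have [_ cz _ _] := vz.
rewrite ivp_increment// -mulNr; apply: (@Rint_le_cst _ L) => //; first exact: bmM ba (bm_continuous L cz).
move=> r rI; have /andP[ca _] : c <= alpha r <= K.
  by apply: aK; case/andP: rI => xr ry; rewrite (le_trans x0) ?(le_trans ry).
rewrite -[leLHS]opprK lerN2 -mulrN; apply: ler_pM => //; first exact: ltW.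
by rewrite lerNr; exact: ez.
Qed.

Lemma near_half (s : R) : z s != 0 -> exists2 d : R, 0 < d &
  forall r, `|r - s| <= d -> `|z r - z s| <= `|z s| / 2.
Proof.
move=> zs; have [_ cz _ _] := vz.
have e0 : 0 < `|z s| / 2 by rewrite divr_gt0// normr_gt0.
have /cvgrPdist_le /(_ _ e0)[d /= d0 hd] := cz s.
exists (d / 2); first by rewrite divr_gt0.
move=> r rs; rewrite distrC; apply: hd; rewrite /= distrC (le_lt_trans rs)//.
by lra.
Qed.

Hypothesis v0 : forall s, 0 <= s <= L -> 0 <= v s.

(** If v touches 0 at an interior point, its flux there is nonzero by [ivp_no_double_zero], and v
    becomes negative on one side. *)
Lemma ivp_pos_interior (s : R) : 0 < s < L -> 0 < v s.
Proof.
move=> /andP[s0 sl]; have sL : 0 <= s <= L by rewrite !ltW.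
rewrite lt_neqAle v0// andbT; apply/eqP => /esym vs.
have aK' r : 0 <= r <= L -> `|alpha r| <= K.
  by move=> /aK /andP[h1 h2]; rewrite ger0_norm// (le_trans (ltW c0)).
have [zs|zs] := eqVneq (z s) 0.
  exact: (ivp_no_double_zero K0 (ltW L0) ba bb aK' bK vz sL vs zs).
have [d d0 hd] := near_half zs.
have [zneg|zpos] := ltP (z s) 0.
  pose r := Num.min (s + d) L.
  have sr : s < r by rewrite lt_min sl ltrDl d0.
  have rL : r <= L by rewrite ge_min lexx orbT.
  have rd : r <= s + d by rewrite ge_min lexx.
  have r0 := le_lt_trans (ltW s0) sr.
  have e0 : 0 < - z s / 2 by rewrite divr_gt0// oppr_gt0.
  have h : v r - v s <= - (c * (- z s / 2) * (r - s)).
    apply: ivp_increment_le (ltW s0) (ltW sr) rL (ltW e0) _ => y /andP[sy yr].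
    have := hd y; rewrite ger0_norm ?subr_ge0// (ltr0_norm zneg) ler_norml.
    have yd : y - s <= d by lra.
    by move=> /(_ yd)/andP[_ h]; lra.
  have v1 : 0 <= v r by apply: v0; rewrite rL ltW.
  have v2 : 0 < c * (- z s / 2) * (r - s) by apply: mulr_gt0; [exact: mulr_gt0|rewrite subr_gt0].
  by lra.
have zp : 0 < z s by rewrite lt_neqAle eq_sym zs.
pose r := Num.max (s - d) 0.
have rs : r < s by rewrite gt_max s0 ltrBlDr ltrDl d0.
have r0 : 0 <= r by rewrite le_max lexx orbT.
have rd : s - d <= r by rewrite le_max lexx.
have e0 : 0 < z s / 2 by rewrite divr_gt0.
have h : c * (z s / 2) * (s - r) <= v s - v r.
  apply: ivp_increment_ge r0 (ltW rs) (ltW sl) (ltW e0) _ => y /andP[ry ys].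
  have := hd y; rewrite ler0_norm ?subr_le0// (ger0_norm zpos) ler_norml.
  have yd : - (y - s) <= d by lra.
  by move=> /(_ yd)/andP[h _]; lra.
have v1 : 0 <= v r by apply: v0; rewrite r0 ltW// (lt_trans rs).
have v2 : 0 < c * (z s / 2) * (s - r) by apply: mulr_gt0; [exact: mulr_gt0|rewrite subr_gt0].
by lra.
Qed.

(** Near 0 the flux stays above 1/2, which gives linear growth; further away v is positive up to and
    including L, hence bounded below by compactness. *)
Lemma ivp_linear_lower : v L != 0 -> exists2 k, 0 < k & forall s, 0 <= s <= L -> k * s <= v s.
Proof.
move=> vL; have [cv cz vE zE] := vz.
have v00 : v 0 = 0 by rewrite vE ?Rint_same// lexx ltW.
have z0 : z 0 = 1 by rewrite zE ?Rint_same ?addr0// lexx ltW.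
have [d d0 hd] : exists2 d : R, 0 < d & forall r, `|r - 0| <= d -> `|z r - z 0| <= `|z 0| / 2.
  by apply: near_half; rewrite z0 oner_eq0.
pose r0 := Num.min d L.
have r00 : 0 < r0 by rewrite lt_min d0 L0.
have r0L : r0 <= L by rewrite ge_min lexx orbT.
have r0d : r0 <= d by rewrite ge_min lexx.
have small s : 0 <= s <= r0 -> c / 2 * s <= v s.
  move=> /andP[s0 sr]; have := @ivp_increment_ge 0 s (2^-1) (lexx 0) s0 (le_trans sr r0L).
  rewrite v00 !subr0; apply => [|r /andP[rr rs]]; first by rewrite invr_ge0.
  have := hd r; rewrite subr0 z0 normr1 ger0_norm// ler_norml.
  move=> /(_ (le_trans rs (le_trans sr r0d)))/andP[h _]; lra.
have [c' c'0 c'P] : exists2 c' : R, 0 < c' & forall s, r0 <= s <= L -> c' <= v s.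
  apply: continuous_pos_min => // s /andP[rs sL].
  have s0 := lt_le_trans r00 rs.
  move: sL; rewrite le_eqVlt => /predU1P[->|sL]; last by apply: ivp_pos_interior; rewrite s0.
  by rewrite lt_neqAle eq_sym vL v0// lexx ltW.
exists (Num.min (c / 2) (c' / L)); first by rewrite lt_min !divr_gt0.
move=> s /andP[s0 sL]; have [sr|rs] := leP s r0.
  apply: le_trans (small s _); last by rewrite s0.
  by apply: ler_wpM2r => //; rewrite ge_min lexx.
apply: le_trans (c'P s _); last by rewrite sL ltW.
apply: (@le_trans _ _ (c' / L * s)).
  by apply: ler_wpM2r => //; rewrite ge_min lexx orbT.
by rewrite mulrAC ler_pdivrMr// ler_pM2l.
Qed.

End BoundaryPoint.

(** The quantity followed is the infimum of v(s) / s over (0, L]; dividing by s removes the zero of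
    v at 0. It is continuous in the energy, positive at [E0] and nonpositive at [E1]. Where it
    vanishes v is nonnegative, and v(L) = 0, since otherwise [ivp_linear_lower] would make the
    infimum positive. *)
Lemma shooting L (K C E0 E1 c : R) alpha (beta : R -> R -> R) :
  0 < L -> 0 < K -> 0 <= C -> E0 <= E1 -> 0 < c -> bm L alpha ->
  (forall E, bm L (beta E)) ->
  (forall s, 0 <= s <= L -> c <= alpha s <= K) ->
  (forall E s, E0 <= E <= E1 -> 0 <= s <= L -> `|beta E s| <= K) ->
  (forall E E' s, 0 <= s <= L -> `|beta E s - beta E' s| <= C * `|E - E'|) ->
  (forall s, 0 <= s <= L -> 0 <= beta E0 s) ->
  (forall v z, ivp L alpha (beta E1) v z -> exists2 s, 0 < s <= L & v s <= 0) ->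
  exists E v z, [/\ E0 <= E <= E1, ivp L alpha (beta E) v z, v L = 0 &
    forall s, 0 <= s <= L -> 0 <= v s].
Proof.
move=> L0 K0 C0 E01 c0 ba bb aK bK bC b0 osc.
have L0' := ltW L0.
have aK' s : 0 <= s <= L -> `|alpha s| <= K.
  by move=> /aK /andP[? ?]; rewrite ger0_norm//; lra.
(* Clamping keeps the energy where [K] bounds the coefficients, and yields a function continuous on
   all of R for the intermediate value theorem. *)
pose En t := E0 + clamp (E1 - E0) t.
have EnI t : E0 <= En t <= E1.
  by rewrite /En; have := clamp_in t (_ : 0 <= E1 - E0); rewrite subr_ge0 => /(_ E01); lra.
have [v vP] : exists v : R -> R -> R, forall t, exists z, ivp L alpha (beta (En t)) (v t) z.
  have : forall t, exists v, exists z, ivp L alpha (beta (En t)) v z.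
    move=> t; apply: (@ivp_exists R L K) => //.
    by move=> s sL; apply: bK.
  by move=> /choice[w wP]; exists w.
have {vP} [z vzP] : exists z : R -> R -> R, forall t, ivp L alpha (beta (En t)) (v t) (z t).
  by have [w wP] := choice vP; exists w.
pose B := 2 * expR (2 * K * L).
have B0 : 0 <= B by rewrite mulr_ge0// expR_ge0.
have vzB t s : 0 <= s <= L -> `|v t s| <= B /\ `|z t s| <= B.
  move=> sL; have bKt r : 0 <= r <= L -> `|beta (En t) r| <= K by apply: bK.
  have := ivp_bound K0 L0' ba (bb (En t)) aK' bKt (vzP t) sL => h.
  have : 2 * expR (2 * K * s) <= B.
    by rewrite ler_pM2l// ler_expR ler_pM2l ?mulr_gt0//; case/andP: sL.
  have := normr_ge0 (v t s); have := normr_ge0 (z t s); lra.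
have v_lin t s : 0 <= s <= L -> `|v t s| <= K * B * s.
  move=> sL; have [cv cz vE zE] := vzP t; have [? ?] := andP sL.
  rewrite vE// -[s in K * B * s]subr0; apply: (@le_norm_Rint _ L) => //.
    by apply: bmM => //; exact: bm_continuous.
  by move=> r rs; rewrite normrM; apply: ler_pM => //; [apply: aK'|have [] := vzB t r ltac:(lra)]; lra.
pose S t := [set v t s / s | s in [set s | 0 < s <= L]].
have hS t : has_inf (S t).
  split; first by exists (v t L / L), L => //=; rewrite L0 lexx.
  exists (- (K * B)) => _ [s /= /andP[s0 sl] <-].
  rewrite ler_pdivlMr// mulNr.
  have := v_lin t s ltac:(lra); rewrite ler_norml => /andP[]; by [].
pose mm t := inf (S t).
have mmP t s : 0 < s <= L -> mm t * s <= v t s.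
  move=> /andP[s0 sl]; rewrite -ler_pdivlMr//; apply: inf_lbound; first by case: (hS t).
  by exists s => //=; rewrite s0.
pose Q := K * (4 * L * expR (2 * K * L) ^+ 2).
have Q0 : 0 <= Q by rewrite mulr_ge0 ?(ltW K0)// mulr_ge0 ?sqr_ge0// mulr_ge0.
have perturb t t' s : 0 <= s <= L -> `|v t s - v t' s| <= C * `|En t - En t'| * Q * s.
  move=> sL; apply: (ivp_perturb K0 L0' ba (bb (En t)) aK' _ (bb (En t')) _ _ _ (vzP t) (vzP t')) => //.
  - by move=> r rL; apply: bK.
  - by rewrite mulr_ge0.
  - by move=> r rL; apply: bK.
  - by move=> r rL; apply: bC.
  - by move=> r rL; have [] := vzB t' r rL.
have mm_step t t' : mm t' - C * `|En t - En t'| * Q <= mm t.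
  apply: lb_le_inf; first by case: (hS t).
  move=> _ [s /= sL <-]; have [s0 sl] := andP sL.
  rewrite ler_pdivlMr// mulrBl.
  have := mmP t' s sL; have := perturb t t' s ltac:(lra).
  by rewrite ler_norml => /andP[? ?]; lra.
have mm_cts : continuous mm.
  apply: (@lip_continuous _ _ (C * Q)) => t t' tt'.
  have /andP[c1 c2] := clamp_mono (E1 - E0) tt'.
  have En1 : `|En t - En t'| <= t' - t.
    by rewrite /En ler_norml; apply/andP; split; lra.
  have En2 : C * `|En t - En t'| * Q <= C * Q * (t' - t).
    by rewrite mulrAC ler_wpM2l// mulr_ge0.
  have := mm_step t t'; have := mm_step t' t; rewrite (distrC (En t')).
  by rewrite ler_norml => *; apply/andP; split; lra.
have En0 : En 0 = E0 by rewrite /En clampE ?addr0// lexx subr_ge0.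
have En1 : En (E1 - E0) = E1 by rewrite /En clampE; lra.
have mm0 : 0 < mm 0.
  apply: (lt_le_trans c0); apply: lb_le_inf; first by case: (hS 0).
  move=> _ [s /= /andP[s0 sl] <-]; rewrite ler_pdivlMr//.
  have := vzP 0; rewrite En0 => /(ivp_linear_growth L0 c0 ba (bb E0)); apply => //.
    by move=> r /aK /andP[].
  by lra.
have mm1 : mm (E1 - E0) <= 0.
  have := vzP (E1 - E0); rewrite En1 => /osc [s sL vs].
  have [s0 sl] := andP sL.
  by have := mmP (E1 - E0) s sL; nra.
have [t tI mmt] : exists2 t, t \in `[0, E1 - E0] & mm t = 0.
  apply: (@IVT R mm 0 (E1 - E0) 0); first lra.
    exact: continuous_subspaceT.
  by rewrite ge_min le_max mm1 (ltW mm0) orbT.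
exists (En t), (v t), (z t).
have [cv cz vE zE] := vzP t.
have vpos s : 0 <= s <= L -> 0 <= v t s.
  rewrite le_eqVlt => /andP[/predU1P[<- _|s0 sl]].
    by rewrite vE ?lexx// Rint_same.
  by have := mmP t s ltac:(by rewrite s0 sl); rewrite mmt mul0r.
split => //; apply/eqP/negP => /negP vL.
have [k kp kv] := ivp_linear_lower L0 K0 c0 ba (bb (En t)) aK (fun s sL => bK _ s (EnI t) sL)
  (vzP t) vpos vL.
have : k <= mm t.
  apply: lb_le_inf; first by case: (hS t).
  by move=> _ [s /= /andP[s0 sl] <-]; rewrite ler_pdivlMr// kv// sl ltW.
by rewrite mmt leNgt kp.
Qed.

End Shooting.

(** * Existence of the mode and its lower bounds at both ends *)

Section Eigenpair.
Context {R : realType}.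
Implicit Types (f Z q v z zeta : R -> R) (L a mu eps E B s : R).

(** On the whole zone the flux is nonnegative, so v is nondecreasing and its value at s1 bounds it
    from below on an interval of length s1, as an L^2 norm requires. *)
Lemma agmon_far f Z q v z zeta (s1 a mu eps E B Lam z0 : R) :
  0 < s1 -> 0 < eps -> 0 < a -> 0 <= mu ->
  smooth f -> smooth Z -> (forall s, 0 < Z s) -> bm (2 * s1) q ->
  (forall s, 0 <= s <= 2 * s1 -> [/\ `|derive1 f s| <= mu, `|q s| <= B,
     `|derive1 Z s / Z s| <= Lam, mu <= a * Z s &
     `|E| + eps * (B + mu * Lam) <= a * mu * Z s /\ E + eps * B <= (a * Z s) ^+ 2]) ->
  zeta 0 = 0 -> (forall s, is_derive s 1 zeta (Z s)) ->
  bm (2 * s1) v -> bm (2 * s1) z -> 0 <= z0 ->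
  (forall s, 0 <= s <= 2 * s1 -> v s = Rint 0 s (fun r => wgtV f Z eps r * z r)) ->
  (forall s, 0 <= s <= 2 * s1 -> z s = z0 + Rint 0 s (fun r => wpot f Z q a E eps r * v r)) ->
  forall s, s1 <= s <= 2 * s1 ->
    z0 * wgtV f Z eps 0 * (eps / (2 * a * Z 0)) *
      (expR ((a * zeta s1 - mu * s1) / eps) - 1) <= v s.
Proof.
move=> s10 eps0 a0 mu0 sf sZ Z0 bq H zeta0 dzeta bv bz z00 vE zE s ss.
have x0 : 0 <= 2 * s1 by lra.
have A := agmon x0 eps0 a0 mu0 sf sZ Z0 bq H zeta0 dzeta bv bz z00 vE zE.
have [h1 _] := A s1 ltac:(lra).
have cZ := smooth_continuous sZ.
have zs1 : 0 <= zeta s1.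
  have := Rint_FTC (ltW s10) cZ dzeta; rewrite zeta0 subr0 => <-.
  by apply: Rint_ge0 => r _; exact/ltW.
have bpV : bm (2 * s1) (wgtV f Z eps) by apply: bm_smooth; exact: smooth_wgtV.
have vmono : v s1 <= v s.
  rewrite !vE; try lra.
  rewrite (@Rint_chasles _ (2 * s1) _ 0 s1 s); [|exact: bmM|lra|lra|lra|lra].
  rewrite lerDl; apply: Rint_ge0 => r rs; have [_ zr] := A r ltac:(lra).
  by rewrite mulr_ge0// ltW// wgtV_gt0.
apply: le_trans vmono; apply: le_trans h1.
have -> : z0 * wgtV f Z eps 0 = z0 / wgt f Z eps 0.
  have K := wgtK f eps (lt0r_neq0 (Z0 0)).
  have w0 : wgt f Z eps 0 != 0 by rewrite gt_eqF// wgt_gt0.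
  by apply: (mulIf w0); rewrite divfK// -mulrA K mulr1.
apply: ler_wpM2l.
  apply: mulr_ge0; first by rewrite divr_ge0// ltW// wgt_gt0.
  by rewrite divr_ge0 ?(ltW eps0)// mulr_ge0 ?(ltW (Z0 0))// mulr_ge0// ltW.
rewrite lerB// -[leRHS]expR0 ler_expR pmulr_lle0 ?invr_gt0//.
have : 0 <= a * zeta s1 by rewrite mulr_ge0// ltW.
have : 0 <= mu * s1 by rewrite mulr_ge0// ltW.
by lra.
Qed.

Lemma smooth_reflect L f : smooth f -> smooth (fun s => f (L - s)).
Proof.
move=> /smoothP sf; apply/smoothP => n; apply: (@Ck_comp _ n (fun s => L - s)) => //.
by apply: CkB; [exact: Ck_cst|exact: Ck_id].
Qed.

Lemma is_derive_reflect L f (g : R -> R) s : (forall s, is_derive s 1 f (g s)) ->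
  is_derive s 1 (fun s => f (L - s)) (- g (L - s)).
Proof.
move=> fg; have d : is_derive s 1 (fun s => L - s) (-1).
  by apply: is_derive_congr (is_derive1B (is_derive1_cst L s) (is_derive1_id s)) _; rewrite sub0r.
apply: is_derive_congr (@is_derive1_o _ f (fun s => L - s) s _ _ (fg _) d) _.
by rewrite mulrN1.
Qed.

Lemma derive1_reflect L f s : smooth f -> derive1 (fun s => f (L - s)) s = - derive1 f (L - s).
Proof.
move=> sf; apply: is_derive_derive1; apply: (@is_derive_reflect L f (derive1 f)) => r.
exact: smooth_is_derive.
Qed.

Lemma bmW L L' f : L' <= L -> bm L f -> bm L' f.
Proof.
move=> LL [mf [K fK]]; split; last by exists K => s sL; apply: fK; lra.
by apply: measurable_funS mf => //; move=> s /=; rewrite !in_itv /=; lra.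
Qed.

(** The reflection s -> L - s turns v into a solution with initial flux - z(L), whose sign is not
    known beforehand. [agmon_far] is applied to v or to - v accordingly; a lower bound for - v is
    also one for v, because v >= 0. *)
Lemma agmon_far_right f Z q v z zeta (L s1 a mu eps E B Lam : R) :
  0 < L -> 0 < s1 -> 2 * s1 <= L -> 0 < eps -> 0 < a -> 0 <= mu ->
  smooth f -> smooth Z -> (forall s, 0 < Z s) -> bm L q ->
  (forall s, L - 2 * s1 <= s <= L -> [/\ `|derive1 f s| <= mu, `|q s| <= B,
     `|derive1 Z s / Z s| <= Lam, mu <= a * Z s &
     `|E| + eps * (B + mu * Lam) <= a * mu * Z s /\ E + eps * B <= (a * Z s) ^+ 2]) ->
  (forall s, is_derive s 1 zeta (Z s)) ->
  ivp L (wgtV f Z eps) (wpot f Z q a E eps) v z -> v L = 0 ->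
  (forall s, 0 <= s <= L -> 0 <= v s) ->
  forall s, s1 <= s <= 2 * s1 ->
    `|z L| * wgtV f Z eps L * (eps / (2 * a * Z L)) *
    (expR ((a * (zeta L - zeta (L - s1)) - mu * s1) / eps) - 1) <= v (L - s).
Proof.
move=> L0 s10 s1L eps0 a0 mu0 sf sZ Z0 bq cond dzeta [cv cz vE zE] vL vpos.
have bv := bm_continuous L cv; have bz := bm_continuous L cz.
have spV : smooth (wgtV f Z eps) by exact: smooth_wgtV.
have bpV := bm_smooth L spV.
have bbeta : bm L (wpot f Z q a E eps) by exact: bm_wpot.
have bbv := bmM bbeta bv; have bpz := bmM bpV bz.
have refl_range r : 0 <= r <= 2 * s1 -> L - 2 * s1 <= L - r <= L by clear; lra.
have s1L_in r : 0 <= r <= 2 * s1 -> 0 <= r <= L by clear -s1L; lra.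
have Lr_in r : 0 <= r <= L -> 0 <= L - r <= L by clear; lra.
have L_in : 0 <= L <= L by rewrite lexx ltW.
have vD r : 0 <= r <= L -> Rint (L - r) L (fun t => wgtV f Z eps t * z t) = v L - v (L - r).
  move=> rL; have /andP[l0 lL] := Lr_in r rL.
  rewrite (vE _ (Lr_in r rL)) (vE _ L_in) (Rint_chasles bpz (lexx 0) l0 lL (lexx L)).
  by rewrite addrAC subrr add0r.
have zD r : 0 <= r <= L -> Rint (L - r) L (fun t => wpot f Z q a E eps t * v t) = z L - z (L - r).
  move=> rL; have /andP[l0 lL] := Lr_in r rL.
  rewrite (zE _ (Lr_in r rL)) (zE _ L_in) (Rint_chasles bbv (lexx 0) l0 lL (lexx L)).
  by rewrite opprD addrACA subrr add0r addrAC subrr add0r.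
move=> s ss.
pose fr s := f (L - s); pose Zr' s := Z (L - s); pose qr s := q (L - s).
pose zr s := zeta L - zeta (L - s).
have sfr : smooth fr := smooth_reflect sf.
have sZr : smooth Zr' := smooth_reflect sZ.
have condr r : 0 <= r <= 2 * s1 ->
   [/\ `|derive1 fr r| <= mu, `|qr r| <= B,
     `|derive1 Zr' r / Zr' r| <= Lam, mu <= a * Zr' r &
     `|E| + eps * (B + mu * Lam) <= a * mu * Zr' r /\ E + eps * B <= (a * Zr' r) ^+ 2].
  move=> rs; have [c1 c2 c3 c4 c5] := cond _ (refl_range r rs).
  rewrite /fr /Zr' /qr (derive1_reflect L r sf) (derive1_reflect L r sZ) mulNr !normrN.
  by split.
have zr0 : zr 0 = 0 by rewrite /zr subr0 subrr.
have dzr (r : R) : is_derive r 1 zr (Zr' r).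
  apply: is_derive_congr (is_derive1B (is_derive1_cst (zeta L) r) (is_derive_reflect L r dzeta)) _.
  by rewrite sub0r opprK.
have bvr := bm_reflect bv; have bzr := bm_reflect bz; have bqr := bm_reflect bq.
have vrE r : 0 <= r <= L -> v (L - r) = - Rint 0 r (fun t => wgtV fr Zr' eps t * z (L - t)).
  move=> rL; have [r0 rL'] := andP rL.
  have -> : Rint 0 r (fun t => wgtV fr Zr' eps t * z (L - t)) =
      Rint (L - r) L (fun t => wgtV f Z eps t * z t).
    by have := Rint_reflect bpz (lexx 0) r0 rL'; rewrite subr0 => <-.
  by rewrite (vD _ rL) vL sub0r opprK.
have zrE r : 0 <= r <= L -> z (L - r) = z L - Rint 0 r (fun t => wpot fr Zr' qr a E eps t * v (L - t)).
  move=> rL; have [r0 rL'] := andP rL.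
  have -> : Rint 0 r (fun t => wpot fr Zr' qr a E eps t * v (L - t)) =
      Rint (L - r) L (fun t => wpot f Z q a E eps t * v t).
    by have := Rint_reflect bbv (lexx 0) r0 rL'; rewrite subr0 => <-.
  by rewrite (zD _ rL) opprB addrCA subrr addr0.
have bV : bm L (wgtV fr Zr' eps) by apply: bm_smooth; exact: smooth_wgtV.
have Zr0 t : 0 < Zr' t by exact: Z0.
have bW : bm L (wpot fr Zr' qr a E eps) by exact: bm_wpot.
have sgn (sg : R) : sg = 1 \/ sg = -1 -> 0 <= sg * - z L ->
   (sg * - z L) * wgtV f Z eps L * (eps / (2 * a * Z L)) *
      (expR ((a * (zeta L - zeta (L - s1)) - mu * s1) / eps) - 1) <= sg * v (L - s).
  move=> sg1 sgz.
  have bsv : bm L (fun s => sg * v (L - s)) by apply: bmM => //; exact: bm_cst.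
  have bsz : bm L (fun s => sg * - z (L - s)) by apply: bmM; [exact: bm_cst|exact: bmN].
  have := @agmon_far fr Zr' qr (fun s => sg * v (L - s)) (fun s => sg * - z (L - s)) zr
    s1 a mu eps E B Lam (sg * - z L) s10 eps0 a0 mu0 sfr sZr Zr0
    (bmW s1L bqr) condr zr0 dzr (bmW s1L bsv) (bmW s1L bsz) sgz.
  rewrite /zr /Zr' /wgtV /fr subr0; apply => //.
  - move=> r rs; have rL := s1L_in r rs; have /andP[r0 rL'] := rL.
    rewrite (vrE _ rL) mulrN -mulNr -(@RintZ _ L)//; last by apply: bmM => //.
    by apply: eq_Rint => t _; rewrite /wgtV /fr /Zr'; ring.
  - move=> r rs; have rL := s1L_in r rs; have /andP[r0 rL'] := rL.
    rewrite (zrE _ rL) opprB mulrDr addrC mulrN -(@RintZ _ L)//; last by apply: bmM => //.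
    by congr (_ + _); apply: eq_Rint => t _; ring.
have vs0 : 0 <= v (L - s) by apply: vpos; clear -ss s10 s1L; lra.
case: (ger0P (z L)) => zL.
  have := sgn (-1) ltac:(by right); rewrite mulrNN mul1r => /(_ zL) h.
  by apply: le_trans h _; clear -vs0; lra.
by have := sgn 1 ltac:(by left); rewrite !mul1r => /(_ ltac:(clear -zL; lra)).
Qed.

(** Energies are sought in [- mu^2 / 2, mu^2 / 2]. At the lower end the potential is nonnegative for
    small eps. At the upper end, on [x1, y1], the bound (a Z)^2 <= mu^2 / 8 and the Liouville term
    f'^2 / 4 <= mu^2 / 4 leave at most - mu^2 / 8 plus terms of order eps, so that [sturm] yields a
    point where v <= 0. Near the ends a Z >= 3 mu / 2 leaves room for |E| in the hypotheses of
    [agmon]. *)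
Theorem eigenpair f Z q zeta (L B a mu s1 x1 y1 : R) :
  0 < L -> 0 < a -> 0 < mu -> 0 < s1 -> 2 * s1 <= L -> 0 < x1 -> x1 < y1 -> y1 <= L ->
  smooth f -> smooth Z -> (forall s, 0 < Z s) -> bm L q ->
  (forall s, 0 <= s <= L -> `|derive1 f s| <= mu) ->
  (forall s, 0 <= s <= L -> `|q s| <= B) ->
  (forall s, 0 <= s <= 2 * s1 -> 3 / 2 * mu <= a * Z s) ->
  (forall s, L - 2 * s1 <= s <= L -> 3 / 2 * mu <= a * Z s) ->
  (forall s, x1 <= s <= y1 -> (a * Z s) ^+ 2 <= mu ^+ 2 / 8) ->
  zeta 0 = 0 -> (forall s, is_derive s 1 zeta (Z s)) ->
  exists2 eps0, 0 < eps0 & forall eps, 0 < eps < eps0 ->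
  exists E v z, [/\ E <= mu ^+ 2 / 2,
    ivp L (wgtV f Z eps) (wpot f Z q a E eps) v z, v L = 0,
    (forall s, s1 <= s <= 2 * s1 ->
      wgtV f Z eps 0 * (eps / (2 * a * Z 0)) *
      (expR ((a * zeta s1 - mu * s1) / eps) - 1) <= v s) &
    (forall s, s1 <= s <= 2 * s1 ->
      `|z L| * wgtV f Z eps L * (eps / (2 * a * Z L)) *
      (expR ((a * (zeta L - zeta (L - s1)) - mu * s1) / eps) - 1) <= v (L - s))].
Proof.
move=> L0 a0 mu0 s10 s1L x10 xy1 y1L sf sZ Z0 bq fmu qB Zl Zr ZI zeta0 dzeta.
have B0 : 0 <= B by apply: le_trans (qB 0 _) => //; rewrite lexx ltW.
pose N s := derive1 Z s / Z s.
have sN : smooth N := smooth_mul (smooth_derive1 sZ) (smooth_inv Z0 sZ).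
have sN' := smooth_derive1 sN.
have sf1 := smooth_derive1 sf; have sf2 := smooth_derive1 sf1.
have [Lam Lam0 LamP] := continuous_bounded 0 L (smooth_continuous sN).
have [Lam' Lam'0 Lam'P] := continuous_bounded 0 L (smooth_continuous sN').
have [F2 F20 F2P] := continuous_bounded 0 L (smooth_continuous sf2).
pose kk : R := (pi / (y1 - x1)) ^+ 2.
have kk0 : 0 <= kk by rewrite sqr_ge0.
(* [C] collects all the terms of order eps; eps C has to stay below the margin mu^2 / 8 = mu^2 / 2 -
   mu^2 / 4 - mu^2 / 8. *)
pose C : R := B + mu * Lam + Lam ^+ 2 + F2 + Lam' + kk + 1.
have muLam : 0 < mu * Lam by rewrite mulr_gt0.
have Lam2 : 0 <= Lam ^+ 2 by rewrite sqr_ge0.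
have C0 : 0 < C by rewrite /C; clear -B0 muLam Lam2 F20 Lam'0 kk0; lra.
have mu2 : 0 < mu ^+ 2 by rewrite exprn_gt0.
exists (Num.min 1 (mu ^+ 2 / 8 / C)).
  by rewrite lt_min ltr01 !divr_gt0.
move=> eps /andP[eps0]; rewrite lt_min => /andP[eps1 epsC].
have {}epsC : eps * C < mu ^+ 2 / 8 by rewrite -ltr_pdivlMr.
have epsn0 : eps != 0 by rewrite gt_eqF.
have eB : eps * B <= eps * C by rewrite ler_pM2l// /C; lra.
have eBL : eps * (B + mu * Lam) <= eps * C by rewrite ler_pM2l// /C; lra.
have eq s : 0 <= s <= L -> - (eps * B) <= eps * q s <= eps * B.
  by move=> sL; have := qB s sL; rewrite -mulrN ler_norml !ler_pM2l.
have spV : smooth (wgtV f Z eps) by exact: smooth_wgtV.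
have sp : smooth (wgt f Z eps) by exact: smooth_wgt.
have bpV := bm_smooth L spV.
have cp := smooth_continuous sp; have cpV := smooth_continuous spV.
have [c c0 cP] := @continuous_pos_min _ (wgtV f Z eps) 0 L (ltW L0) cpV
  (fun s _ => wgtV_gt0 f eps (Z0 s)).
have [K1 K10 K1P] := continuous_bounded 0 L cpV.
have [K3 K30 K3P] := continuous_bounded 0 L cp.
have bbeta E : bm L (wpot f Z q a E eps) by exact: bm_wpot.
have [_ [K2 K2P]] := bbeta 0.
have K2x := le_trans (normr_ge0 _) (K2P 0 ltac:(rewrite lexx ltW//)).
have e20 : 0 < eps ^+ 2 by rewrite exprn_gt0.
have wE E E' s : wpot f Z q a E eps s - wpot f Z q a E' eps s =
    wgt f Z eps s / eps ^+ 2 * (E' - E).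
  by rewrite /wpot /pot; field.
have wC E E' s : 0 <= s <= L -> `|wpot f Z q a E eps s - wpot f Z q a E' eps s| <=
    K3 / eps ^+ 2 * `|E - E'|.
  move=> sL; rewrite wE normrM distrC normrM [`|(eps ^+ 2)^-1|]ger0_norm ?invr_ge0 ?(ltW e20)//.
  by rewrite ler_wpM2r// ler_wpM2r ?invr_ge0 ?(ltW e20)// K3P.
have C30 : 0 <= K3 / eps ^+ 2 by rewrite divr_ge0// ltW.
have CKm : 0 <= K3 / eps ^+ 2 * (mu ^+ 2 / 2).
  by apply: mulr_ge0 => //; clear -mu2; lra.
have [] := @shooting R L (K1 + K2 + K3 / eps ^+ 2 * (mu ^+ 2 / 2)) (K3 / eps ^+ 2)
  (- (mu ^+ 2 / 2)) (mu ^+ 2 / 2) c (wgtV f Z eps)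
  (fun E => wpot f Z q a E eps) L0 _ C30 _ c0 bpV bbeta _ _ _ _ _.
- by clear -CKm K10 K2x; lra.
- by clear -mu2; lra.
- move=> s sL; rewrite cP//=; apply: le_trans (ler_norm _) _; apply: le_trans (K1P s sL) _.
  by clear -CKm K2x; lra.
- move=> E s EI sL.
  have -> : wpot f Z q a E eps s = wpot f Z q a 0 eps s + (wpot f Z q a E eps s - wpot f Z q a 0 eps s) by rewrite addrC subrK.
  apply: le_trans (ler_normD _ _) _.
  have := wC E 0 s sL; rewrite subr0.
  have : K3 / eps ^+ 2 * `|E| <= K3 / eps ^+ 2 * (mu ^+ 2 / 2).
    by apply: ler_wpM2l => //; rewrite ler_norml.
  by have := K2P s sL; clear -K10; lra.
- exact: wC.
- move=> s sL; rewrite mulr_ge0 ?(ltW (wgt_gt0 f eps (Z0 s)))// divr_ge0 ?(ltW e20)// /pot.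
  have := eq s sL; have : 0 <= (a * Z s) ^+ 2 by rewrite sqr_ge0.
  by clear -eB epsC mu2; lra.
- move=> v z vz.
  have [s sI vs] : exists2 s, x1 <= s <= y1 & v s <= 0.
    apply: (sturm eps0 (ltW x10) xy1 y1L sf sZ Z0 bq vz) => s sI.
    have sL : 0 <= s <= L by clear -sI x10 y1L; lra.
    have dm : derive1 (half_log_derive f Z eps) s = (derive1 (derive1 f) s / eps - derive1 N s) / 2.
      apply: is_derive_derive1.
      have d1 := is_derive1M (smooth_is_derive s sf1) (is_derive1_cst eps^-1 s).
      have d2 := is_derive1M (is_derive1B d1 (smooth_is_derive s sN)) (is_derive1_cst 2^-1 s).
      by apply: is_derive_congr d2 _; rewrite !mulr0 !addr0.
    rewrite dm -/kk.
    have -> : eps ^+ 2 * (half_log_derive f Z eps s ^+ 2 +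
        (derive1 (derive1 f) s / eps - derive1 N s) / 2 + kk) =
      (derive1 f s ^+ 2 - 2 * eps * (derive1 f s * N s) + eps ^+ 2 * N s ^+ 2) / 4 +
      eps * derive1 (derive1 f) s / 2 - eps ^+ 2 * derive1 N s / 2 + eps ^+ 2 * kk.
      by rewrite /half_log_derive -/(N s); field.
    rewrite /pot.
    have h1 := ZI s sI; have h2 := eq s sL.
    have n1 := fmu s sL; have n2 := LamP s sL; have n3 := F2P s sL; have n4 := Lam'P s sL.
    have h3 : derive1 f s ^+ 2 <= mu ^+ 2.
      by rewrite -(real_normK (num_real _)) ler_pXn2r// ?nnegrE ?(ltW mu0).
    have h4 : - (eps * (mu * Lam)) <= eps * (derive1 f s * N s).
      rewrite -mulrN ler_pM2l//.
      have : `|derive1 f s * N s| <= mu * Lam by rewrite normrM ler_pM.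
      by rewrite ler_norml => /andP[].
    have e2 : eps ^+ 2 <= eps by rewrite expr2 ler_piMr// ltW.
    have h5 : eps ^+ 2 * N s ^+ 2 <= eps * Lam ^+ 2.
      apply: ler_pM => //; rewrite ?sqr_ge0//.
      by rewrite -(real_normK (num_real _)) ler_pXn2r// ?nnegrE ?(ltW Lam0).
    have h6 : eps * derive1 (derive1 f) s <= eps * F2.
      by rewrite ler_pM2l// (le_trans (ler_norm _)).
    have h7 : - (eps ^+ 2 * derive1 N s) <= eps * Lam'.
      rewrite -mulrN; apply: le_trans (_ : _ <= eps ^+ 2 * Lam') _.
        by rewrite ler_pM2l// (le_trans (ler_norm _))// normrN.
      by rewrite ler_pM2r.
    have h8 : eps ^+ 2 * kk <= eps * kk by rewrite ler_wpM2r.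
    have p1 : 0 <= eps * (mu * Lam) by rewrite mulr_ge0// ltW.
    have p2 : 0 <= eps * Lam ^+ 2 by rewrite mulr_ge0// ltW.
    have p3 : 0 <= eps * F2 by rewrite mulr_ge0// ltW.
    have p4 : 0 <= eps * Lam' by rewrite mulr_ge0// ltW.
    have eC : eps * C = eps * B + eps * (mu * Lam) + eps * Lam ^+ 2 + eps * F2 + eps * Lam' + eps * kk + eps.
      by rewrite /C !mulrDr mulr1.
    move: {+}epsC; rewrite eC; clear -h1 h2 h3 h4 h5 h6 h7 h8 p1 p2 p3 p4 mu2 eps0; lra.
  by exists s => //; clear -sI x10 y1L; lra.
move=> E [v [z [EI vz vL vpos]]]; exists E, v, z.
have nE : `|E| <= mu ^+ 2 / 2 by rewrite ler_norml.
have [cv cz vE zE] := vz.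
have bv := bm_continuous L cv; have bz := bm_continuous L cz.
have bbv := bmM (bbeta E) bv; have bpz := bmM bpV bz.
have cond s : 0 <= s <= L -> 3 / 2 * mu <= a * Z s ->
   [/\ `|derive1 f s| <= mu, `|q s| <= B,
     `|derive1 Z s / Z s| <= Lam, mu <= a * Z s &
     `|E| + eps * (B + mu * Lam) <= a * mu * Z s /\ E + eps * B <= (a * Z s) ^+ 2].
  move=> sL aZ; split; [exact: fmu|exact: qB|exact: LamP|clear -aZ mu0; lra|].
  have h1 : mu * (3 / 2 * mu) <= mu * (a * Z s) by rewrite ler_pM2l.
  have h2 : (3 / 2 * mu) ^+ 2 <= (a * Z s) ^+ 2.
    by rewrite ler_pXn2r// ?nnegrE; clear -aZ mu0; lra.
  have -> : a * mu * Z s = mu * (a * Z s) by ring.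
  have h3 : mu * (3 / 2 * mu) = 3 / 2 * mu ^+ 2 by ring.
  have h4 : (3 / 2 * mu) ^+ 2 = 9 / 4 * mu ^+ 2 by field.
  have h5 := ler_norm E.
  by rewrite h3 in h1; rewrite h4 in h2; clear -h1 h2 h5 nE eBL eB epsC mu2; split; lra.
split => //; first by case/andP: EI.
- move=> s ss.
  have := @agmon_far f Z q v z zeta s1 a mu eps E B Lam 1 s10 eps0 a0 (ltW mu0) sf sZ Z0
    (bmW s1L bq) _ zeta0 dzeta (bmW s1L bv) (bmW s1L bz) ler01.
  rewrite mul1r; apply => //.
  + by move=> r rs; apply: cond; [clear -rs s1L; lra|exact: Zl].
  + by move=> r rs; apply: vE; clear -rs s1L; lra.
  + by move=> r rs; apply: zE; clear -rs s1L; lra.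
apply: (agmon_far_right L0 s10 s1L eps0 a0 (ltW mu0) sf sZ Z0 bq _ dzeta vz vL vpos).
by move=> s ss; apply: cond; [clear -ss s1L s10; lra|exact: Zr].
Qed.

End Eigenpair.

(** * Separated solutions of the viscous equation *)

Section Integrals.
Context {R : realType}.
Local Notation leb := (@lebesgue_measure R).

(* No measurability is needed, as the integral is a lower integral. *)
Lemma le_lower_integral d (T : measurableType d) (mu : {measure set T -> \bar R})
    (D : set T) (f g : T -> \bar R) :
  (forall x, D x -> 0 <= f x)%E -> (forall x, D x -> f x <= g x)%E ->
  (\int[mu]_(x in D) f x <= \int[mu]_(x in D) g x)%E.
Proof.
move=> f0 fg.
have g0 x : D x -> (0 <= g x)%E by move=> Dx; apply: le_trans (f0 _ Dx) (fg _ Dx).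
rewrite !ge0_integralE//; apply: le_ereal_sup => _ [h /= hf <-]; exists h => //= x.
apply: le_trans (hf x) _; rewrite !patchE; case: ifPn => // xD.
by apply: fg; rewrite inE in xD.
Qed.

Lemma integral_le_cst d (T : measurableType d) (mu : {measure set T -> \bar R})
    (D : set T) (f : T -> \bar R) (M : R) : measurable D -> 
  (forall x, D x -> 0 <= f x)%E -> (forall x, D x -> f x <= M%:E)%E ->
  (\int[mu]_(x in D) f x <= M%:E * mu D)%E.
Proof.
move=> mD f0 fM; rewrite -integral_cst//.
exact: le_lower_integral.
Qed.

Lemma EFin_Rint L (f : R -> R) x y : bm L f -> 0 <= x -> y <= L ->
  (\int[leb]_(s in `[x, y]) (f s)%:E)%E = (Rint x y f)%:E.
Proof.
move=> bf x0 yL; rewrite /Rint /Rintegral fineK//.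
by apply: integrable_fin_num => //; exact: bm_integrable bf x0 yL.
Qed.

Lemma integral_tensor L P (h k : R -> R) : 0 <= L -> 0 <= P -> bm L h -> bm P k ->
  (forall s, 0 <= s <= L -> 0 <= h s) -> (forall s, 0 <= s <= P -> 0 <= k s) ->
  (\int[(leb \x leb)%E]_(x in `[0%R, L] `*` `[0%R, P]) (h x.1 * k x.2)%:E)%E =
  (Rint 0 L h * Rint 0 P k)%:E.
Proof.
move=> L0 P0 bh bk h0 k0.
pose h' := h \_ `[0, L]%classic; pose k' := k \_ `[0, P]%classic.
have mh' : measurable_fun setT h'.
  by have [mh _] := bh; apply/(measurable_restrictT _ _).1.
have mk' : measurable_fun setT k'.
  by have [mk _] := bk; apply/(measurable_restrictT _ _).1.
have h'0 s : 0 <= h' s.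
  by rewrite /h' patchE; case: ifPn => //; rewrite inE /= in_itv /=; exact: h0.
have k'0 s : 0 <= k' s.
  by rewrite /k' patchE; case: ifPn => //; rewrite inE /= in_itv /=; exact: k0.
rewrite integral_mkcond.
transitivity (\int[(leb \x leb)%E]_x (h' x.1 * k' x.2)%:E)%E.
  apply: eq_integral => -[s t] _; rewrite patchE /h' /k' !patchE /=.
  have -> : ((s, t) \in `[0, L] `*` `[0, P]) = (s \in `[0, L]%classic) && (t \in `[0, P]%classic).
    apply/idP/idP; first by rewrite inE => -[/= h1 h2]; apply/andP; split; rewrite inE.
    by move=> /andP[]; rewrite !inE => h1 h2; split.
  by case: (s \in _); case: (t \in _); rewrite /= ?mul0r ?mulr0.
have mhk : measurable_fun setT (fun x : R * R => (h' x.1 * k' x.2)%:E).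
  apply/measurable_EFinP; apply: measurable_funM.
    exact: (measurableT_comp mh' measurable_fst).
  exact: (measurableT_comp mk' measurable_snd).
rewrite fubini_tonelli1//; last by move=> x; rewrite lee_fin mulr_ge0.
rewrite /fubini_F /=.
have ek : (\int[leb]_y (k' y)%:E = (Rint 0 P k)%:E)%E.
  rewrite -(EFin_Rint bk (lexx 0) (lexx P)) [RHS]integral_mkcond.
  by apply: eq_integral => s _; rewrite /k' !patchE; case: ifP.
have eh : (\int[leb]_y (h' y)%:E = (Rint 0 L h)%:E)%E.
  rewrite -(EFin_Rint bh (lexx 0) (lexx L)) [RHS]integral_mkcond.
  by apply: eq_integral => s _; rewrite /h' !patchE; case: ifP.
transitivity (\int[leb]_x ((h' x)%:E * (Rint 0 P k)%:E))%E.
  apply: eq_integral => x _; rewrite -ek -ge0_integralZl//.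
  - exact/measurable_EFinP.
  - by move=> y _; rewrite lee_fin.
  - by rewrite lee_fin.
have rk0 : 0 <= Rint 0 P k by apply: Rint_ge0.
rewrite ge0_integralZr//.
- by rewrite eh EFinM.
- exact/measurable_EFinP.
- by move=> y _; rewrite lee_fin.
Qed.

End Integrals.

Section RotJets.
Context {R : realType}.
Variables (L : R) (Rad : R -> R).
Hypotheses (L0 : 0 < L) (sRad : smooth Rad) (Rad0 : forall s, 0 < Rad s).
Local Notation leb := (@lebesgue_measure R).
Local Notation g := (rot_metric Rad).
Implicit Types (x : R * R) (ws : nat -> R -> R).

Lemma gdet_rot x : gdet g x = Rad x.1 ^+ 2.
Proof. by rewrite /gdet /= mul1r expr0n subr0. Qed.

Lemma gvol_rot x : gvol g x = Rad x.1.
Proof. by rewrite /gvol gdet_rot sqrtr_sqr ger0_norm// ltW. Qed.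

Lemma iss_rot x : iss g x = 1.
Proof. by rewrite /iss gdet_rot /= divff// expf_neq0// gt_eqF. Qed.

Lemma ist_rot x : ist g x = 0.
Proof. by rewrite /ist /= oppr0 mul0r. Qed.

Lemma itt_rot x : itt g x = (Rad x.1 ^+ 2)^-1.
Proof. by rewrite /itt gdet_rot /= mul1r. Qed.

Lemma sharp_rot (a : R * R) x : sharp g a x = (a.1, a.2 / Rad x.1 ^+ 2).
Proof. by rewrite /sharp iss_rot ist_rot itt_rot !mul0r mul1r addr0 add0r mulrC. Qed.

(* The jet of [ws 0 (s) cos (k theta)], where [ws i] stands for the [i]-th derivative. *)
Definition rot_jet ws k : jet := fun i j => tens (ws i) (derive1n j (ckt k)).

Lemma smooth_dckt k j : smooth (derive1n j (@ckt R k)).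
Proof. by apply: smooth_derive1n; exact: smooth_ckt. Qed.

Lemma bmX P (f : R -> R) : bm P f -> bm P (fun s => f s ^+ 2).
Proof.
move=> bf; rewrite (_ : (fun s => _) = fun s => f s * f s); first exact: bmM.
by apply/funext => s; rewrite expr2.
Qed.

Lemma bmRad P : bm P Rad.
Proof. exact: bm_continuous (smooth_continuous sRad). Qed.

Lemma measurable_fdom : measurable (fdom L).
Proof. by apply: measurableX; exact: measurable_itv. Qed.

Lemma measurable_tens (G c : R -> R) : bm L G -> continuous c ->
  measurable_fun (fdom L) (tens G c).
Proof.
move=> [mG _] cc.
have mfd : measurable (fdom L) by exact: measurable_fdom.
pose G' := G \_ `[0, L]%classic.
have mG' : measurable_fun setT G' by apply/(measurable_restrictT _ _).1.
apply: (@eq_measurable_fun _ _ _ _ _ (tens G' c)).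
  move=> x; rewrite inE => -[x1 _]; rewrite /tens /G' patchE.
  by rewrite ifT// inE.
apply: measurable_funTS; apply: measurable_funM.
  exact: (measurableT_comp mG' measurable_fst).
exact: (measurableT_comp (continuous_measurable_fun cc) measurable_snd).
Qed.

Lemma pi20 : 0 <= pi *+ 2 :> R.
Proof. by rewrite mulrn_wge0// pi_ge0. Qed.

Lemma integral_S_tens (G c : R -> R) : bm L G -> continuous c ->
  (forall s, 0 <= G s) -> (forall s, 0 <= c s) ->
  integral_S L g (tens G c) = (Rint 0 L (fun s => G s * Rad s) * Rint 0 (pi *+ 2) c)%:E.
Proof.
move=> bG cc G0 c0; rewrite -(@integral_tensor R L (pi *+ 2)).
- by apply: eq_integral => x _; rewrite gvol_rot /tens mulrAC.
- exact: ltW.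
- exact: pi20.
- by apply: bmM => //; exact: bmRad.
- exact: bm_continuous.
- by move=> s _; rewrite mulr_ge0// ltW.
- by [].
Qed.

Lemma L2sq_tens (G c : R -> R) : bm L G -> smooth c ->
  L2sq L g (tens G c) =
  (Rint 0 L (fun s => G s ^+ 2 * Rad s) * Rint 0 (pi *+ 2) (fun t => c t ^+ 2))%:E.
Proof.
move=> bG sc; rewrite -integral_S_tens.
- by congr (integral_S _ _ _); apply/funext => x; rewrite /tens exprMn.
- exact: bmX.
- have cc := smooth_continuous sc.
  rewrite (_ : (fun t => _) = fun t => c t * c t); first exact: ctsM.
  by apply/funext => s; rewrite expr2.
- by move=> s; exact: sqr_ge0.
- by move=> s; exact: sqr_ge0.
Qed.

Lemma cvg_EFin0 (u : nat -> R) : u n @[n --> \oo] --> (0 : R) ->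
  (u n)%:E @[n --> \oo] --> 0%E.
Proof. by move=> u0; apply: cvg_EFin => //; exact: nearW. Qed.

Lemma cvg0_mulr (u : nat -> R) (c : R) : u n @[n --> \oo] --> (0 : R) ->
  u n * c @[n --> \oo] --> (0 : R).
Proof. by move=> u0; have := cvgM u0 (cvg_cst c); rewrite mul0r; exact. Qed.

Lemma cvg0_mull (u : nat -> R) (c : R) : u n @[n --> \oo] --> (0 : R) ->
  c * u n @[n --> \oo] --> (0 : R).
Proof. by move=> u0; have := cvgM (cvg_cst c) u0; rewrite mulr0; exact. Qed.

(** The angular factor is the same along the sequence, so the errors factor and only the
    one-variable L^2 errors have to tend to 0. *)
Lemma Hlim_rot m (phi : nat -> R -> R) ws k : (forall n, smooth (phi n)) ->
  (forall i, (i <= m)%N -> bm L (ws i)) ->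
  (forall i, (i <= m)%N ->
     Rint 0 L (fun s => (derive1n i (phi n) s - ws i s) ^+ 2) @[n --> \oo] --> (0 : R)) ->
  Hlim L g m (fun n => tens (phi n) (ckt k)) (rot_jet ws k).
Proof.
move=> sphi bws cws i j ijm.
have im : (i <= m)%N by rewrite (leq_trans _ ijm)// leq_addr.
split.
  by apply: measurable_tens; [exact: bws|exact: smooth_continuous (@smooth_dckt k j)].
have bD n : bm L (fun s => derive1n i (phi n) s - ws i s).
  apply: bmB; last exact: bws.
  exact: bm_continuous (smooth_continuous (@smooth_derive1n R i _ (sphi n))).
have EF n : pd i j (tens (phi n) (ckt k)) \- rot_jet ws k i j =
    tens (fun s => derive1n i (phi n) s - ws i s) (derive1n j (ckt k)).
  rewrite (pd_tens i j (sphi n) (@smooth_ckt R k)).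
  by apply/funext => x; rewrite /rot_jet /tens mulrBl.
have E n : L2sq L g (pd i j (tens (phi n) (ckt k)) \- rot_jet ws k i j) =
    (Rint 0 L (fun s => (derive1n i (phi n) s - ws i s) ^+ 2 * Rad s) *
     Rint 0 (pi *+ 2) (fun t => derive1n j (ckt k) t ^+ 2))%:E.
  by rewrite EF; exact: (L2sq_tens (bD n) (@smooth_dckt k j)).
under eq_fun do rewrite E.
apply: cvg_EFin0.
apply: cvg0_mulr.
have [K K0 KP] := continuous_bounded 0 L (smooth_continuous sRad).
have cK : K * Rint 0 L (fun s => (derive1n i (phi n) s - ws i s) ^+ 2) @[n --> \oo] --> (0 : R).
  by apply: cvg0_mull; exact: cws.
apply: (squeeze_cvgr _ (cvg_cst 0) cK).
near=> n; apply/andP; split.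
  by apply: Rint_ge0 => s _; rewrite mulr_ge0 ?sqr_ge0// ltW.
rewrite -(@RintZ _ L)//; last exact: bmX.
apply: (@le_Rint _ L) => //.
- by apply: bmM; [exact: bmX|exact: bmRad].
- by apply: bmM; [exact: bm_cst|exact: bmX].
move=> s sL; rewrite mulrC ler_wpM2r ?sqr_ge0//.
exact: le_trans (ler_norm _) (KP s sL).
Unshelve. all: by end_near. Qed.

Definition rot_energy ws k : R :=
  (Rint 0 L (fun s => ws 0%N s ^+ 2 * Rad s) + Rint 0 L (fun s => ws 1%N s ^+ 2 * Rad s)) *
     Rint 0 (pi *+ 2) (fun t => ckt k t ^+ 2)
  + Rint 0 L (fun s => (ws 0%N s / Rad s) ^+ 2 * Rad s) *
     Rint 0 (pi *+ 2) (fun t => derive1 (ckt k) t ^+ 2).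

Lemma ctsX (f : R -> R) : continuous f -> continuous (fun s => f s ^+ 2).
Proof.
move=> cf; rewrite (_ : (fun s => _) = fun s => f s * f s); first exact: ctsM.
by apply/funext => s; rewrite expr2.
Qed.

Lemma bmRadV P : bm P (fun s => (Rad s)^-1).
Proof.
apply: bm_continuous; apply: smooth_continuous; apply/smoothP => n.
by apply: CkV; [move=> s; rewrite gt_eqF|exact: smooth_Ck].
Qed.

Lemma integral_S_D (F1 F2 : R * R -> R) : measurable_fun (fdom L) F1 ->
  measurable_fun (fdom L) F2 -> (forall x, 0 <= F1 x) -> (forall x, 0 <= F2 x) ->
  integral_S L g (fun x => F1 x + F2 x) = (integral_S L g F1 + integral_S L g F2)%E.
Proof.
move=> m1 m2 F10 F20.
have mfd : measurable (fdom L) by exact: measurable_fdom.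
have mR : measurable_fun (fdom L) (fun x : R * R => gvol g x).
  have -> : (fun x : R * R => gvol g x) = Rad \o fst.
    by apply/funext => x; rewrite gvol_rot.
  apply: measurable_funTS; apply: measurableT_comp; last exact: measurable_fst.
  exact: continuous_measurable_fun (smooth_continuous sRad).
rewrite /integral_S -ge0_integralD//.
- by apply: eq_integral => x _; rewrite mulrDl EFinD.
- by move=> x _; rewrite lee_fin mulr_ge0// gvol_rot ltW.
- by apply/measurable_EFinP; exact: measurable_funM.
- by move=> x _; rewrite lee_fin mulr_ge0// gvol_rot ltW.
- by apply/measurable_EFinP; exact: measurable_funM.
Qed.

Lemma H1sq_rot ws k : bm L (ws 0%N) -> bm L (ws 1%N) ->
  H1sq L g (rot_jet ws k) = (rot_energy ws k)%:E.
Proof.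
move=> b0 b1.
have bv : bm L (fun s => ws 0%N s / Rad s) by apply: bmM => //; exact: bmRadV.
have c0 : continuous (fun t => ckt k t ^+ 2 : R).
  by apply: ctsX; exact: smooth_continuous (@smooth_ckt R k).
have c1 : continuous (fun t => derive1 (ckt k) t ^+ 2 : R).
  by apply: ctsX; exact: smooth_continuous (@smooth_dckt k 1).
have -> : H1sq L g (rot_jet ws k) = integral_S L g (fun x =>
    (tens (fun s => ws 0%N s ^+ 2) (fun t => ckt k t ^+ 2) x +
     tens (fun s => ws 1%N s ^+ 2) (fun t => ckt k t ^+ 2) x) +
    tens (fun s => (ws 0%N s / Rad s) ^+ 2) (fun t => derive1 (ckt k) t ^+ 2) x).
  congr (integral_S _ _ _); apply/funext => x.
  rewrite /jet_grad sharp_rot /ginner /rot_jet /tens /= /derive1n /=.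
  by field; rewrite gt_eqF.
have sq (f : R -> R) s : 0 <= f s ^+ 2 by exact: sqr_ge0.
rewrite integral_S_D; first rewrite integral_S_D.
- rewrite !integral_S_tens => //; try exact: bmX; try (by move=> s; exact: sqr_ge0).
  by rewrite -!EFinD /rot_energy mulrDl.
- by apply: measurable_tens => //; exact: bmX.
- by apply: measurable_tens => //; exact: bmX.
- by move=> x; rewrite mulr_ge0 ?sqr_ge0.
- by move=> x; rewrite mulr_ge0 ?sqr_ge0.
- by apply: measurable_funD; apply: measurable_tens => //; exact: bmX.
- by apply: measurable_tens => //; exact: bmX.
- by move=> x; apply: addr_ge0; apply: mulr_ge0; exact: sqr_ge0.
- by move=> x; apply: mulr_ge0; exact: sqr_ge0.
Qed.

Lemma rot_energyZ (c : R) ws k : bm L (ws 0%N) -> bm L (ws 1%N) ->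
  rot_energy (fun i s => c * ws i s) k = c ^+ 2 * rot_energy ws k.
Proof.
move=> b0 b1; have L0' := ltW L0.
have bv : bm L (fun s => ws 0%N s / Rad s) by apply: bmM => //; exact: bmRadV.
have bR := bmRad L.
have H (f : R -> R) : bm L f -> Rint 0 L (fun s => (c * f s) ^+ 2 * Rad s) =
    c ^+ 2 * Rint 0 L (fun s => f s ^+ 2 * Rad s).
  move=> bf; rewrite -(@RintZ _ L)//; last by apply: bmM => //; exact: bmX.
  by apply: eq_Rint => s _; rewrite exprMn mulrA.
rewrite /rot_energy !H//.
have -> : Rint 0 L (fun s => (c * ws 0%N s / Rad s) ^+ 2 * Rad s) =
    c ^+ 2 * Rint 0 L (fun s => (ws 0%N s / Rad s) ^+ 2 * Rad s).
  by rewrite -H//; apply: eq_Rint => s _; rewrite mulrA.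
by ring.
Qed.

Lemma derive1_const (c : R) (s : R) : derive1 (fun=> c) s = 0.
Proof. exact: is_derive_derive1 (is_derive1_cst c s). Qed.

Lemma laplace_rot ws k x : laplace_beltrami g (rot_jet ws k) x =
  (ws 2%N x.1 - k%:R ^+ 2 / Rad x.1 ^+ 2 * ws 0%N x.1
   + derive1 Rad x.1 / Rad x.1 * ws 1%N x.1) * ckt k x.2.
Proof.
rewrite /laplace_beltrami iss_rot ist_rot itt_rot gvol_rot.
have e1 : gvol g \* iss g = fun x => Rad x.1.
  by apply/funext => y /=; rewrite iss_rot gvol_rot mulr1.
have e2 : gvol g \* ist g = fun=> 0 by apply/funext => y /=; rewrite ist_rot mulr0.
have e3 : gvol g \* itt g = fun y => Rad y.1 * (Rad y.1 ^+ 2)^-1.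
  by apply/funext => y /=; rewrite itt_rot gvol_rot.
rewrite e1 e2 e3.
have d1 : ds (fun x : R * R => Rad x.1) x = derive1 Rad x.1 by rewrite dsE.
have d2 : ds (fun _ : R * R => 0) x = 0 by rewrite dsE; exact: (@derive1_const 0 x.1).
have d3 : dth (fun _ : R * R => 0) x = 0 by rewrite dthE; exact: (@derive1_const 0 x.2).
have d4 : dth (fun y : R * R => Rad y.1 * (Rad y.1 ^+ 2)^-1) x = 0.
  rewrite dthE; exact: (@derive1_const (Rad x.1 * (Rad x.1 ^+ 2)^-1) x.2).
rewrite d1 d2 d3 d4 !addr0 !mul0r mul0rn addr0 mul1r.
rewrite /rot_jet /tens derive1n2_ckt /derive1n /=.
by field; rewrite gt_eqF.
Qed.

Lemma generator_rot (f : R -> R) (q : R -> R) eps ws k x : smooth f ->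
  generator g (fun x => f x.1) q eps (rot_jet ws k) x =
  (derive1 f x.1 * ws 1%N x.1 + q x.1 * ws 0%N x.1 +
   eps * (ws 2%N x.1 - k%:R ^+ 2 / Rad x.1 ^+ 2 * ws 0%N x.1
   + derive1 Rad x.1 / Rad x.1 * ws 1%N x.1)) * ckt k x.2.
Proof.
move=> sf; rewrite /generator laplace_rot /grad sharp_rot /jet_grad sharp_rot.
have -> : ds (fun x : R * R => f x.1) x = derive1 f x.1 by rewrite dsE.
have -> : dth (fun x : R * R => f x.1) x = 0.
  by rewrite dthE; exact: (@derive1_const (f x.1) x.2).
rewrite /ginner /rot_jet /tens /= /derive1n /=.
by field; rewrite gt_eqF.
Qed.

Lemma dnu_rot (phi c : R -> R) x : smooth phi ->
  dnu g (tens phi c) x = (if x.1 == 0 then -1 else 1) * (derive1 phi x.1 * c x.2).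
Proof.
move=> sphi; rewrite /dnu /grad sharp_rot iss_rot sqrtr1 invr1 mulr1 /=.
by rewrite ds_tens.
Qed.

End RotJets.

(** * Smooth approximation of the mode, in H^2 and with compact support in H^1 *)

Section Approximation.
Context {R : realType}.
Implicit Types (v z w alpha beta f : R -> R) (L K s C : R).

Lemma cvg_inv_nat (u : nat -> R) C : (forall n, 0 <= u n <= C / n.+1%:R) ->
  u n @[n --> \oo] --> (0 : R).
Proof.
move=> uC.
have cH : C / n.+1%:R @[n --> \oo] --> (0 : R).
  by apply: cvg0_mull; exact: (@cvg_harmonic R).
apply: (squeeze_cvgr _ (cvg_cst 0) cH).
by near=> n; exact: uC.
Unshelve. all: by end_near. Qed.

Lemma inv_nat_le1 (n : nat) : (n.+1%:R)^-1 <= 1 :> R.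
Proof. by rewrite invf_le1// ler1n. Qed.

Lemma inv_nat_gt0 (n : nat) : 0 < (n.+1%:R)^-1 :> R.
Proof. by rewrite invr_gt0. Qed.

Lemma inv_nat_sqr (n : nat) : (n.+1%:R)^-1 ^+ 2 <= (n.+1%:R)^-1 :> R.
Proof.
by rewrite expr2; apply: ler_piMl; [exact: ltW (inv_nat_gt0 n)|exact: inv_nat_le1].
Qed.

Lemma sqr_sub_le (x y a b : R) : x ^+ 2 <= a -> y ^+ 2 <= b ->
  (x - y) ^+ 2 <= 2 * a + 2 * b.
Proof.
move=> xa yb; have h := sqr_ge0 (x + y).
have -> : (x - y) ^+ 2 = 2 * x ^+ 2 + 2 * y ^+ 2 - (x + y) ^+ 2 by ring.
by lra.
Qed.

Lemma sqr_le_norm (x y : R) : `|x| <= y -> x ^+ 2 <= y ^+ 2.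
Proof.
move=> xy; rewrite -(real_normK (num_real x)) ler_pXn2r// nnegrE.
exact: le_trans xy.
Qed.

(** The right-hand side beta v of z' is replaced by smooth functions close to it in L^1, and the
    system is integrated twice. The fluxes and the functions then converge uniformly; only second
    derivatives call for an integral norm. *)
Lemma ivp_smooth_approx L alpha beta v z : 0 < L -> smooth alpha -> bm L beta ->
  ivp L alpha beta v z -> exists (phi : nat -> R -> R) C,
  [/\ forall n, smooth (phi n), 0 <= C,
    (forall n s, 0 <= s <= L -> `|phi n s - v s| <= C / n.+1%:R),
    (forall n s, 0 <= s <= L -> `|derive1 (phi n) s - alpha s * z s| <= C / n.+1%:R) &
    (forall n, Rint 0 L (fun s => (derive1 (derive1 (phi n)) s -
       (derive1 alpha s * z s + alpha s * (beta s * v s))) ^+ 2) <= C / n.+1%:R)].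
Proof.
move=> L0 sa bb [cv cz vE zE]; have L0' := ltW L0.
have bv := bm_continuous L cv; have bz := bm_continuous L cz.
have bbv := bmM bb bv.
have [_ [K KP]] := bbv.
have K0 : 0 <= K by apply: le_trans (KP 0 _) => //; rewrite lexx.
have ca := smooth_continuous sa; have sa' := smooth_derive1 sa; have ca' := smooth_continuous sa'.
have ba := bm_continuous L ca; have ba' := bm_continuous L ca'.
have [A A0 AP] := continuous_bounded 0 L ca.
have [A' A'0 A'P] := continuous_bounded 0 L ca'.
have dense (n : nat) : exists h, [/\ smooth h, forall s, `|h s| <= K &
    Rint 0 L (fun s => `|beta s * v s - h s|) <= (n.+1%:R)^-1].
  by apply: smooth_L1_dense => //; exact: inv_nat_gt0.
have [h hP] := choice dense.
have prim1 n : exists F : R -> R, F 0 = 1 /\ forall s, is_derive s 1 F (h n s).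
  by apply: primitive_exists; have [sh _ _] := hP n; exact: smooth_continuous.
have [zn znP] := choice prim1.
have szn n : smooth (zn n).
  by have [sh _ _] := hP n; have [_ dz] := znP n; exact: smooth_primitive sh dz.
have prim2 n : exists F : R -> R, F 0 = 0 /\ forall s, is_derive s 1 F (alpha s * zn n s).
  exact: primitive_exists (ctsM ca (smooth_continuous (szn n))).
have [phi phiP] := choice prim2.
have sphi n : smooth (phi n).
  by have [_ d] := phiP n; exact: smooth_primitive (smooth_mul sa (szn n)) d.
have dphi n : derive1 (phi n) = fun s => alpha s * zn n s.
  by apply/funext => s; have [_ d] := phiP n; exact: is_derive_derive1.
have zn_z n s : 0 <= s <= L -> `|zn n s - z s| <= (n.+1%:R)^-1.
  move=> sL; have [s0 sl] := andP sL; have [sh hK he] := hP n; have [z1 dz] := znP n.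
  have ch := smooth_continuous sh; have bh := bm_continuous L ch.
  have -> : zn n s - z s = Rint 0 s (h n) - Rint 0 s (fun r => beta r * v r).
    by rewrite (Rint_FTC s0 ch dz) z1 zE//; clear; lra.
  rewrite -(@RintB _ L)//.
  apply: le_trans (le_Rint_norm (bmB bh bbv) _ sl) _ => //.
  apply: le_trans he.
  have bn : bm L (fun s => `|beta s * v s - h n s|) by apply: bm_norm; exact: bmB.
  rewrite (Rint_chasles bn (lexx 0) s0 sl (lexx L)).
  under eq_Rint do rewrite distrC.
  by rewrite lerDl; apply: Rint_ge0 => r _; exact: normr_ge0.
have d1 n s : 0 <= s <= L -> `|derive1 (phi n) s - alpha s * z s| <= A / n.+1%:R.
  move=> sL; rewrite dphi -mulrBr normrM.
  by apply: ler_pM => //; [exact: AP|exact: zn_z].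
pose C := A + A * L + (2 * A' ^+ 2 * L + 4 * A ^+ 2 * K).
have AL : 0 <= A * L by rewrite mulr_ge0// ltW.
have CC : 0 <= 2 * A' ^+ 2 * L + 4 * A ^+ 2 * K.
  by apply: addr_ge0; do 2 apply: mulr_ge0 => //; exact: sqr_ge0.
have C0 : 0 <= C by rewrite /C; clear -AL CC A0; lra.
have up (a : R) n : a <= C -> a / n.+1%:R <= C / n.+1%:R.
  by move=> aC; rewrite ler_wpM2r.
exists phi, C; split => //.
- move=> n s sL; have [s0 sl] := andP sL.
  apply: le_trans (up (A * L) n _); last by rewrite /C; clear -AL CC A0; lra.
  have [p0 dp] := phiP n.
  have cc : continuous (fun s => alpha s * zn n s) := ctsM ca (smooth_continuous (szn n)).
  have bc := bm_continuous L cc; have baz := bmM ba bz.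
  have -> : phi n s - v s = Rint 0 s (fun s => alpha s * zn n s) - Rint 0 s (fun r => alpha r * z r).
    by rewrite (Rint_FTC s0 cc dp) p0 vE// subr0.
  rewrite -(@RintB _ L)//.
  apply: (@le_trans _ _ (A / n.+1%:R * (s - 0))).
    apply: (@le_norm_Rint _ L) => //; first exact: bmB.
    move=> r rs; have := d1 n r; rewrite dphi; apply.
    by clear -rs sl; lra.
  rewrite subr0 mulrAC ler_wpM2r// ler_wpM2l// ltW//.
- move=> n s sL; apply: le_trans (d1 n s sL) _; apply: up.
  by rewrite /C; clear -AL CC A0; lra.
move=> n; apply: le_trans (up (2 * A' ^+ 2 * L + 4 * A ^+ 2 * K) n _); last first.
  by rewrite /C; clear -AL CC A0; lra.
have [sh hK he] := hP n.
have ch := smooth_continuous sh; have bh := bm_continuous L ch.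
have d2 s : derive1 (derive1 (phi n)) s = derive1 alpha s * zn n s + alpha s * h n s.
  rewrite dphi; apply: is_derive_derive1.
  by apply: is_derive1M; [exact: smooth_is_derive|have [_] := znP n].
have bn : bm L (fun s => `|beta s * v s - h n s|) by apply: bm_norm; exact: bmB.
apply: (@le_trans _ _ (Rint 0 L (fun s => 2 * A' ^+ 2 / n.+1%:R + 4 * A ^+ 2 * K * `|beta s * v s - h n s|))).
  apply: (@le_Rint _ L) => //.
  - apply: bmX; apply: bmB; last first.
      by apply: bmD; apply: bmM.
    exact: bm_continuous (smooth_continuous (smooth_derive1 (smooth_derive1 (sphi n)))).
  - by apply: bmD; [exact: bm_cst|apply: bmM => //; exact: bm_cst].
  move=> s sL; rewrite d2.
  have -> : derive1 alpha s * zn n s + alpha s * h n s -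
    (derive1 alpha s * z s + alpha s * (beta s * v s)) =
    derive1 alpha s * (zn n s - z s) - alpha s * (beta s * v s - h n s) by ring.
  set x := derive1 alpha s * (zn n s - z s); set y := alpha s * _.
  have x1 : `|x| <= A' / n.+1%:R.
    by rewrite normrM; apply: ler_pM => //; [exact: A'P|exact: zn_z].
  set D := `|beta s * v s - h n s|.
  have y1 : `|y| <= A * D by rewrite normrM ler_wpM2r// AP.
  (* The sup bound turns smallness in L^1 into smallness in L^2. *)
  have D2 : D <= 2 * K.
    rewrite /D; apply: le_trans (ler_normB _ _) _.
    by have := KP s sL; have := hK s; clear; lra.
  have xx : x ^+ 2 <= A' ^+ 2 / n.+1%:R.
    apply: (@le_trans _ _ ((A' / n.+1%:R) ^+ 2)); first exact: sqr_le_norm.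
    by rewrite exprMn; apply: ler_wpM2l; [exact: sqr_ge0|exact: inv_nat_sqr].
  have yy : y ^+ 2 <= A ^+ 2 * (2 * K * D).
    apply: (@le_trans _ _ ((A * D) ^+ 2)); first exact: sqr_le_norm.
    by rewrite exprMn [D ^+ 2]expr2; apply: ler_wpM2l; [exact: sqr_ge0|by apply: ler_wpM2r; [exact: normr_ge0|exact: D2]].
  have -> : 2 * A' ^+ 2 / n.+1%:R = 2 * (A' ^+ 2 / n.+1%:R) by rewrite mulrA.
  have -> : 4 * A ^+ 2 * K * D = 2 * (A ^+ 2 * (2 * K * D)) by ring.
  exact: sqr_sub_le.
rewrite (@RintD _ L)//; [|exact: bm_cst|by apply: bmM => //; exact: bm_cst].
rewrite Rint_cst// (@RintZ _ L)// subr0 [leRHS]mulrDl; apply: lerD.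
  by rewrite mulrAC.
by apply: ler_wpM2l => //; do 2 apply: mulr_ge0 => //; exact: sqr_ge0.
Qed.

Definition cutoff L (d : R) s := sstep ((s - d) / d) * sstep ((L - d - s) / d).

Lemma smooth_affine_sstep (a b : R) : smooth (fun s => sstep (a * s + b)).
Proof.
apply/smoothP => n; apply: (@Ck_comp _ n (fun s => a * s + b)).
  by move=> m; apply: smooth_Ck; exact: smooth_sstep.
by apply: CkD; [apply: CkM; [exact: Ck_cst|exact: Ck_id]|exact: Ck_cst].
Qed.

Lemma smooth_cutoff L (d : R) : smooth (cutoff L d).
Proof.
rewrite (_ : cutoff L d = fun s => sstep (d^-1 * s + - d / d) * sstep (- d^-1 * s + (L - d) / d)).
  exact: (smooth_mul (@smooth_affine_sstep d^-1 (- d / d))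
    (@smooth_affine_sstep (- d^-1) ((L - d) / d))).
by apply/funext => s; congr (sstep _ * sstep _); move: (d^-1) => e; ring.
Qed.

Lemma cutoff_itv L (d : R) s : 0 <= cutoff L d s <= 1.
Proof.
by rewrite mulr_ge0 ?sstep_ge0//= mulr_ile1 ?sstep_ge0 ?sstep_le1.
Qed.

Lemma cutoff0 L (d : R) s : 0 < d -> (s <= d) || (L - d <= s) -> cutoff L d s = 0.
Proof.
move=> d0 /orP[h|h]; rewrite /cutoff.
  by rewrite sstep0 ?mul0r// ler_pdivrMr// mul0r; lra.
by rewrite [X in _ * X]sstep0 ?mulr0// ler_pdivrMr// mul0r; lra.
Qed.

Lemma cutoff1 L (d : R) s : 0 < d -> 2 * d <= s <= L - 2 * d -> cutoff L d s = 1.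
Proof.
move=> d0 /andP[h1 h2]; rewrite /cutoff !sstep1 ?mulr1//.
  by rewrite ler_pdivlMr//; lra.
by rewrite ler_pdivlMr//; lra.
Qed.

(** The cutoff is applied to the derivative, which is then integrated: cutting off v itself would
    differentiate the cutoff and produce a factor 1 / d. *)
Lemma H10_approx L (v w : R -> R) (h : nat -> R -> R) C : 0 < L -> 0 <= C -> bm L w ->
  (forall s, 0 <= s <= L -> v s = Rint 0 s w) -> bm L v -> v L = 0 ->
  (forall n, smooth (h n)) ->
  (forall n s, 0 <= s <= L -> `|h n s - w s| <= C / n.+1%:R) ->
  exists (phi : nat -> R -> R) K,
  [/\ forall n, smooth (phi n),
    (forall n, exists a b, [/\ 0 < a, b < L & forall s, ~~ (a <= s <= b) -> phi n s = 0]),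
    (forall n, Rint 0 L (fun s => (phi n s - v s) ^+ 2) <= K / n.+1%:R) &
    (forall n, Rint 0 L (fun s => (derive1 (phi n) s - w s) ^+ 2) <= K / n.+1%:R)].
Proof.
move=> L0 C0 bw vE bv vL sh hw; have L0' := ltW L0.
have [_ [W WP]] := bw.
have W0 : 0 <= W by apply: le_trans (WP 0 _) => //; rewrite lexx.
pose d (n : nat) : R := L / 4 / n.+1%:R.
have d0 n : 0 < d n by rewrite !divr_gt0.
have dL n : d n <= L / 4 by rewrite /d ler_piMr ?inv_nat_le1// divr_ge0.
pose r0 := cutoff L (L / 4).
have L40 : 0 < L / 4 by rewrite divr_gt0.
have sr0 : smooth r0 by exact: smooth_cutoff.
have cr0 := smooth_continuous sr0; have br0 := bm_continuous L cr0.
have r0I s : 0 <= r0 s <= 1 by exact: cutoff_itv.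
have I0 : 0 < Rint 0 L r0.
  have r1 : r0 (L / 2) = 1 by apply: cutoff1 => //; clear -L0; lra.
  have /cvgrPdist_le /(_ (1 / 2)) := cr0 (L / 2).
  move=> /(_ ltac:(clear; lra)) [e /= e0 eP].
  pose e' := Num.min (e / 2) (L / 4).
  have [e'0 e'e e'L] : [/\ 0 < e', e' < e & e' <= L / 4].
    by rewrite /e' minEle; case: ifP => h1; split; clear -h1 e0 L0; lra.
  have h2 : 1 / 2 * (L / 2 + e' - L / 2) <= Rint (L / 2) (L / 2 + e') r0.
    apply: (@le_cst_Rint _ L) => //; [clear -L0; lra|clear -e'0; lra|clear -e'L L0; lra|].
    move=> s sI; have : `|r0 (L / 2) - r0 s| <= 1 / 2.
      by apply: eP; rewrite /= ltr_norml; apply/andP; split; clear -sI e'0 e'e; lra.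
    by rewrite r1 ler_norml => /andP[? ?]; lra.
  have h3 := Rint_chasles br0 (lexx 0) (_ : 0 <= L / 2) (_ : L / 2 <= L) (lexx L).
  rewrite h3; [|clear -L0; lra|clear -L0; lra].
  have h4 := Rint_chasles br0 (_ : 0 <= L / 2) (_ : L / 2 <= L / 2 + e') (_ : L / 2 + e' <= L) (lexx L).
  rewrite h4; [|clear -L0; lra|clear -e'0; lra|clear -e'L L0; lra].
  have p1 : 0 <= Rint 0 (L / 2) r0 by apply: Rint_ge0 => s _; case/andP: (r0I s).
  have p2 : 0 <= Rint (L / 2 + e') L r0 by apply: Rint_ge0 => s _; case/andP: (r0I s).
  by clear -h2 p1 p2 e'0; lra.
pose I := Rint 0 L r0.
pose chi n := cutoff L (d n).
have schi n : smooth (chi n) by exact: smooth_cutoff.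
(* The cut-off derivative need not have integral 0. Subtracting [c n] times the fixed bump [r0]
   makes its primitive vanish again near L, and [c n] tends to 0 because the integral of [w] is v(L)
   = 0. *)
pose c n := Rint 0 L (fun s => chi n s * h n s) / I.
pose gn n s := chi n s * h n s - c n * r0 s.
have sgn n : smooth (gn n).
  have s1 := smooth_mul (schi n) (sh n).
  have s2 := smooth_mul (@smooth_cst R (c n)) sr0.
  exact: (smooth_add s1 (smooth_opp s2)).
have cgn n := smooth_continuous (sgn n).
have prim n : exists F : R -> R, F 0 = 0 /\ forall s, is_derive s 1 F (gn n s).
  exact: primitive_exists (cgn n).
have [phi phiP] := choice prim.
have sphi n : smooth (phi n) by have [_ dp] := phiP n; exact: smooth_primitive (sgn n) dp.
have dphi n : derive1 (phi n) = gn n.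
  by apply/funext => s; have [_ dp] := phiP n; exact: is_derive_derive1.
have bh n := bm_continuous L (smooth_continuous (sh n)).
have bchi n := bm_continuous L (smooth_continuous (schi n)).
have bch n := bmM (bchi n) (bh n).
have bcr n : bm L (fun s => c n * r0 s) by apply: bmM => //; exact: bm_cst.
have Ign n : Rint 0 L (gn n) = 0.
  rewrite /gn (@RintB _ L)// (@RintZ _ L)// /c divfK ?subrr//.
  by rewrite gt_eqF.
have phi_left n s : s <= d n -> phi n s = 0.
  move=> sd; have [p0 dp] := phiP n.
  have gz x : x <= d n -> gn n x = 0.
    move=> xd; rewrite /gn /chi cutoff0 ?xd// mul0r sub0r /r0 cutoff0 ?mulr0 ?oppr0//.
    by rewrite (le_trans xd).
  have [s0|s0] := leP 0 s.
    have := Rint_FTC s0 (cgn n) dp; rewrite p0 subr0 => <-.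
    rewrite (@eq_Rint _ _ (fun=> 0)) ?Rint_cst ?mul0r//.
    by move=> x xs; apply: gz; clear -xs sd; lra.
  have := Rint_FTC (ltW s0) (cgn n) dp; rewrite p0 sub0r.
  rewrite (@eq_Rint _ _ (fun=> 0)) ?Rint_cst ?mul0r ?ltW//; first by clear; lra.
  by move=> x xs; apply: gz; have := d0 n; clear -xs; lra.
have phiL n : phi n L = 0.
  by have [p0 dp] := phiP n; have := Rint_FTC L0' (cgn n) dp; rewrite p0 subr0 Ign.
have phi_right n s : L - d n <= s -> phi n s = 0.
  move=> sd; have [p0 dp] := phiP n.
  have gz x : L - d n <= x -> gn n x = 0.
    move=> xd; rewrite /gn /chi cutoff0 ?xd ?orbT// mul0r sub0r /r0 cutoff0 ?mulr0 ?oppr0//.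
    by apply/orP; right; have := dL n; clear -xd; lra.
  have [s0|s0] := leP L s.
    have := Rint_FTC s0 (cgn n) dp; rewrite phiL subr0 => <-.
    rewrite (@eq_Rint _ _ (fun=> 0)) ?Rint_cst ?mul0r//.
    by move=> x xs; apply: gz; have := d0 n; clear -xs; lra.
  have := Rint_FTC (ltW s0) (cgn n) dp; rewrite phiL sub0r.
  rewrite (@eq_Rint _ _ (fun=> 0)) ?Rint_cst ?mul0r ?ltW//; first by clear; lra.
  by move=> x xs; apply: gz; clear -xs sd; lra.
pose A n := Rint 0 L (fun s => `|chi n s * h n s - w s|).
pose C1 := C * L + W * L.
have bD n : bm L (fun s => chi n s * h n s - w s) by exact: bmB.
have bDn n := bm_norm (bD n).
have pw n s : 0 <= s <= L -> `|chi n s * h n s - w s| <= C / n.+1%:R + W * (1 - chi n s).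
  move=> sL; have /andP[c0 c1] := cutoff_itv L (d n) s; rewrite -/(chi n s) in c0 c1.
  have -> : chi n s * h n s - w s = chi n s * (h n s - w s) - (1 - chi n s) * w s by ring.
  apply: le_trans (ler_normB _ _) _; apply: lerD.
    rewrite normrM ger0_norm//; apply: le_trans (hw n s sL).
    by rewrite ler_piMl.
  rewrite normrM ger0_norm ?subr_ge0// mulrC; apply: ler_wpM2r; first by rewrite subr_ge0.
  exact: WP.
have b1c n : bm L (fun s => 1 - chi n s) by apply: bmB => //; exact: bm_cst.
have badL n : Rint 0 L (fun s => 1 - chi n s) <= L / n.+1%:R.
  have d2 : 2 * d n <= L - 2 * d n by have := dL n; clear; lra.
  have dp : 0 <= 2 * d n by have := d0 n; clear; lra.
  have dq : L - 2 * d n <= L by have := d0 n; clear; lra.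
  rewrite (Rint_chasles (b1c n) (lexx 0) dp (le_trans d2 dq) (lexx L)).
  rewrite (Rint_chasles (b1c n) dp d2 dq (lexx L)).
  have le1 s : 1 - chi n s <= 1.
    by have /andP[c0 _] := cutoff_itv L (d n) s; rewrite -/(chi n s) in c0; clear -c0; lra.
  have i1 := Rint_le_cst (b1c n) (lexx 0) dp (le_trans d2 dq) (fun s _ => le1 s).
  have i3 := Rint_le_cst (b1c n) (le_trans dp d2) dq (lexx L) (fun s _ => le1 s).
  have i2 : Rint (2 * d n) (L - 2 * d n) (fun s => 1 - chi n s) = 0.
    rewrite (@eq_Rint _ _ (fun=> 0)) ?Rint_cst ?mul0r//.
    by move=> s sI; rewrite /chi cutoff1// subrr.
  have e : L / n.+1%:R = 4 * d n by rewrite /d; move: (n.+1%:R^-1) => y; field.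
  by rewrite i2 e; clear -i1 i3; lra.
have AC n : A n <= C1 / n.+1%:R.
  apply: (@le_trans _ _ (Rint 0 L (fun s => C / n.+1%:R + W * (1 - chi n s)))).
    apply: (@le_Rint _ L) => //.
      by apply: bmD; [exact: bm_cst|apply: bmM => //; exact: bm_cst].
    by move=> s; exact: pw.
  rewrite (@RintD _ L)//; [|exact: bm_cst|by apply: bmM => //; exact: bm_cst].
  rewrite Rint_cst// (@RintZ _ L)// subr0 /C1 mulrDl; apply: lerD; first by rewrite mulrAC.
  by rewrite -mulrA; apply: ler_wpM2l.
have A0 n : 0 <= A n by apply: Rint_ge0 => s _; exact: normr_ge0.
have cI n : `|c n * I| <= A n.
  rewrite /c divfK; last by rewrite gt_eqF.
  have -> : Rint 0 L (fun s => chi n s * h n s) = Rint 0 L (fun s => chi n s * h n s - w s).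
    rewrite (@RintB _ L)//; have := vE L; rewrite vL => <-; first by rewrite subr0.
    by rewrite lexx ltW.
  exact: (le_Rint_norm (bD n) (lexx 0) (lexx L)).
have C10 : 0 <= C1 by rewrite addr_ge0// mulr_ge0.
pose B := C + W.
have B0 : 0 <= B by rewrite addr_ge0.
have pwB n s : 0 <= s <= L -> `|chi n s * h n s - w s| <= B.
  move=> sL; apply: le_trans (pw n s sL) _; apply: lerD.
    by rewrite ler_piMr ?inv_nat_le1.
  rewrite ler_piMr//; have /andP[c0 _] := cutoff_itv L (d n) s; rewrite -/(chi n s) in c0.
  by clear -c0; lra.
have cn n : `|c n| <= A n / I.
  by have := cI n; rewrite normrM [`|I|]gtr0_norm// -ler_pdivlMr.
have bgn n := bm_continuous L (cgn n).
have dv n s : 0 <= s <= L -> `|phi n s - v s| <= 2 * A n.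
  move=> sL; have [s0 sl] := andP sL; have [p0 dp] := phiP n.
  have -> : phi n s - v s = Rint 0 s (fun s => chi n s * h n s - w s) - c n * Rint 0 s r0.
    rewrite vE// -(@RintZ _ L)//.
    have -> : phi n s = Rint 0 s (gn n) by rewrite (Rint_FTC s0 (cgn n) dp) p0 subr0.
    by rewrite /gn !(@RintB _ L)//; clear; lra.
  apply: le_trans (ler_normB _ _) _.
  have h1 : `|Rint 0 s (fun s => chi n s * h n s - w s)| <= A n.
    apply: le_trans (le_Rint_norm (bD n) (lexx 0) sl) _.
    rewrite /A (Rint_chasles (bDn n) (lexx 0) s0 sl (lexx L)) lerDl.
    by apply: Rint_ge0 => r _; exact: normr_ge0.
  have h2 : `|c n * Rint 0 s r0| <= A n.
    apply: le_trans (cI n); rewrite !normrM; apply: ler_wpM2l => //.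
    have i0 x y : 0 <= Rint x y r0 by apply: Rint_ge0 => r _; case/andP: (r0I r).
    rewrite !ger0_norm ?i0// /I (Rint_chasles br0 (lexx 0) s0 sl (lexx L)) lerDl.
    exact: i0.
  by clear -h1 h2; lra.
pose K1 := L * (4 * C1 ^+ 2); pose K2 := 2 * B * C1 + 2 * (C1 / I) ^+ 2 * L.
have K10 : 0 <= K1 by rewrite mulr_ge0// mulr_ge0// sqr_ge0.
have K20 : 0 <= K2.
  by apply: addr_ge0; [rewrite !mulr_ge0|do 2 apply: mulr_ge0 => //; exact: sqr_ge0].
have AC1 n : A n ^+ 2 <= C1 ^+ 2 / n.+1%:R.
  apply: (@le_trans _ _ ((C1 / n.+1%:R) ^+ 2)).
    by apply: sqr_le_norm; rewrite ger0_norm.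
  by rewrite exprMn; apply: ler_wpM2l; [exact: sqr_ge0|exact: inv_nat_sqr].
exists phi, (K1 + K2); split => //.
- move=> n; exists (d n), (L - d n); split => //; first by have := d0 n; clear; lra.
  move=> s; rewrite negb_and -!ltNge => /orP[h1|h1]; first by apply: phi_left; exact: ltW.
  by apply: phi_right; exact: ltW.
- move=> n; apply: (@le_trans _ _ (K1 / n.+1%:R)); last first.
    by rewrite ler_wpM2r// lerDl.
  have bp := bm_continuous L (smooth_continuous (sphi n)).
  apply: (@le_trans _ _ (4 * A n ^+ 2 * (L - 0))).
    apply: (@Rint_le_cst _ L) => //; first by apply: bmX; exact: bmB.
    move=> s sL; have -> : 4 * A n ^+ 2 = (2 * A n) ^+ 2 by ring.
    by apply: sqr_le_norm; exact: dv.
  rewrite subr0 mulrC /K1 -mulrA; apply: ler_wpM2l => //.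
  by rewrite -mulrA; apply: ler_wpM2l.
move=> n; apply: (@le_trans _ _ (K2 / n.+1%:R)); last first.
  by rewrite ler_wpM2r// lerDr.
rewrite dphi.
apply: (@le_trans _ _ (Rint 0 L (fun s => 2 * B * `|chi n s * h n s - w s| + 2 * (A n / I) ^+ 2))).
  apply: (@le_Rint _ L) => //.
  - by apply: bmX; exact: bmB.
  - by apply: bmD; [apply: bmM => //; exact: bm_cst|exact: bm_cst].
  move=> s sL.
  have -> : gn n s - w s = (chi n s * h n s - w s) - c n * r0 s by rewrite /gn; ring.
  set x := chi n s * h n s - w s; set y := c n * r0 s.
  have xx : x ^+ 2 <= B * `|x|.
    by rewrite -(real_normK (num_real x)) expr2 ler_wpM2r// pwB.
  have yy : y ^+ 2 <= (A n / I) ^+ 2.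
    apply: sqr_le_norm; rewrite /y normrM; apply: le_trans (cn n).
    by have /andP[r1 r2] := r0I s; rewrite [`|r0 s|]ger0_norm// ler_piMr.
  by rewrite -mulrA; exact: sqr_sub_le.
rewrite (@RintD _ L)//; [|by apply: bmM => //; exact: bm_cst|exact: bm_cst].
rewrite (@RintZ _ L)// Rint_cst// subr0.
have In0 : I != 0 by rewrite gt_eqF.
have -> : K2 / n.+1%:R = 2 * B * (C1 / n.+1%:R) + 2 * (C1 ^+ 2 / n.+1%:R / I ^+ 2) * L.
  by rewrite /K2; move: (n.+1%:R^-1) => y; field.
apply: lerD; first by apply: ler_wpM2l; [rewrite mulr_ge0|exact: AC].
rewrite expr_div_n; apply: ler_wpM2r => //; apply: ler_wpM2l => //.
by apply: ler_wpM2r; [rewrite invr_ge0 sqr_ge0|exact: AC1].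
Qed.

End Approximation.

(** * The separated functions solve the viscous equation *)

Section Solution.
Context {R : realType}.
Variables (L : R) (f Z q : R -> R) (eps E : R) (k : nat) (v z : R -> R).
Hypotheses (L0 : 0 < L) (sf : smooth f) (sZ : smooth Z) (Z0 : forall s, 0 < Z s).
Hypotheses (bq : bm L q) (eps0 : 0 < eps).
Hypothesis vz : ivp L (wgtV f Z eps) (wpot f Z q (eps * k%:R) E eps) v z.
Hypothesis vL : v L = 0.
Local Notation leb := (@lebesgue_measure R).
Local Notation Rad := (fun s => (Z s)^-1).
Local Notation g := (rot_metric (fun s => (Z s)^-1)).
Local Notation alpha := (wgtV f Z eps).
Local Notation beta := (wpot f Z q (eps * k%:R) E eps).

(** The derivatives of v read off the system; the second one contains the measurable q and is a
    derivative in the weak sense. *)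
Definition ev_jet (i : nat) (s : R) : R :=
  match i with
  | 0%N => v s
  | 1%N => alpha s * z s
  | 2%N => derive1 alpha s * z s + alpha s * (beta s * v s)
  | _ => 0
  end.

Definition ev_exp (t : R) : R := expR (- (E / eps) * t).

Definition ev_sol (t : R) : jet := rot_jet (fun i s => ev_exp t * ev_jet i s) k.

Definition ev_trace (t : R) (x : R * R) : R :=
  (if x.1 == 0 then -1 else 1) * (ev_exp t * ev_jet 1 x.1 * ckt k x.2).

Let sRad : smooth Rad. Proof. exact: smooth_inv Z0 sZ. Qed.
Let Rad0 : forall s, 0 < Rad s. Proof. by move=> s; rewrite invr_gt0. Qed.
Let bv : bm L v. Proof. by have [cv _ _ _] := vz; exact: bm_continuous. Qed.
Let bz : bm L z. Proof. by have [_ cz _ _] := vz; exact: bm_continuous. Qed.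
Let salpha : smooth alpha. Proof. exact: smooth_wgtV sf sZ. Qed.
Let balpha : bm L alpha. Proof. exact: bm_continuous (smooth_continuous salpha). Qed.
Let bbeta : bm L beta. Proof. exact: bm_wpot sf sZ Z0 bq. Qed.

Lemma bm_ev_jet i : bm L (ev_jet i).
Proof.
case: i => [|[|[|i]]] /=; [exact: bv|exact: (bmM balpha bz)| |exact: bm_cst].
apply: bmD; last exact: (bmM balpha (bmM bbeta bv)).
exact: (bmM (bm_continuous L (smooth_continuous (smooth_derive1 salpha))) bz).
Qed.

Lemma bm_ev_jetZ (c : R) i : bm L (fun s => c * ev_jet i s).
Proof. by apply: bmM; [exact: bm_cst|exact: bm_ev_jet]. Qed.

Lemma smooth_scale (c : R) (phi : R -> R) : smooth phi -> smooth (fun s => c * phi s).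
Proof. exact: smooth_mul (@smooth_cst R c). Qed.

Lemma derive1_scale (c : R) (phi : R -> R) : smooth phi ->
  derive1 (fun s => c * phi s) = fun s => c * derive1 phi s.
Proof.
move=> sphi; apply/funext => s; apply: is_derive_derive1.
exact: is_derive1Z (smooth_is_derive s sphi).
Qed.

Lemma Rint_sqr_scale_cvg (c C : R) (F : nat -> R -> R) (G : R -> R) :
  (forall n, bm L (F n)) -> bm L G ->
  (forall n, Rint 0 L (fun s => (F n s - G s) ^+ 2) <= C / n.+1%:R) ->
  Rint 0 L (fun s => (c * F n s - c * G s) ^+ 2) @[n --> \oo] --> (0 : R).
Proof.
move=> bF bG FG; have L0' : 0 <= L := ltW L0.
have e n : Rint 0 L (fun s => (c * F n s - c * G s) ^+ 2) =
    c ^+ 2 * Rint 0 L (fun s => (F n s - G s) ^+ 2).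
  rewrite -(@RintZ _ L)//; last by apply: bmX; exact: bmB.
  by apply: eq_Rint => s _; rewrite -mulrBr exprMn.
under eq_fun do rewrite e.
apply: cvg0_mull; apply: (@cvg_inv_nat _ _ C) => n; rewrite FG andbT.
by apply: Rint_ge0 => s _; exact: sqr_ge0.
Qed.

Lemma sup_to_L2 (C : R) (F : nat -> R -> R) (G : R -> R) : 0 <= C ->
  (forall n, bm L (F n)) -> bm L G ->
  (forall n s, 0 <= s <= L -> `|F n s - G s| <= C / n.+1%:R) ->
  forall n, Rint 0 L (fun s => (F n s - G s) ^+ 2) <= C ^+ 2 * L / n.+1%:R.
Proof.
move=> C0 bF bG FG n; have L0' : 0 <= L := ltW L0.
apply: (@le_trans _ _ (C ^+ 2 / n.+1%:R * (L - 0))).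
  apply: (@Rint_le_cst _ L) => //; first by apply: bmX; exact: bmB.
  move=> s sL; apply: (@le_trans _ _ ((C / n.+1%:R) ^+ 2)).
    by apply: sqr_le_norm; exact: FG.
  by rewrite exprMn; apply: ler_wpM2l; [exact: sqr_ge0|exact: inv_nat_sqr].
by rewrite subr0 mulrAC.
Qed.

(** The approximants of [ivp_smooth_approx] need not vanish near the ends; their derivatives are fed
    to [H10_approx]. *)
Lemma ev_H10_jet (c : R) : H10_jet L g (rot_jet (fun i s => c * ev_jet i s) k).
Proof.
have L0' := L0.
have [phi [C [sphi C0 p0 p1 p2]]] := ivp_smooth_approx L0 salpha bbeta vz.
have [cv cz vE zE] := vz.
have [th [K [sth supp t0 t1]]] := H10_approx L0 C0 (bmM balpha bz) vE bv vL
  (fun n => smooth_derive1 (sphi n)) p1.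
exists (fun n => tens (fun s => c * th n s) (ckt k)); split.
  move=> n; split.
    exact: smooth_cyl_tens (@smooth_scale c _ (sth n)) (@smooth_ckt R k) (@periodic_ckt R k).
  have [a [b [a0 bL ab]]] := supp n; exists a, b; split => // x xab.
  by rewrite /tens ab// mulr0 mul0r.
apply: (Hlim_rot L0 sRad Rad0).
- exact: (fun n => @smooth_scale c _ (sth n)).
- by move=> i _; exact: bm_ev_jetZ.
move=> [|[|//]] _.
- apply: (@Rint_sqr_scale_cvg c K th (ev_jet 0)) => // n.
  exact: bm_continuous (smooth_continuous (sth n)).
- have e n : derive1n 1 (fun s => c * th n s) = fun s => c * derive1 (th n) s.
    by rewrite /derive1n /= (@derive1_scale c _ (sth n)).
  under eq_fun do rewrite e.
  apply: (@Rint_sqr_scale_cvg c K (fun n => derive1 (th n)) (ev_jet 1)) => //.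
    move=> n; exact: bm_continuous (smooth_continuous (smooth_derive1 (sth n))).
  exact: (bm_ev_jet 1).
Qed.

Lemma ev_Hlim2 (c : R) : exists phi : nat -> R -> R,
  [/\ forall n, smooth (phi n),
    Hlim L g 2 (fun n => tens (fun s => c * phi n s) (ckt k)) (rot_jet (fun i s => c * ev_jet i s) k) &
    forall s, 0 <= s <= L -> derive1 (phi n) s - ev_jet 1 s @[n --> \oo] --> (0 : R)].
Proof.
have [phi [C [sphi C0 p0 p1 p2]]] := ivp_smooth_approx L0 salpha bbeta vz.
have b0 n : bm L (phi n) := bm_continuous L (smooth_continuous (sphi n)).
have b1 n : bm L (derive1 (phi n)) :=
  bm_continuous L (smooth_continuous (smooth_derive1 (sphi n))).
have b2 n : bm L (derive1 (derive1 (phi n))) :=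
  bm_continuous L (smooth_continuous (smooth_derive1 (smooth_derive1 (sphi n)))).
exists phi; split => //; last first.
  move=> s sL; apply/norm_cvg0P; apply: (@cvg_inv_nat _ _ C) => n.
  by rewrite normr_ge0 p1.
apply: (Hlim_rot L0 sRad Rad0).
- exact: (fun n => @smooth_scale c _ (sphi n)).
- by move=> i _; exact: bm_ev_jetZ.
move=> [|[|[|//]]] _.
- apply: (@Rint_sqr_scale_cvg c (C ^+ 2 * L) phi (ev_jet 0)) => //.
  exact: (sup_to_L2 C0 b0 (bm_ev_jet 0) p0).
- have e n : derive1n 1 (fun s => c * phi n s) = fun s => c * derive1 (phi n) s.
    by rewrite /derive1n /= (@derive1_scale c _ (sphi n)).
  under eq_fun do rewrite e.
  apply: (@Rint_sqr_scale_cvg c (C ^+ 2 * L) (fun n => derive1 (phi n)) (ev_jet 1)) => //.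
    exact: (bm_ev_jet 1).
  exact: (sup_to_L2 C0 b1 (bm_ev_jet 1) p1).
- have e n : derive1n 2 (fun s => c * phi n s) = fun s => c * derive1 (derive1 (phi n)) s.
    rewrite /derive1n /= (@derive1_scale c _ (sphi n)).
    exact: (@derive1_scale c _ (smooth_derive1 (sphi n))).
  under eq_fun do rewrite e.
  apply: (@Rint_sqr_scale_cvg c C (fun n => derive1 (derive1 (phi n))) (ev_jet 2)) => //.
  exact: (bm_ev_jet 2).
Qed.

Lemma ev_H2_jet (c : R) : H2_jet L g (rot_jet (fun i s => c * ev_jet i s) k).
Proof.
have [phi [sphi H _]] := ev_Hlim2 c; exists (fun n => tens (fun s => c * phi n s) (ckt k)).
split => // n.
exact: smooth_cyl_tens (@smooth_scale c _ (sphi n)) (@smooth_ckt R k) (@periodic_ckt R k).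
Qed.

Lemma L2sq_bd_rot (b : R * R -> R) (B : R -> R) : (forall c th, b (c, th) = B c * ckt k th) ->
  L2sq_bd L g b = ((B 0 ^+ 2 * Rad 0 + B L ^+ 2 * Rad L) *
     Rint 0 (pi *+ 2) (fun t => ckt k t ^+ 2))%:E.
Proof.
move=> bB.
have cc : continuous (fun t => ckt k t ^+ 2 : R).
  by apply: ctsX; exact: smooth_continuous (@smooth_ckt R k).
have bc : bm (pi *+ 2) (fun t => ckt k t ^+ 2 : R) by exact: bm_continuous.
have e c : (\int[leb]_(th in fcirc) (b (c, th) ^+ 2 * Num.sqrt (gtt g (c, th)))%:E =
    (B c ^+ 2 * Rad c * Rint 0 (pi *+ 2) (fun t => ckt k t ^+ 2))%:E)%E.
  rewrite -(@RintZ _ (pi *+ 2))// -(@EFin_Rint _ (pi *+ 2)) //; last first.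
    by apply: bmM => //; exact: bm_cst.
  apply: eq_integral => th _; rewrite bB /= sqrtr_sqr ger0_norm; last exact/ltW/Rad0.
  by congr (_%:E); rewrite exprMn; ring.
by rewrite /L2sq_bd !big_cons big_nil adde0 !e -EFinD mulrDl.
Qed.

Lemma ev_normal_trace t : normal_trace L g (ev_sol t) (ev_trace t).
Proof.
split.
  move=> c _; apply: measurable_funTS; apply: continuous_measurable_fun.
  have -> : (fun th => ev_trace t (c, th)) = fun th =>
      (if c == 0 then -1 else 1) * (ev_exp t * ev_jet 1 c) * ckt k th.
    by apply/funext => th; rewrite /ev_trace /= -!mulrA.
  exact: (ctsM (@ctsC R _) (smooth_continuous (@smooth_ckt R k))).
have [phi [sphi H d1]] := ev_Hlim2 (ev_exp t).
exists (fun n => tens (fun s => ev_exp t * phi n s) (ckt k)); split => //.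
  move=> n.
  exact: smooth_cyl_tens (@smooth_scale (ev_exp t) _ (sphi n)) (@smooth_ckt R k) (@periodic_ckt R k).
pose B n c := (if c == 0 then -1 else 1) * (ev_exp t * (derive1 (phi n) c - ev_jet 1 c)).
have e n : L2sq_bd L g (dnu g (tens (fun s => ev_exp t * phi n s) (ckt k)) \- ev_trace t) =
    ((B n 0 ^+ 2 * Rad 0 + B n L ^+ 2 * Rad L) *
     Rint 0 (pi *+ 2) (fun t => ckt k t ^+ 2))%:E.
  apply: L2sq_bd_rot => c th.
  rewrite /= (dnu_rot Rad0 _ _ (@smooth_scale (ev_exp t) _ (sphi n))) /= (@derive1_scale _ _ (sphi n)).
  by rewrite /ev_trace /B /=; case: ifP => _; ring.
under eq_fun do rewrite e.
apply: cvg_EFin0; apply: cvg0_mulr.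
have B0 c : 0 <= c <= L -> B n c ^+ 2 * Rad c @[n --> \oo] --> (0 : R).
  move=> cL; apply: cvg0_mulr.
  have -> : (fun n => B n c ^+ 2) = fun n => (derive1 (phi n) c - ev_jet 1 c) *
      (ev_exp t ^+ 2 * (derive1 (phi n) c - ev_jet 1 c)).
    by apply/funext => n; rewrite /B; case: ifP => _; ring.
  have h := d1 c cL; have := cvgM h (cvg0_mull (ev_exp t ^+ 2) h).
  by rewrite mulr0; exact.
have I0 : (0 : R) <= 0 <= L by apply/andP; split; [exact: lexx|exact: ltW].
have IL : 0 <= L <= L by apply/andP; split; [exact: ltW|exact: lexx].
have := cvgD (B0 0 I0) (B0 L IL).
by rewrite addr0; exact.
Qed.

(** Since 1 / R = Z, the angular term k^2 / R^2 cancels the part (eps k Z)^2 of [pot], the q terms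
    cancel, and the drift f' / eps - Z' / Z is cancelled by the logarithmic derivative of 1 / p.
    Only E survives. *)
Lemma ev_generator t x : generator g (fun x => f x.1) q eps (ev_sol t) x =
  - (E / eps) * ev_exp t * v x.1 * ckt k x.2.
Proof.
rewrite (generator_rot Rad0 q eps _ k x sf) /=.
have Zn : Z x.1 != 0 by rewrite gt_eqF.
have epsn : eps != 0 by rewrite gt_eqF.
have dR : derive1 Rad x.1 = - derive1 Z x.1 / Z x.1 ^+ 2.
  by apply: is_derive_derive1; exact: is_derive1V Zn (smooth_is_derive x.1 sZ).
have da : derive1 alpha x.1 = alpha x.1 * (derive1 Z x.1 / Z x.1 - derive1 f x.1 / eps).
  have d1 := is_derive1N (is_derive1M (smooth_is_derive x.1 sf) (is_derive1_cst eps^-1 x.1)).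
  have d2 := is_derive1M (smooth_is_derive x.1 sZ) (is_derive1_o (is_derive_expR _) d1).
  apply: is_derive_derive1; apply: is_derive_congr d2 _.
  by rewrite /wgtV; field; rewrite epsn Zn.
rewrite dR da.
have wK : alpha x.1 * beta x.1 = pot Z q (eps * k%:R) E eps x.1 / eps ^+ 2.
  by rewrite /wpot mulrA wgtK ?mul1r.
rewrite [alpha x.1 * (beta _ * _)]mulrA wK /pot.
move: (ev_exp t) (ckt k x.2) (alpha x.1) (v x.1) (z x.1) (q x.1) => e c al vv zz qq.
by field; rewrite epsn Zn.
Qed.

Lemma cvg_EFin_filter (T : Type) (F : set_system T) (FF : Filter F) (h : T -> R) :
  h x @[x --> F] --> (0 : R) -> (h x)%:E @[x --> F] --> 0%E.
Proof. by move=> h0; apply: cvg_EFin => //; exact: nearW. Qed.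

Lemma cvg_sqr_mul (T : Type) (F : set_system T) (FF : Filter F) (h : T -> R) (c : R) :
  h x @[x --> F] --> (0 : R) -> h x ^+ 2 * c @[x --> F] --> (0 : R).
Proof.
move=> h0; have -> : (fun x => h x ^+ 2 * c) = fun x => (h x * h x) * c.
  by apply/funext => x; rewrite expr2.
have : (h x * h x) * c @[x --> F] --> 0 * 0 * c.
  by apply: cvgM; [exact: cvgM|exact: cvg_cst].
by rewrite !mul0r.
Qed.

Lemma ev_exp_is_derive (t : R) : is_derive t 1 ev_exp (- (E / eps) * ev_exp t).
Proof.
apply: is_derive_congr (is_derive1_o (is_derive_expR _) (is_derive1_mulr (- (E / eps)) t)) _.
by rewrite mulrC.
Qed.

Lemma ev_energy (c : R) : H1sq L g (rot_jet (fun i s => c * ev_jet i s) k) =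
  (c ^+ 2 * rot_energy L Rad ev_jet k)%:E.
Proof.
rewrite (H1sq_rot L0 sRad Rad0); [|exact: bm_ev_jetZ|exact: bm_ev_jetZ].
by rewrite (rot_energyZ L0 sRad Rad0)//; exact: bm_ev_jet.
Qed.

Lemma ev_solution T : solution L g (fun x => f x.1) q eps T (ev_sol 0 0%N 0%N) ev_sol.
Proof.
split.
- transitivity (\int[(leb \x leb)%E]_(x in fdom L) (0 : \bar R))%E.
    by apply: eq_integral => x _; rewrite /= subrr expr0n mul0r.
  exact: integral0.
- by move=> t _; exact: ev_H10_jet.
- move=> t _.
  have e r : H1sq L g (subj (ev_sol r) (ev_sol t)) =
      ((ev_exp r - ev_exp t) ^+ 2 * rot_energy L Rad ev_jet k)%:E.
    rewrite -ev_energy; congr (H1sq _ _ _).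
    apply/funext => i; apply/funext => j; apply/funext => x.
    by rewrite /subj /ev_sol /rot_jet /tens; ring.
  under eq_fun do rewrite e.
  apply: cvg_EFin_filter.
  have ce : ev_exp r @[r --> within `[0, T] (nbhs t)] --> ev_exp t.
    apply: cvg_within_filter.
    exact: (is_derive_continuous ev_exp_is_derive).
  have h1 : ev_exp r - ev_exp t @[r --> within `[0, T] (nbhs t)] --> ev_exp t - ev_exp t.
    by apply: cvgB; [exact: ce|exact: cvg_cst].
  rewrite subrr in h1.
  exact: cvg_sqr_mul h1.
- by move=> t _; exact: ev_H2_jet.
move=> t _.
pose D h := h^-1 * (ev_exp (t + h) - ev_exp t) - - (E / eps) * ev_exp t.
have e h : L2sq L g (fun x => (ev_sol (t + h) 0%N 0%N x - ev_sol t 0%N 0%N x) / h -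
     generator g (fun x => f x.1) q eps (ev_sol t) x) =
  (D h ^+ 2 * (Rint 0 L (fun s => v s ^+ 2 * Rad s) *
     Rint 0 (pi *+ 2) (fun t => ckt k t ^+ 2)))%:E.
  have -> : (fun x => (ev_sol (t + h) 0%N 0%N x - ev_sol t 0%N 0%N x) / h -
     generator g (fun x => f x.1) q eps (ev_sol t) x) = tens (fun s => D h * v s) (ckt k).
    apply/funext => x; rewrite ev_generator /ev_sol /rot_jet /tens /D /derive1n /=.
    by ring.
  rewrite (L2sq_tens L0 sRad Rad0); [|by apply: bmM; [exact: bm_cst|exact: bv]|exact: smooth_ckt].
  have bvR : bm L (fun s => v s ^+ 2 * Rad s).
    by apply: bmM; [apply: bmX; exact: bv|exact: bm_continuous (smooth_continuous sRad)].
  rewrite mulrA -(RintZ (D h ^+ 2) bvR (lexx 0) (lexx L)).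
  by congr ((_ * _)%:E); apply: eq_Rint => s _; rewrite exprMn mulrA.
under eq_fun do rewrite e.
apply: cvg_EFin_filter.
have D0 : D h @[h --> 0^'] --> (0 : R).
  have [dt dE] := ev_exp_is_derive t.
  have c1 : h^-1 * (ev_exp (t + h) - ev_exp t) @[h --> 0^'] --> 'D_1 ev_exp t.
    have -> : (fun h => h^-1 * (ev_exp (t + h) - ev_exp t)) =
       (fun h => h^-1 *: ((ev_exp \o shift t) h%:A - ev_exp t)).
      by apply/funext => h; rewrite /= [h%:A]mulr1 [h + t]addrC.
    exact: dt.
  have c2 : D h @[h --> 0^'] --> 'D_1 ev_exp t - 'D_1 ev_exp t.
    by rewrite /D -dE; apply: cvgB; [exact: c1|exact: cvg_cst].
  by rewrite subrr in c2.
exact: cvg_sqr_mul D0.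
Qed.

End Solution.

(** * Failure of observability *)

Section CosIntegrals.
Context {R : realType}.
Implicit Types (k : nat).

Lemma pi2E : pi *+ 2 = 2 * pi :> R.
Proof. by rewrite mulr_natl. Qed.

Lemma ckt2pi k : cos (k%:R * (pi *+ 2)) = 1 :> R.
Proof. by have := @periodic_ckt R k 0; rewrite /ckt add0r mulr0 cos0. Qed.

Lemma Rint_ckt_sqr k : (0 < k)%N -> Rint 0 (pi *+ 2) (fun t => ckt k t ^+ 2) = pi :> R.
Proof.
move=> k0; have kn0 : (k%:R : R) != 0 by rewrite pnatr_eq0 -lt0n.
pose F (t : R) := t * 2^-1 + sin (k%:R * t) * cos (k%:R * t) * (2 * k%:R)^-1.
have dF (t : R) : is_derive t 1 F (ckt k t ^+ 2).
  have dk := is_derive1_mulr (k%:R : R) t.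
  have ds := is_derive1_o (is_derive_sin _) dk.
  have dc := is_derive1_o (is_derive_cos _) dk.
  have d1 := is_derive1M (is_derive1M ds dc) (is_derive1_cst (2 * k%:R)^-1 t).
  have d2 := is_derive1M (is_derive1_id t) (is_derive1_cst (2^-1) t).
  apply: is_derive_congr (is_derive1D d2 d1) _.
  have h := sin2cos2 (k%:R * t).
  rewrite /ckt; move: h; set C := cos _; set S := sin _ => h.
  transitivity (2^-1 * (1 + C ^+ 2 - S ^+ 2)); last by rewrite h; field.
  by field; rewrite kn0.
have cc : continuous (fun t : R => ckt k t ^+ 2).
  by apply: ctsX; exact: smooth_continuous (@smooth_ckt R k).
have pi0 : (0 : R) <= pi *+ 2 by rewrite mulrn_wge0// pi_ge0.
rewrite (Rint_FTC pi0 cc dF) /F !mulr0 mul0r sin0 !mul0r addr0 subr0 pi2E.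
have -> : sin (k%:R * (2 * pi)) = 0 :> R.
  by apply/eqP; rewrite -sqrf_eq0 sin2cos2 -pi2E ckt2pi expr1n subrr.
by rewrite !mul0r addr0; field.
Qed.

Lemma ckt_lip k (x y : R) : 0 <= x -> x <= y -> `|ckt k y - ckt k x| <= k%:R * (y - x).
Proof.
move=> x0 xy.
have cd : continuous (derive1 (@ckt R k)).
  exact: smooth_continuous (smooth_derive1 (@smooth_ckt R k)).
have d (t : R) : is_derive t 1 (@ckt R k) (derive1 (ckt k) t) := smooth_is_derive t (@smooth_ckt R k).
rewrite -(Rint_FTC xy cd d).
apply: (@le_norm_Rint _ y) => //; first exact: bm_continuous.
move=> s _; rewrite derive1_ckt normrM normrN normr_nat ler_piMr//.
by rewrite ler_norml sin_geN1 sin_le1.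
Qed.

(** When the short arc passes through the point 0, periodicity replaces the smaller angle x by x + 2
    pi. *)
Lemma ckt_circ k (x y : R) : 0 <= x <= pi *+ 2 -> 0 <= y <= pi *+ 2 ->
  `|ckt k x - ckt k y| <= k%:R * circ_dist x y.
Proof.
move=> xI yI.
wlog xy : x y xI yI / x <= y => [H|].
  have [xy|yx] := leP x y; first exact: H.
  by have := H y x yI xI (ltW yx); rewrite distrC /circ_dist (distrC y).
move: xI yI => /andP[x0 x2] /andP[y0 y2].
have e : `|x - y| = y - x by rewrite distrC ger0_norm// subr_ge0.
rewrite /circ_dist e minEle; case: ifP => _; first by rewrite distrC ckt_lip.
rewrite -periodic_ckt; have -> : pi *+ 2 - (y - x) = x + pi *+ 2 - y by ring.
by apply: ckt_lip => //; rewrite (le_trans y2)// lerDr.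
Qed.

Lemma ckt_slope k (x y : R) : 0 <= x <= pi *+ 2 -> 0 <= y <= pi *+ 2 ->
  ((ckt k x - ckt k y) / circ_dist x y) ^+ 2 <= k%:R ^+ 2.
Proof.
move=> xI yI; have h := ckt_circ k xI yI.
apply: sqr_le_norm; rewrite normrM normfV.
have [->|d0] := eqVneq (circ_dist x y) 0; first by rewrite normr0 invr0 mulr0 ler0n.
rewrite ler_pdivrMr ?normr_gt0//; apply: le_trans h _.
by apply: ler_wpM2l; [exact: ler0n|exact: ler_norm].
Qed.

End CosIntegrals.

(** * The boundary observation of a separated solution *)

Section Observation.
Context {R : realType}.
Variables (L : R) (f Z q : R -> R) (eps E : R) (k : nat) (v z : R -> R).
Hypotheses (L0 : 0 < L) (sf : smooth f) (sZ : smooth Z) (Z0 : forall s, 0 < Z s).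
Hypotheses (bq : bm L q) (eps0 : 0 < eps) (k0 : (0 < k)%N).
Hypothesis vz : ivp L (wgtV f Z eps) (wpot f Z q (eps * k%:R) E eps) v z.
Hypothesis vL : v L = 0.
Local Notation leb := (@lebesgue_measure R).
Local Notation Rad := (fun s => (Z s)^-1).
Local Notation g := (rot_metric (fun s => (Z s)^-1)).
Local Notation jt := (ev_jet f Z q eps E k v z).
Local Notation ex := (ev_exp eps E).
Local Notation tr := (ev_trace f Z q eps E k v z).

(** Bounds the squared H^(1/2) norm of cos(k theta) on the circle s = c: the first term is the L^2
    part, the second bounds the double integral through the Lipschitz constant k. A polynomial bound
    in k is harmless against the exponential gain. *)
Definition bd_cst (c : R) : R := Rad c * pi + k%:R ^+ 2 * (pi *+ 2 * (pi *+ 2)).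

(** The sign of E is not known, so the factor may grow or decay; its square is at most its value at
    one of the two ends of [0, T]. *)
Lemma ev_exp_le (T t : R) : 0 <= t <= T -> ex t ^+ 2 <= 1 + ex T ^+ 2.
Proof.
move=> /andP[t0 tT]; rewrite /ev_exp; have [E0|E0] := leP 0 (E / eps).
  apply: (@le_trans _ _ 1); last by rewrite lerDl sqr_ge0.
  rewrite expr_le1 ?expR_ge0//.
  by rewrite -[leRHS]expR0 ler_expR mulNr oppr_le0 mulr_ge0.
apply: (@le_trans _ _ (expR (- (E / eps) * T) ^+ 2)); last by rewrite lerDr.
rewrite ler_pXn2r// ?nnegrE ?expR_ge0// ler_expR.
by apply: ler_wpM2l => //; rewrite oppr_ge0 ltW.
Qed.

Lemma ev_trace_H12 (T t : R) : 0 <= t <= T ->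
  (H12sq_bd L g (fun x => eps * tr t x)%R <=
   ((1 + ex T ^+ 2) * (eps ^+ 2 * (jt 1 0 ^+ 2 * bd_cst 0 + jt 1 L ^+ 2 * bd_cst L)))%:E)%E.
Proof.
move=> tT; have eT := ev_exp_le tT.
pose B (c : R) : R := eps * ((if c == 0 then -1 else 1) * (ex t * jt 1%N c)).
have Bsq c : B c ^+ 2 = ex t ^+ 2 * (eps ^+ 2 * jt 1%N c ^+ 2).
  by rewrite /B; case: ifP => _; ring.
have bB (c th : R) : eps * tr t (c, th) = B c * ckt k th by rewrite /ev_trace /B /= -!mulrA.
have pi0 : (0 : R) <= pi *+ 2 by rewrite mulrn_wge0// pi_ge0.
have dI c : (\int[(leb \x leb)%E]_(y in @fcirc R `*` @fcirc R)
   (((eps * tr t (c, y.1) - eps * tr t (c, y.2)) / circ_dist y.1 y.2) ^+ 2)%:E <=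
   (B c ^+ 2 * k%:R ^+ 2 * (pi *+ 2 * (pi *+ 2)))%:E)%E.
  have mc : measurable (@fcirc R) by exact: measurable_itv.
  have mu2 : (leb \x leb)%E (@fcirc R `*` @fcirc R) = (pi *+ 2 * (pi *+ 2))%:E.
    have m1 : leb (@fcirc R) = (pi *+ 2)%:E.
      rewrite /fcirc lebesgue_measure_itv /= lte_fin.
      by move: pi0; rewrite le_eqVlt => /predU1P[<-|->]; rewrite ?ltxx -?EFinB ?subr0.
    by have := product_measure1E leb leb mc mc; rewrite [X in _ = (X * X)%E]m1 -EFinM.
  rewrite EFinM -mu2; apply: integral_le_cst => //.
  - exact: measurableX.
  - by move=> y _; rewrite lee_fin sqr_ge0.
  move=> [x y] [/= xI yI]; rewrite /fcirc /= !in_itv /= in xI yI.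
  rewrite lee_fin !bB -mulrBr -mulrA exprMn.
  by apply: ler_wpM2l; [exact: sqr_ge0|exact: ckt_slope].
rewrite /H12sq_bd (L2sq_bd_rot L Z0 bB) Rint_ckt_sqr// !big_cons big_nil adde0.
apply: (@le_trans _ _ (((B 0 ^+ 2 * Rad 0 + B L ^+ 2 * Rad L) * pi)%:E +
   ((B 0 ^+ 2 * k%:R ^+ 2 * (pi *+ 2 * (pi *+ 2)))%:E +
    (B L ^+ 2 * k%:R ^+ 2 * (pi *+ 2 * (pi *+ 2)))%:E))%E).
  by apply: leeD => //; apply: leeD; exact: dI.
rewrite -!EFinD lee_fin !Bsq.
have D0 : 0 <= eps ^+ 2 * (jt 1 0 ^+ 2 * bd_cst 0 + jt 1 L ^+ 2 * bd_cst L).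
  have c0 c : 0 <= bd_cst c.
    rewrite /bd_cst addr_ge0 ?mulr_ge0 ?sqr_ge0 ?pi_ge0// invr_ge0; exact/ltW.
  apply: mulr_ge0; first exact: sqr_ge0.
  by apply: addr_ge0; apply: mulr_ge0; [exact: sqr_ge0|exact: c0|exact: sqr_ge0|exact: c0].
apply: le_trans (ler_wpM2r D0 eT).
rewrite le_eqVlt; apply/orP; left; apply/eqP; rewrite /bd_cst /=; ring.
Qed.

(** The observability inequality tested on the separated solution; on the left only the L^2 part of
    the H^1 norm is kept. *)
Lemma observable_le (T K0 : R) : 0 < T ->
  observable L g (fun x => f x.1) q T K0 eps ->
  ex T ^+ 2 * (pi * Rint 0 L (fun s => v s ^+ 2 * Rad s)) <=
  K0 ^+ 2 * ((1 + ex T ^+ 2) * (eps ^+ 2 * (jt 1 0 ^+ 2 * bd_cst 0 + jt 1 L ^+ 2 * bd_cst L)) * T).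
Proof.
move=> T0 obs.
have hH10 : H10 L g (ev_sol f Z q eps E k v z 0 0 0).
  by exists (ev_sol f Z q eps E k v z 0) => //; exact: (ev_H10_jet L0 sf sZ Z0 bq vz vL).
have hsol := ev_solution L0 sf sZ Z0 bq eps0 vz vL T.
have htr t : 0 < t < T -> normal_trace L g (ev_sol f Z q eps E k v z t) (tr t).
  by move=> _; exact: (ev_normal_trace L0 sf sZ Z0 bq vz).
have := obs _ hH10 _ hsol tr htr.
rewrite (ev_energy L0 sf sZ Z0 bq vz) => h.
have hR : (\int[leb]_(t in `]0%R, T[) H12sq_bd L g (fun x => (eps * tr t x)%R) <=
  ((1 + ex T ^+ 2) * (eps ^+ 2 * (jt 1 0 ^+ 2 * bd_cst 0 + jt 1 L ^+ 2 * bd_cst L)))%:E * T%:E)%E.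
  have -> : T%:E = leb `]0%R, T[%classic.
    by rewrite lebesgue_measure_itv /= lte_fin T0 -EFinB subr0.
  apply: integral_le_cst => //.
    move=> t _; rewrite /H12sq_bd /L2sq_bd !big_cons !big_nil !adde0.
    by apply: adde_ge0; apply: adde_ge0; apply: integral_ge0 => x _;
      rewrite lee_fin ?sqr_ge0// mulr_ge0 ?sqr_ge0 ?sqrtr_ge0.
  move=> t /=; rewrite in_itv /= => /andP[t0 tT]; apply: ev_trace_H12.
  by rewrite !ltW.
have {}h := le_trans h (lee_wpmul2l (_ : (0 <= (K0 ^+ 2)%:E)%E) hR).
move: h; rewrite lee_fin sqr_ge0 -!EFinM lee_fin => /(_ isT); apply: le_trans.
apply: ler_wpM2l; first exact: sqr_ge0.
rewrite /rot_energy Rint_ckt_sqr// mulrC.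
have n0 (F : R -> R) : 0 <= Rint 0 L (fun s => F s ^+ 2 * Rad s).
  by apply: Rint_ge0 => s _; rewrite mulr_ge0 ?sqr_ge0// invr_ge0 ltW.
rewrite -[leLHS]addr0; apply: lerD; last first.
  by rewrite mulr_ge0// Rint_ge0// => t _; exact: sqr_ge0.
by apply: ler_wpM2r; [exact: pi_ge0|rewrite lerDl].
Qed.

End Observation.

(** * Comparison of the rates as the frequency tends to infinity *)

Section NonObservability.
Context {R : realType}.
Implicit Types (f Z q zeta : R -> R).

(** The exponential is the cube of exp(kap y / 3) > kap y / 3, and a cubic beats K y^2. *)
Lemma sqr_lt_expR (kap K : R) : 0 < kap -> 0 <= K ->
  exists2 A : R, 0 < A & forall y : R, A < y -> K * y ^+ 2 < expR (kap * y).
Proof.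
move=> kap0 K0.
have k3 : 0 < kap ^+ 3 by rewrite exprn_gt0.
have KK : 0 <= 27 * K / kap ^+ 3 by apply: divr_ge0 (ltW k3); exact: mulr_ge0.
exists (27 * K / kap ^+ 3 + 1); first by rewrite ltr_wpDl.
move=> y hy.
have y0 : 0 < y by apply: lt_trans hy; rewrite ltr_wpDl.
have e : expR (kap * y) = expR (kap * y / 3) ^+ 3.
  by rewrite -expRM_natr; congr expR; field.
rewrite e.
have h1 : kap * y / 3 < expR (kap * y / 3).
  by apply: lt_le_trans (expR_ge1Dx _); rewrite ltrDr.
have h2 : (kap * y / 3) ^+ 3 < expR (kap * y / 3) ^+ 3.
  rewrite ltr_pXn2r// nnegrE ?expR_ge0// divr_ge0// mulr_ge0// ltW//.
apply: le_lt_trans h2.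
have -> : (kap * y / 3) ^+ 3 = (kap ^+ 3 * y / 27) * y ^+ 2 by field.
apply: ler_wpM2r; first exact: sqr_ge0.
have h3 : 27 * K / kap ^+ 3 <= y by apply/ltW/(lt_trans _ hy); rewrite ltrDl.
rewrite ler_pdivrMr// in h3.
by rewrite ler_pdivlMr// mulrC [kap ^+ 3 * y]mulrC.
Qed.

Lemma Rint_sub_ge (L : R) (h : R -> R) (c x y : R) : bm L h ->
  (forall s, 0 <= s <= L -> 0 <= h s) -> 0 <= x -> x <= y -> y <= L ->
  (forall s, x <= s <= y -> c <= h s) -> c * (y - x) <= Rint 0 L h.
Proof.
move=> bh h0 x0 xy yL hc.
rewrite (Rint_chasles bh (lexx 0) x0 (le_trans xy yL) (lexx L)).
rewrite (Rint_chasles bh x0 xy yL (lexx L)).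
have n1 : 0 <= Rint 0 x h.
  by apply: Rint_ge0 => s /andP[s0 sx]; apply: h0; rewrite s0 (le_trans sx)// (le_trans xy).
have n2 : 0 <= Rint y L h.
  by apply: Rint_ge0 => s /andP[ys sL]; apply: h0; rewrite sL andbT (le_trans x0)// (le_trans xy).
have n3 := le_cst_Rint bh x0 xy yL hc.
by clear -n1 n2 n3; lra.
Qed.

(* The observed quantity is smaller than the norm by the Agmon factor
   [expR (2 * Psi / eps)], up to polynomial factors in [eps^-1], whereas the norm
   decays at most by [expR (- mu^2 * T / eps)]. *)
Lemma decay_contra (K0 T a mu A rm C1 Psi : R) : 0 < T -> 0 < a -> 0 < A -> 0 < rm -> 0 < C1 ->
  T * mu ^+ 2 / 2 < Psi ->
  exists2 k0 : R, 0 < k0 & forall (k : nat) (E N w0 wL b0 bL : R),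
   let eps := a / k%:R in let e2 := ev_exp eps E T ^+ 2 in
   let G := expR (Psi / eps) - 1 in
   k0 < k%:R -> E <= mu ^+ 2 / 2 -> 0 < w0 ->
   rm * (w0 * (eps / A * G)) ^+ 2 <= N ->
   rm * (wL * (eps / A * G)) ^+ 2 <= N ->
   b0 <= C1 * k%:R ^+ 2 -> bL <= C1 * k%:R ^+ 2 ->
   e2 * (pi * N) <= K0 ^+ 2 * ((1 + e2) * (eps ^+ 2 * (w0 ^+ 2 * b0 + wL ^+ 2 * bL)) * T) ->
   False.
Proof.
move=> T0 a0 A0 rm0 C10 TPsi.
have Psi0 : 0 < Psi.
  by apply: le_lt_trans TPsi; rewrite divr_ge0// mulr_ge0 ?sqr_ge0// ltW.
pose K := K0 ^+ 2 * T * (A ^+ 2 / rm) * (C1 *+ 2).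
have K_ge0 : 0 <= K.
  apply: mulr_ge0; last by rewrite mulrn_wge0// ltW.
  apply: mulr_ge0; last exact: divr_ge0 (sqr_ge0 _) (ltW rm0).
  exact: mulr_ge0 (sqr_ge0 _) (ltW T0).
pose kap := (Psi *+ 2 - mu ^+ 2 * T) / a.
have kap0 : 0 < kap by rewrite /kap divr_gt0//; clear -TPsi; lra.
(* 8 = 2 * 4: the 2 comes from bounding 1 + [e2] by twice [e2] exp(mu^2 T / eps), the 4 from G >=
   exp(Psi / eps) / 2, squared. *)
have K80 : 0 <= 8 * K / pi by apply: divr_ge0 (pi_ge0 R); exact: mulr_ge0.
have [k1 k10 hk1] := sqr_lt_expR kap0 K80.
have aPsi : 0 < a / Psi by rewrite divr_gt0.
(* The second term ensures Psi / eps > 1, hence G >= exp(Psi / eps) / 2. *)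
exists (k1 + a / Psi); first exact: addr_gt0.
move=> k E N w0 wL b0 bL eps e2 G hk hE hw0 hN hL hb0 hbL.
have kk1 : k1 < k%:R by clear -hk aPsi; lra.
have kk2 : a / Psi < k%:R by clear -hk k10; lra.
have kpos : 0 < k%:R :> R by apply: lt_trans kk1.
have eps0 : 0 < eps by rewrite /eps divr_gt0.
have ie : eps^-1 = k%:R / a by rewrite /eps invf_div.
have Pe1 : 1 < Psi / eps.
  by rewrite ie mulrA ltr_pdivlMr// mul1r mulrC -ltr_pdivrMr.
have Ge : expR (Psi / eps) / 2 <= G.
  have := expR_ge1Dx (Psi / eps); rewrite /G; clear -Pe1; set e := expR _; lra.
have G0 : 0 < G by apply: lt_le_trans Ge; rewrite divr_gt0// expR_gt0.
have e20 : 0 < e2 by rewrite exprn_gt0// expR_gt0.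
pose Q := rm * (eps / A * G) ^+ 2.
have Q0 : 0 < Q by rewrite /Q mulr_gt0// exprn_gt0// mulr_gt0// divr_gt0.
have hN' : w0 ^+ 2 * Q <= N by move: hN; rewrite exprMn mulrCA.
have hL' : wL ^+ 2 * Q <= N by move: hL; rewrite exprMn mulrCA.
have N0 : 0 < N by apply: lt_le_trans hN'; rewrite mulr_gt0// exprn_gt0.
apply/negP; rewrite -ltNge.
have bnd (w b : R) : w ^+ 2 * Q <= N -> b <= C1 * k%:R ^+ 2 ->
    w ^+ 2 * b <= N / Q * (C1 * k%:R ^+ 2).
  move=> hw hb; apply: (@le_trans _ _ (w ^+ 2 * (C1 * k%:R ^+ 2))).
    by apply: ler_wpM2l => //; exact: sqr_ge0.
  apply: ler_wpM2r; first by rewrite mulr_ge0 ?sqr_ge0// ltW.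
  by rewrite ler_pdivlMr.
have h0 := bnd _ _ hN' hb0; have h1 := bnd _ _ hL' hbL.
apply: (@le_lt_trans _ _ (K0 ^+ 2 * ((1 + e2) * (eps ^+ 2 * ((N / Q * (C1 * k%:R ^+ 2)) *+ 2)) * T))).
  apply: ler_wpM2l; first exact: sqr_ge0.
  apply: ler_wpM2r; first exact: ltW.
  apply: ler_wpM2l; first by rewrite addr_ge0// ltW.
  apply: ler_wpM2l; first exact: sqr_ge0.
  by rewrite mulr2n lerD.
have -> : K0 ^+ 2 * ((1 + e2) * (eps ^+ 2 * ((N / Q * (C1 * k%:R ^+ 2)) *+ 2)) * T) =
    (1 + e2) * N * (K * k%:R ^+ 2 / G ^+ 2).
  rewrite /Q /K; field.
  by rewrite !gt_eqF.
have -> : e2 * (pi * N) = e2 * N * pi by ring.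
have key : (1 + e2) * (K * k%:R ^+ 2 / G ^+ 2) < e2 * pi.
  have e2V : 1 + e2 <= e2 * (expR (mu ^+ 2 * T / eps) *+ 2).
    have h : e2^-1 <= expR (mu ^+ 2 * T / eps).
      rewrite /e2 /ev_exp -exprVn -expRN -expRM_natr ler_expR.
      have -> : - (- (E / eps) * T) * 2 = E * (2 * T) / eps by ring.
      apply: ler_wpM2r; first by rewrite invr_ge0 ltW.
      have -> : mu ^+ 2 * T = mu ^+ 2 / 2 * (2 * T) by field.
      by apply: ler_wpM2r => //; rewrite mulr_ge0// ltW.
    have h' : 1 <= e2 * expR (mu ^+ 2 * T / eps) by rewrite -ler_pdivrMl// mulr1.
    have h'' : 1 <= expR (mu ^+ 2 * T / eps).
      have m0 := mulr_ge0 (sqr_ge0 mu) (ltW T0).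
      by apply: le_trans (expR_ge1Dx _); rewrite lerDl; exact: divr_ge0 m0 (ltW eps0).
    rewrite mulr2n mulrDr lerD// ler_peMr//.
    exact: ltW.
  apply: (@le_lt_trans _ _ (e2 * (expR (mu ^+ 2 * T / eps) *+ 2) * (K * k%:R ^+ 2 / G ^+ 2))).
    apply: ler_wpM2r => //; apply: divr_ge0 (sqr_ge0 _).
    exact: mulr_ge0 (sqr_ge0 _).
  rewrite -mulrA ltr_pM2l//.
  have hexp := hk1 _ kk1.
  have e3 : expR (kap * k%:R) * expR (mu ^+ 2 * T / eps) = expR (Psi / eps) ^+ 2.
    rewrite -expRD -expRM_natr; congr expR.
    by rewrite /kap /eps; field; rewrite !gt_eqF.
  have G2 : expR (Psi / eps) ^+ 2 / 4 <= G ^+ 2.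
    have -> : expR (Psi / eps) ^+ 2 / 4 = (expR (Psi / eps) / 2) ^+ 2 by field.
    by rewrite ler_pXn2r ?nnegrE// ?divr_ge0 ?expR_ge0// ltW.
  rewrite mulrA ltr_pdivrMr ?exprn_gt0//.
  apply: lt_le_trans (ler_wpM2l (pi_ge0 R) G2); rewrite -e3.
  have em := expR_gt0 (mu ^+ 2 * T / eps).
  have -> : expR (mu ^+ 2 * T / eps) *+ 2 * (K * k%:R ^+ 2) =
     (8 * K / pi * k%:R ^+ 2) * (pi * expR (mu ^+ 2 * T / eps) / 4).
    have pn : pi != 0 :> R by rewrite gt_eqF ?pi_gt0.
    by move: (pi : R) pn => P Pn; field.
  have -> : pi * (expR (kap * k%:R) * expR (mu ^+ 2 * T / eps) / 4) =
     expR (kap * k%:R) * (pi * expR (mu ^+ 2 * T / eps) / 4) by ring.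
  by rewrite ltr_pM2r// divr_gt0// mulr_gt0// pi_gt0.
have -> : (1 + e2) * N * (K * k%:R ^+ 2 / G ^+ 2) = (1 + e2) * (K * k%:R ^+ 2 / G ^+ 2) * N by ring.
by rewrite [ltRHS]mulrAC ltr_pM2r.
Qed.

End NonObservability.

Section NonObservable.
Context {R : realType}.
Implicit Types (f Z q zeta : R -> R).

Lemma le_bd_cst Z (k : nat) (c : R) : (0 < k)%N -> 0 < Z c ->
  bd_cst Z k c <= ((Z c)^-1 * pi + pi *+ 2 * (pi *+ 2)) * k%:R ^+ 2.
Proof.
move=> k0 Zc; rewrite /bd_cst [leRHS]mulrDl [X in _ <= _ + X]mulrC.
apply: lerD => //; rewrite ler_peMr//.
  by rewrite mulr_ge0 ?pi_ge0// invr_ge0 ltW.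
by rewrite exprn_ege1// ler1n.
Qed.

(** The observed fluxes are 1 / p at 0, where z(0) = 1, and |z(L)| / p at L. The same numbers
    multiply the lower bounds for v in [eigenpair], so flux and norm can be compared in
    [decay_contra] whatever the size of p. *)
Theorem not_observable f Z q zeta (L B a mu s1 x1 y1 T : R) :
  0 < L -> 0 < a -> 0 < mu -> 0 < s1 -> 2 * s1 <= L -> 0 < x1 -> x1 < y1 -> y1 <= L ->
  smooth f -> smooth Z -> (forall s, 0 < Z s) -> bm L q ->
  (forall s, 0 <= s <= L -> `|derive1 f s| <= mu) ->
  (forall s, 0 <= s <= L -> `|q s| <= B) ->
  (forall s, 0 <= s <= 2 * s1 -> 3 / 2 * mu <= a * Z s) ->
  (forall s, L - 2 * s1 <= s <= L -> 3 / 2 * mu <= a * Z s) ->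
  (forall s, x1 <= s <= y1 -> (a * Z s) ^+ 2 <= mu ^+ 2 / 8) ->
  zeta 0 = 0 -> (forall s : R, is_derive s 1 zeta (Z s)) ->
  0 < T -> T * mu ^+ 2 / 2 < a * zeta s1 - mu * s1 ->
  T * mu ^+ 2 / 2 < a * (zeta L - zeta (L - s1)) - mu * s1 ->
  forall K0 epsm : R, 0 < epsm -> exists2 eps : R, 0 < eps < epsm &
    ~ observable L (rot_metric (fun s => (Z s)^-1)) (fun x => f x.1) q T K0 eps.
Proof.
move=> L0 a0 mu0 s10 s1L x10 xy1 y1L sf sZ Z0 bq fmu qB Zl Zr ZI zeta0 dzeta T0 TP TP'.
move=> K0 epsm epsm0.
have [eps0 eps00 hE] := eigenpair L0 a0 mu0 s10 s1L x10 xy1 y1L sf sZ Z0 bq fmu qB Zl Zr ZI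
  zeta0 dzeta.
pose Psi := Num.min (a * zeta s1 - mu * s1) (a * (zeta L - zeta (L - s1)) - mu * s1).
have TPsi : T * mu ^+ 2 / 2 < Psi by rewrite /Psi lt_min TP TP'.
pose A := 2 * a * Num.max (Z 0) (Z L).
have Zmax : 0 < Num.max (Z 0) (Z L) by rewrite lt_max Z0.
have A0 : 0 < A by rewrite /A mulr_gt0// mulr_gt0.
have sRad : smooth (fun s => (Z s)^-1) := smooth_inv Z0 sZ.
have [ZM ZM0 ZMP] := continuous_bounded 0 L (smooth_continuous sZ).
(* The minimum of the radius, at least 1 / ZM, times the length of the interval where v is bounded
   below. *)
pose rm := ZM^-1 * s1.
have rm0 : 0 < rm by rewrite mulr_gt0// invr_gt0.
pose C1 := Num.max ((Z 0)^-1 * pi + pi *+ 2 * (pi *+ 2)) ((Z L)^-1 * pi + pi *+ 2 * (pi *+ 2)).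
have C10 : 0 < C1.
  rewrite lt_max; apply/orP; left; have p0 := pi_gt0 R.
  by rewrite addr_gt0// mulr_gt0// ?invr_gt0// mulrn_wgt0.
have [k0 k00 hk] := decay_contra K0 T0 a0 A0 rm0 C10 TPsi.
pose em := Num.min eps0 epsm.
have em0 : 0 < em by rewrite lt_min eps00 epsm0.
have [k] : exists k : nat, k0 + a / em < k%:R.
  by exists (Num.bound (k0 + a / em)); apply: archi_boundP; rewrite addr_ge0 ?divr_ge0// ltW.
move=> hkk.
have aem : 0 < a / em by rewrite divr_gt0.
have kk : k0 < k%:R by apply: le_lt_trans hkk; rewrite lerDl ltW.
have kem : a / em < k%:R by apply: le_lt_trans hkk; rewrite lerDr ltW.
have kR : 0 < k%:R :> R by apply: lt_trans kk.
have kpos : (0 < k)%N by rewrite -(ltr0n R).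
pose eps := a / k%:R.
have e0 : 0 < eps by rewrite divr_gt0.
have eem : eps < em by rewrite /eps ltr_pdivrMr// mulrC -ltr_pdivrMr.
move: (eem); rewrite lt_min => /andP[ee0 eem'].
exists eps; first by rewrite e0.
move=> obs.
have [|E [v [z [EE vz vL hl hr]]]] := hE eps; first by rewrite e0.
have ak : a = eps * k%:R by rewrite /eps mulfVK// gt_eqF.
have vz' := vz; rewrite ak in vz'.
have hobs := observable_le L0 sf sZ Z0 bq e0 kpos vz' vL T0 obs.
have [cv cz vE zE] := vz.
have z0 : z 0 = 1 by rewrite zE ?lexx ?ltW// Rint_same addr0.
pose N := Rint 0 L (fun s => v s ^+ 2 * (Z s)^-1).
have bN : bm L (fun s => v s ^+ 2 * (Z s)^-1).
  by apply: bmM; [apply: bmX; exact: bm_continuous|exact: bm_smooth sRad].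
have N_ge (W x : R) : 0 <= W -> 0 <= x -> x + s1 <= L ->
    (forall s, x <= s <= x + s1 -> W <= v s) -> rm * W ^+ 2 <= N.
  move=> W0 xx xL Wv.
  have -> : rm * W ^+ 2 = ZM^-1 * W ^+ 2 * (x + s1 - x) by rewrite /rm; ring.
  apply: Rint_sub_ge => //.
  - by move=> s _; rewrite mulr_ge0 ?sqr_ge0// invr_ge0 ltW.
  - by rewrite lerDl ltW.
  move=> s /andP[xs sx]; rewrite mulrC; apply: ler_pM; [exact: sqr_ge0|by rewrite invr_ge0 ltW| |].
    have Ws : W <= v s by apply: Wv; rewrite xs.
    by rewrite ler_pXn2r// nnegrE (le_trans W0).
  rewrite lef_pV2 ?posrE//; apply: le_trans (ler_norm _) (ZMP _ _).
  by rewrite (le_trans xx)//= (le_trans sx).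
pose G := expR (Psi / eps) - 1.
have Psi0 : 0 < Psi by apply: le_lt_trans TPsi; rewrite divr_ge0// mulr_ge0 ?sqr_ge0// ltW.
have G0 : 0 <= G.
  by have := expR_ge1Dx (Psi / eps); have := divr_ge0 (ltW Psi0) (ltW e0); rewrite /G; clear; lra.
have AG (c P : R) : 0 < Z c -> Z c <= Num.max (Z 0) (Z L) -> Psi <= P ->
    eps / A * G <= eps / (2 * a * Z c) * (expR (P / eps) - 1).
  move=> Zc ZcM PP; have a2 : 0 < 2 * a by rewrite mulr_gt0.
  apply: ler_pM => //; first by rewrite divr_ge0// ltW.
    apply: ler_wpM2l; first exact: ltW.
    by rewrite lef_pV2 ?posrE// /A ?mulr_gt0// ler_pM2l.
  by rewrite /G lerD2r ler_expR ler_pM2r// invr_gt0.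
have XG0 : 0 <= eps / A * G by rewrite mulr_ge0// divr_ge0// ltW.
have PP1 : Psi <= a * zeta s1 - mu * s1 by rewrite /Psi ge_min lexx.
have PP2 : Psi <= a * (zeta L - zeta (L - s1)) - mu * s1 by rewrite /Psi ge_min lexx orbT.
have ZM1 : Z 0 <= Num.max (Z 0) (Z L) by rewrite le_max lexx.
have ZM2 : Z L <= Num.max (Z 0) (Z L) by rewrite le_max lexx orbT.
have w00 : 0 < wgtV f Z eps 0 by exact: wgtV_gt0.
have wL0 : 0 < wgtV f Z eps L by exact: wgtV_gt0.
have zLn : 0 <= `|z L| * wgtV f Z eps L by rewrite mulr_ge0// ltW.
have jL : (`|z L| * wgtV f Z eps L) ^+ 2 = ev_jet f Z q eps E k v z 1 L ^+ 2.
  by rewrite exprMn real_normK ?num_real// -exprMn mulrC.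
have j0 : wgtV f Z eps 0 ^+ 2 = ev_jet f Z q eps E k v z 1 0 ^+ 2.
  by rewrite /ev_jet z0 mulr1.
apply: (hk k E N (wgtV f Z eps 0) (`|z L| * wgtV f Z eps L) (bd_cst Z k 0) (bd_cst Z k L)) => //.
- apply: (N_ge _ s1); rewrite -?/G.
  + by rewrite mulr_ge0// ltW.
  + exact: ltW.
  + by clear -s1L; lra.
  move=> s sI; apply: le_trans (hl s _); last by clear -sI; lra.
  rewrite -[leRHS]mulrA; apply: ler_wpM2l; first exact: ltW.
  exact: (AG 0 _ (Z0 0) ZM1 PP1).
- apply: (N_ge _ (L - 2 * s1)); rewrite -?/G.
  + by rewrite mulr_ge0.
  + by clear -s1L; lra.
  + by clear -s10; lra.
  move=> s sI; have := hr (L - s); rewrite subKr => hr'.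
  apply: le_trans (hr' _); last by clear -sI; lra.
  rewrite -[leRHS]mulrA; apply: ler_wpM2l => //.
  exact: (AG L _ (Z0 L) ZM2 PP2).
- by apply: le_trans (le_bd_cst kpos (Z0 0)) (ler_wpM2r (sqr_ge0 _) _); rewrite le_max lexx.
- by apply: le_trans (le_bd_cst kpos (Z0 L)) (ler_wpM2r (sqr_ge0 _) _); rewrite le_max lexx orbT.
- by rewrite j0 jL; exact: hobs.
Qed.
End NonObservable.

(** * The flushing time *)

Section FlushTime.
Context {R : realType}.

Lemma mean_value (F F' : R -> R) (x y : R) : x <= y ->
  (forall s : R, is_derive s 1 F (F' s)) ->
  exists2 c, x <= c <= y & F y - F x = F' c * (y - x).
Proof.
move=> xy dF; have [|c] := @MVT_segment R F F' x y xy (fun s _ => dF s).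
  exact/continuous_subspaceT/(is_derive_continuous dF).
by rewrite in_itv /= => cI e; exists c.
Qed.

Lemma is_derive_total (F : R -> R) : (forall s : R, derivable F s 1) ->
  forall s : R, is_derive s 1 F (derive1 F s).
Proof. by move=> dF s; split => //; rewrite derive1E. Qed.

Lemma cvg_derive1 (F : R -> R) (x : R) : derivable F x 1 ->
  h^-1 *: (F (h + x) - F x) @[h --> 0^'] --> derive1 F x.
Proof.
move=> dF; rewrite derive1E.
have -> : (fun h => h^-1 *: (F (h + x) - F x)) = (fun h => h^-1 *: ((F \o shift x) h%:A - F x)).
  by apply/funext => h; rewrite /= [h%:A]mulr1.
exact: dF.
Qed.

Lemma first_hit (F : R -> R) (t : R) : continuous F -> 0 <= t -> 0 <= F 0 -> F t <= 0 ->
  exists2 u, 0 <= u <= t & F u = 0 /\ forall s, 0 <= s <= u -> 0 <= F s.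
Proof.
move=> cF t0 F0 Ft.
pose S := [set s | 0 <= s <= t /\ F s <= 0].
have St : S t by rewrite /S /= t0 lexx.
have lbS : lbound S 0 by move=> s [/andP[]].
have hS : has_inf S by split; [exists t|exists 0].
pose u := inf S.
have u0 : 0 <= u by apply: lb_le_inf => //; exists t.
have uS s : S s -> u <= s by move=> Ss; apply: ge_inf => //; exists 0.
have ut : u <= t by exact: uS.
have pos s : 0 <= s < u -> 0 < F s.
  move=> /andP[s0 su]; rewrite ltNge; apply/negP => Fs.
  have Ss : S s by split => //; rewrite s0 (le_trans (ltW su)).
  by have := uS s Ss; rewrite leNgt su.
have Fu : F u = 0.
  apply/eqP; rewrite eq_le; apply/andP; split; rewrite leNgt; apply/negP => h.
    have [e /= e0 he] : \forall y \near u, 0 < F y by exact: (cvgr_gt _ (cF u)).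
    have [s Ss su] := inf_adherent e0 hS.
    have us := uS _ Ss.
    have : 0 < F s.
      by apply: he; rewrite /= distrC ger0_norm ?subr_ge0// ltrBlDl.
    by rewrite ltNge; case: Ss => _ ->.
  have [e /= e0 he] : \forall y \near u, F y < 0 by exact: (cvgr_lt _ (cF u)).
  have u0' : 0 < u.
    rewrite lt_neqAle u0 andbT; apply/eqP => u_.
    by move: F0; rewrite [X in F X]u_ leNgt h.
  pose d := Num.min (u / 2) (e / 2).
  have d0 : 0 < d by rewrite lt_min !divr_gt0.
  have du : d <= u / 2 by rewrite ge_min lexx.
  have de : d <= e / 2 by rewrite ge_min lexx orbT.
  have : F (u - d) < 0.
    by apply: he; rewrite /= subKr (gtr0_norm d0); clear -de e0; lra.
  by apply/negP; rewrite -leNgt ltW// pos//; clear -d0 du u0'; lra.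
exists u; [by rewrite u0 ut|split => // s /andP[s0]].
by rewrite le_eqVlt => /predU1P[->|su]; [rewrite Fu|rewrite ltW// pos// s0].
Qed.

(** Stated for a family of scalar paths so that it serves both for s and, when f' < 0, for L - s.
    The path from L realizes the time: it can leave [0, L] only through 0. Any other path remaining
    inside beyond that time would make the primitive of 1 / V negative. *)
Lemma flush_time (I : Type) (a : I -> R -> R) (V : R -> R) (L T : R) :
  0 < L -> continuous V -> (forall s, 0 <= s <= L -> 0 < V s) ->
  (forall i (t : R), derivable (a i) t 1) ->
  (forall i t, 0 <= a i t <= L -> derive1 (a i) t = - V (a i t)) ->
  (exists i, a i 0 = L) ->
  (0 < T /\ forall i, 0 <= a i 0 <= L -> exists t, 0 < t < T /\ ~ (0 <= a i t <= L)) <->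
  Rint 0 L (fun s => (V s)^-1) < T.
Proof.
move=> L0 cV V0 da aV [i0 ai0].
have [m m0 mV] := continuous_pos_min (ltW L0) cV V0.
(* The positivity of [V] is known on [0, L] only; truncation at its minimum makes the integrand
   continuous on R. *)
pose h s := (Num.max (V s) m)^-1.
have ch : continuous h.
  move=> s; apply: cvgV; first by rewrite gt_eqF// lt_max m0 orbT.
  exact: (continuous_max (cV s) (@cst_continuous _ _ m s)).
have h0 s : 0 < h s by rewrite invr_gt0 lt_max m0 orbT.
have hV s : 0 <= s <= L -> h s = (V s)^-1 by move=> sL; rewrite /h max_l// mV.
have [G [G0 dG]] := primitive_exists 0 ch.
have GL : Rint 0 L (fun s => (V s)^-1) = G L.
  rewrite -[RHS]subr0 -[X in _ - X]G0 -(Rint_FTC (ltW L0) ch dG).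
  by apply: eq_Rint => s sL; rewrite hV.
rewrite GL.
have Ginc x y : x <= y -> G x <= G y.
  move=> xy; have [c _ e] := mean_value xy dG.
  by rewrite -subr_ge0 e mulr_ge0 ?subr_ge0// ltW.
have GL0 : 0 < G L.
  have [c _ e] := mean_value (ltW L0) dG.
  by move: e; rewrite G0 !subr0 => ->; rewrite mulr_gt0.
have dai i := is_derive_total (da i).
have ca i := is_derive_continuous (dai i).
have dGa i (t : R) : is_derive t 1 (fun t => G (a i t)) (h (a i t) * derive1 (a i) t).
  exact: is_derive1_o (dG _) (dai i t).
have law i t : 0 <= t -> (forall s, 0 <= s <= t -> 0 <= a i s <= L) -> G (a i t) = G (a i 0) - t.
  move=> t0 aI; have [c cI] := mean_value t0 (dGa i).
  rewrite subr0 => /eqP; rewrite subr_eq => /eqP ->.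
  have acI := aI c cI.
  by rewrite aV// hV// mulrN mulVf ?mulN1r 1?addrC// gt_eqF// V0.
split.
  move=> [T0 fl]; have [|t [/andP[t0 tT] nt]] := fl i0.
    by rewrite ai0 lexx ltW.
  (* If the path lay beyond L at time r, it would have stayed above L since its last visit to L,
     where its derivative is negative. The last visit is a first hit in reversed time. *)
  have aL r : 0 <= r -> a i0 r <= L.
    move=> r0; rewrite leNgt; apply/negP => ar.
    have [||||u /andP[u0 ur] [eu uI]] := @first_hit (fun s => a i0 (r - s) - L) r.
    - apply: ctsB; last exact: ctsC.
      move=> s; apply: (@continuous_comp _ _ _ (fun s => r - s) (a i0)); last exact: ca.
      by apply: cvgB; [exact: cvg_cst|exact: cvg_id].
    - exact: r0.
    - by rewrite subr0 subr_ge0 ltW.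
    - by rewrite subrr ai0 subrr.
    have {}eu : a i0 (r - u) = L by apply/eqP; rewrite -subr_eq0 eu.
    have u0' : 0 < u.
      by rewrite lt_neqAle u0 andbT; apply: contraTneq ar => u_; rewrite -eu -u_ subr0 ltxx.
    have LL : 0 <= L <= L by rewrite lexx ltW.
    have d0 : derive1 (a i0) (r - u) < 0 by rewrite aV eu// oppr_lt0 V0.
    have cq : h^-1 *: (a i0 (h + (r - u)) - a i0 (r - u)) @[h --> 0^'] --> derive1 (a i0) (r - u).
      exact: cvg_derive1.
    have [e /= e0 he] := cvgr_lt _ cq _ d0.
    pose d := Num.min u (e / 2).
    have dp : 0 < d by rewrite lt_min u0' divr_gt0.
    have de : d <= e / 2 by rewrite ge_min lexx orbT.
    have du : d <= u by rewrite ge_min lexx.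
    have : d^-1 *: (a i0 (d + (r - u)) - a i0 (r - u)) < 0.
      apply: he; last by rewrite gt_eqF.
      by rewrite /= sub0r normrN gtr0_norm//; clear -de e0; lra.
    apply/negP; rewrite -leNgt eu; apply: mulr_ge0; first by rewrite invr_ge0 ltW.
    have := uI (u - d); have -> : r - (u - d) = d + (r - u) by ring.
    by apply; clear -dp du; lra.
  have [at0|at0] := ltP (a i0 t) 0; last by case: nt; rewrite at0 aL// ltW.
  have [||u /andP[u0 ut] [au uI]] := first_hit (ca i0) (ltW t0).
  - by rewrite ai0 ltW.
  - exact: ltW.
  have := law i0 u u0; rewrite au G0 ai0 => law'.
  apply: le_lt_trans tT; apply: le_trans ut; rewrite -subr_le0 -law'//.
  by move=> s sI; rewrite uI// aL//; case/andP: sI.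
move=> GT; split; first exact: lt_trans GL0 GT.
move=> i iL; apply: contrapT => nex.
have inn t : 0 <= t < T -> 0 <= a i t <= L.
  move=> /andP[]; rewrite le_eqVlt => /predU1P[<-//|t0] tT.
  by apply: contrapT => nc; apply: nex; exists t; rewrite t0.
pose t := (G L + T) / 2.
have t1 : G L < t by rewrite /t; clear -GT; lra.
have t2 : t < T by rewrite /t; clear -GT; lra.
have t0 : 0 <= t by apply/ltW/(lt_trans GL0).
have e : G (a i t) = G (a i 0) - t.
  by apply: law => // s /andP[s0 st]; apply: inn; rewrite s0 (le_lt_trans st).
have /andP[at0 _] : 0 <= a i t <= L by apply: inn; rewrite t0.
have := Ginc _ _ at0; rewrite e G0; move/andP: iL => [_ /Ginc].
by clear -t1; lra.
Qed.

End FlushTime.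

(** * Extensions of the surface and their gradient flow *)

Section Extension.
Context {R : realType}.
Implicit Types (F : R * R -> R) (gam : R * R -> R -> R * R).

Lemma is_derive_fst (c : R -> R * R) (t : R) (d : R * R) :
  is_derive t 1 c d -> is_derive t 1 (fun r => (c r).1) d.1.
Proof.
move=> [dc e]; have h : h^-1 *: ((fun r => (c r).1) (h *: 1 + t) - (c t).1) @[h --> 0^'] --> d.1.
  by rewrite -e; exact: (cvg_comp _ _ dc cvg_fst).
by split; [apply/cvg_ex; exists d.1|exact: cvg_lim h].
Qed.

Lemma is_derive_snd (c : R -> R * R) (t : R) (d : R * R) :
  is_derive t 1 c d -> is_derive t 1 (fun r => (c r).2) d.2.
Proof.
move=> [dc e]; have h : h^-1 *: ((fun r => (c r).2) (h *: 1 + t) - (c t).2) @[h --> 0^'] --> d.2.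
  by rewrite -e; exact: (cvg_comp _ _ dc cvg_snd).
by split; [apply/cvg_ex; exists d.2|exact: cvg_lim h].
Qed.

Lemma derivable_slice F (x : R * R) : differentiable F x -> derivable (fun s => F (s, x.2)) x.1 1.
Proof.
move=> dF; apply/derivable1_diffP.
have d2 : differentiable (fun s : R => (s, x.2)) x.1.
  by apply: differentiable_pair => //; exact: differentiable_cst.
by apply: (@differentiable_comp _ _ _ _ (fun s => (s, x.2)) F) => //; rewrite -surjective_pairing.
Qed.

(** Increments are taken towards the middle of [0, L], so that they stay inside even when s is an
    end point. *)
Lemma derive1_eq_on (f h : R -> R) (L s : R) : 0 < L -> 0 <= s <= L ->
  derivable f s 1 -> derivable h s 1 -> (forall r, 0 <= r <= L -> f r = h r) ->
  derive1 f s = derive1 h s.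
Proof.
move=> L0 sL df dh fh; apply/eqP; rewrite -subr_eq0; apply/negPn/negP => d0.
pose d := derive1 f s - derive1 h s.
have c0 : h0^-1 *: (f (h0 + s) - f s) - h0^-1 *: (h (h0 + s) - h s) @[h0 --> 0^'] --> d.
  by apply: cvgB; exact: cvg_derive1.
have dn : 0 < `|d| by rewrite normr_gt0.
move/cvgrPdist_lt : (c0) => /(_ _ dn) [e /= e0 he].
pose r := Num.min (L / 2) (e / 2).
have r0 : 0 < r by rewrite lt_min !divr_gt0.
have rL : r <= L / 2 by rewrite ge_min lexx.
have re : r <= e / 2 by rewrite ge_min lexx orbT.
have [y yr yL] : exists2 y, `|y| = r & 0 <= y + s <= L.
  have [sh|sh] := leP s (L / 2).
    by exists r; [exact: gtr0_norm|clear -sh rL r0 sL; lra].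
  by exists (- r); [rewrite normrN gtr0_norm|clear -sh rL r0 sL; lra].
have : `|d - (y^-1 *: (f (y + s) - f s) - y^-1 *: (h (y + s) - h s))| < `|d|.
  apply: he; last by rewrite -normr_gt0 yr.
  by rewrite /= sub0r normrN yr; clear -re e0; lra.
by rewrite !fh// subrr subr0 ltxx.
Qed.

Lemma grad_extension (L : R) (Rad f : R -> R) (gt : metric R) (ft : R * R -> R) :
  0 < L -> smooth f -> (forall s, 0 <= s <= L -> 0 < Rad s) ->
  extension L (rot_metric Rad) (fun x => f x.1) gt ft ->
  forall x, cyl L x -> [/\ ds ft x = derive1 f x.1, dth ft x = 0 & grad gt ft x = (derive1 f x.1, 0)].
Proof.
move=> L0 sf Rad0 [_ ge [_ dft _] _ fe] x xL.
have e1 : ds ft x = derive1 f x.1.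
  rewrite dsE; apply: (derive1_eq_on L0 xL).
  - exact: derivable_slice.
  - exact: smooth_derivable.
  - by move=> r rL; rewrite fe.
have e2 : dth ft x = 0.
  rewrite dthE; have -> : (fun t => ft (x.1, t)) = fun=> f x.1.
    by apply/funext => t; rewrite fe.
  exact: is_derive_derive1 (is_derive1_cst (f x.1) x.2).
split => //; rewrite /grad /sharp e1 e2 /iss /ist /itt /gdet.
have [-> -> ->] := ge x xL; rewrite /= !mulr0 !addr0 mul1r expr0n /= subr0 oppr0 mul0r.
by rewrite divff ?mul1r ?mul0r// expf_neq0// gt_eqF// Rad0.
Qed.

Lemma continuous_metric (gt : metric R) (c : R -> R * R) : riemannian_cyl gt -> continuous c ->
  [/\ continuous (fun t => iss gt (c t)), continuous (fun t => ist gt (c t))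
    & continuous (fun t => itt gt (c t))].
Proof.
move=> [[_ sss] [_ sst] [_ stt] pos] cc.
have ct (h : R * R -> R) : (forall x, differentiable h x) -> continuous (fun t => h (c t)).
  move=> dh t; apply: continuous_comp; first exact: cc.
  exact: differentiable_continuous.
have css := ct _ (sss 0%N 0%N); have cst := ct _ (sst 0%N 0%N); have ctt := ct _ (stt 0%N 0%N).
have cd : continuous (fun t => gdet gt (c t)).
  exact: (ctsB (ctsM css ctt) (ctsM cst cst)).
have cdV : continuous (fun t => (gdet gt (c t))^-1).
  by move=> t; apply: cvgV; [rewrite gt_eqF//; case: (pos (c t))|exact: cd].
have cstN : continuous (fun t => - gst gt (c t)) by move=> t; apply: cvgN; exact: cst.
by split; [exact: ctsM ctt cdV|exact: ctsM cstN cdV|exact: ctsM css cdV].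
Qed.

Lemma flow_stationary (gt : metric R) (ft : R * R -> R) gam (x : R * R) :
  riemannian_cyl gt -> C11_cyl ft -> neg_gradient_flow gt ft gam ->
  ds ft x = 0 -> dth ft x = 0 -> forall t, 0 <= t -> gam x t = x.
Proof.
move=> rg [_ _ [K [lds ldth]]] flow dx dx' T T0.
have [g0 dg] := flow x.
pose c := gam x.
have cc : continuous c.
  by move=> t; apply/differentiable_continuous/derivable1_diffP; case: (dg t).
have [ci1 ci2 ci3] := continuous_metric rg cc.
have [C1 C10 C1P] := continuous_bounded 0 T ci1.
have [C2 C20 C2P] := continuous_bounded 0 T ci2.
have [C3 C30 C3P] := continuous_bounded 0 T ci3.
have C10' := ltW C10; have C20' := ltW C20; have C30' := ltW C30.
pose n t := `|c t - x|.
have n1 t : `|(c t).1 - x.1| <= n t by rewrite /n /Num.norm /= le_max lexx.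
have n2 t : `|(c t).2 - x.2| <= n t by rewrite /n /Num.norm /= le_max lexx orbT.
have nw t : n t ^+ 2 <= ((c t).1 - x.1) ^+ 2 + ((c t).2 - x.2) ^+ 2.
  have -> : n t = Num.max `|(c t).1 - x.1| `|(c t).2 - x.2| by [].
  by rewrite maxEle; case: ifP => _; rewrite real_normK ?num_real// ?lerDl ?lerDr sqr_ge0.
have lip (h : R * R -> R) : K.-lipschitz h -> h x = 0 -> forall t, `|h (c t)| <= `|K| * n t.
  move=> lh hx t; have := lh (c t, x) (conj I I); rewrite /= hx subr0 => h1.
  by apply: le_trans h1 _; apply: ler_wpM2r => //; exact: ler_norm.
have l1 := lip _ lds dx; have l2 := lip _ ldth dx'.
pose v t : R * R := - grad gt ft (c t).
pose C := (C1 + C2 + C3) * `|K|.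
have C0 : 0 <= C by rewrite mulr_ge0// !addr_ge0.
have prod_le (a b A' B' : R) : `|a| <= A' -> `|b| <= B' -> `|a * b| <= A' * B'.
  by move=> ha hb; rewrite normrM; apply: ler_pM.
have v1 t : 0 <= t <= T -> `|(v t).1| <= C * n t.
  move=> tT; rewrite /v /= normrN; apply: le_trans (ler_normD _ _) _.
  have h1 := prod_le _ _ _ _ (C1P _ tT) (l1 t); have h2 := prod_le _ _ _ _ (C2P _ tT) (l2 t).
  apply: le_trans (lerD h1 h2) _.
  have -> : C * n t = C1 * (`|K| * n t) + C2 * (`|K| * n t) + C3 * (`|K| * n t) by rewrite /C; ring.
  by rewrite lerDl; apply: mulr_ge0 => //; apply: mulr_ge0; exact: normr_ge0.
have v2 t : 0 <= t <= T -> `|(v t).2| <= C * n t.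
  move=> tT; rewrite /v /= normrN; apply: le_trans (ler_normD _ _) _.
  have h1 := prod_le _ _ _ _ (C2P _ tT) (l1 t); have h2 := prod_le _ _ _ _ (C3P _ tT) (l2 t).
  apply: le_trans (lerD h1 h2) _.
  have -> : C * n t = C1 * (`|K| * n t) + (C2 * (`|K| * n t) + C3 * (`|K| * n t)) by rewrite /C; ring.
  by rewrite lerDr; apply: mulr_ge0 => //; apply: mulr_ge0; exact: normr_ge0.
have da (t : R) : is_derive t 1 (fun r => (c r).1) (v t).1 := is_derive_fst (dg t).
have db (t : R) : is_derive t 1 (fun r => (c r).2) (v t).2 := is_derive_snd (dg t).
(* The norm of R * R is a maximum, hence not differentiable; the squared Euclidean distance
   dominates its square. *)
pose w t := ((c t).1 - x.1) ^+ 2 + ((c t).2 - x.2) ^+ 2.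
pose w' t := 2 * ((c t).1 - x.1) * (v t).1 + 2 * ((c t).2 - x.2) * (v t).2.
have dw (t : R) : is_derive t 1 w (w' t).
  have d1 := is_derive1B (da t) (is_derive1_cst x.1 t).
  have d2 := is_derive1B (db t) (is_derive1_cst x.2 t).
  have d3 := is_derive1D (is_derive1M d1 d1) (is_derive1M d2 d2).
  by apply: is_derive_congr d3 _; rewrite /w'; ring.
have w'w t : 0 <= t <= T -> w' t <= 4 * C * w t.
  move=> tT.
  have h1 := prod_le _ _ _ _ (n1 t) (v1 t tT); have h2 := prod_le _ _ _ _ (n2 t) (v2 t tT).
  have h3 := le_trans (ler_norm _) h1; have h4 := le_trans (ler_norm _) h2.
  have h5 : C * n t ^+ 2 <= C * w t by apply: ler_wpM2l => //; exact: nw.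
  by rewrite /w'; clear -h3 h4 h5; nra.
pose W t := expR (- (4 * C) * t) * w t.
have dW (t : R) : is_derive t 1 W (expR (- (4 * C) * t) * (w' t - 4 * C * w t)).
  have d1 := is_derive1_o (is_derive_expR _) (is_derive1_mulr (- (4 * C)) t).
  by apply: is_derive_congr (is_derive1M d1 (dw t)) _; ring.
have [s sT] := mean_value T0 dW.
have W0 : W 0 = 0 by rewrite /W /w /c g0 !subrr expr0n /= addr0 mulr0.
rewrite W0 !subr0 => WT.
have : W T <= 0.
  rewrite WT; apply: mulr_le0_ge0 => //; apply: mulr_ge0_le0; first exact: expR_ge0.
  by rewrite subr_le0; exact: w'w.
rewrite /W pmulr_rle0 ?expR_gt0// => wT.
have := le_trans (nw T) wT => nT.
apply/eqP; rewrite -subr_eq0 -normr_eq0 -sqrf_eq0 eq_le sqr_ge0 andbT.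
exact: nT.
Qed.

End Extension.

Section Flushing.
Context {R : realType}.
Implicit Types (gam : R * R -> R -> R * R).
Local Notation leb := (@lebesgue_measure R).

Lemma bm_eq (L : R) (f h : R -> R) : (forall s, 0 <= s <= L -> f s = h s) -> bm L f -> bm L h.
Proof.
move=> fh [mf [K fK]]; split; last by exists K => s sL; rewrite -fh// fK.
by apply: eq_measurable_fun mf => s; rewrite inE /= in_itv /=; exact: fh.
Qed.

Lemma bm_inv (L : R) (V : R -> R) : 0 < L -> continuous V ->
  (forall s, 0 <= s <= L -> V s != 0) -> bm L (fun s => (V s)^-1).
Proof.
move=> L0 cV V0.
have V2 s : 0 <= s <= L -> 0 < V s * V s by move=> sL; rewrite -expr2 lt_neqAle sqr_ge0 eq_sym sqrf_eq0 V0.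
have [m m0 mV] := continuous_pos_min (ltW L0) (ctsM cV cV) V2.
pose VV s := V s * V s; have cVV : continuous VV := ctsM cV cV.
have c1 : continuous (fun s => (Num.max (VV s) m)^-1).
  move=> s; apply: cvgV; first by rewrite gt_eqF// lt_max m0 orbT.
  exact: (continuous_max (cVV s) (@cst_continuous _ _ m s)).
apply: bm_eq (bm_continuous L (ctsM cV c1)) => s sL.
by rewrite /VV max_l ?mV// invfM mulrA divff ?V0// mul1r.
Qed.

Lemma flushes_pos (L T : R) (V : R -> R) gam :
  0 < L -> continuous V -> (forall s, 0 <= s <= L -> 0 < V s) -> (forall x, gam x 0 = x) ->
  (forall x (t : R), derivable (fun t => (gam x t).1) t 1) ->
  (forall x t, cyl L (gam x t) -> derive1 (fun t => (gam x t).1) t = - V (gam x t).1) ->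
  flushes L gam T <-> Rint 0 L (fun s => (V s)^-1) < T.
Proof.
move=> L0 cV V0 g0 da aV.
rewrite -(@flush_time _ (R * R)%type (fun x t => (gam x t).1) V L T)//.
  by split=> -[T0 h]; split => // x xL; apply: h; move: xL; rewrite /= ?g0.
by exists (L, 0); rewrite g0.
Qed.

Lemma flushes_neg (L T : R) (V : R -> R) gam :
  0 < L -> continuous V -> (forall s, 0 <= s <= L -> V s < 0) -> (forall x, gam x 0 = x) ->
  (forall x (t : R), derivable (fun t => (gam x t).1) t 1) ->
  (forall x t, cyl L (gam x t) -> derive1 (fun t => (gam x t).1) t = - V (gam x t).1) ->
  flushes L gam T <-> - Rint 0 L (fun s => (V s)^-1) < T.
Proof.
move=> L0 cV V0 g0 da aV.
pose W s := - V (L - s).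
have cVr : continuous (fun s => V (L - s)).
  move=> s; apply: (@continuous_comp _ _ _ (fun s => L - s) V); last exact: cV.
  by apply: cvgB; [exact: cvg_cst|exact: cvg_id].
have cW : continuous W by move=> s; apply: cvgN; exact: cVr.
have bV : bm L (fun s => (V s)^-1) by apply: bm_inv => // s sL; rewrite lt_eqF// V0.
have rI s : 0 <= s <= L <-> 0 <= L - s <= L.
  by rewrite subr_ge0 lerBlDr lerDl andbC.
have -> : - Rint 0 L (fun s => (V s)^-1) = Rint 0 L (fun s => (W s)^-1).
  have := Rint_reflect bV (lexx 0) (ltW L0) (lexx L); rewrite subrr subr0 => <-.
  rewrite -mulN1r -(@RintZ _ L)//.
    by apply: eq_Rint => s _; rewrite /W invrN mulN1r.
  by apply: bm_inv => // s /(iffLR (rI _)) sL; rewrite lt_eqF// V0.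
have dg x (t : R) := is_derive_total (da x) t.
have dr x (t : R) : is_derive t 1 (fun t => L - (gam x t).1) (- derive1 (fun t => (gam x t).1) t).
  by apply: is_derive_congr (is_derive1B (is_derive1_cst L t) (dg x t)) _; rewrite sub0r.
rewrite -(@flush_time _ (R * R)%type (fun x t => L - (gam x t).1) W L T)//.
- split=> -[T0 h]; split => // x xL.
    have [|t [tT nt]] := h x; first by move: xL; rewrite g0 => /(iffRL (rI _)).
    by exists t; split => // /(iffRL (rI _)).
  have [|t [tT nt]] := h x; first by rewrite g0; apply: (iffLR (rI _)).
  by exists t; split => // nt'; apply: nt; apply: (iffLR (rI _)).
- by move=> s /(iffLR (rI _)) sL; rewrite /W oppr_gt0 V0.
- move=> x t /(iffRL (rI _)) xt; rewrite (is_derive_derive1 (dr x t)) /W subKr !opprK.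
  by rewrite aV// opprK.
- by exists (0, 0); rewrite g0 subr0.
Qed.

Lemma flushing (L : R) (Rad f : R -> R) (gt : metric R) (ft : R * R -> R) gam :
  0 < L -> smooth f -> (forall s, 0 <= s <= L -> 0 < Rad s) ->
  extension L (rot_metric Rad) (fun x => f x.1) gt ft -> neg_gradient_flow gt ft gam ->
  (FC L gam <-> (forall s : R, 0 <= s <= L -> derive1 f s != 0)) /\
  (FC L gam -> T_FC L gam = `| \int[leb]_(s in `[0%R, L]) ((derive1 f s)^-1)%:E |%E
   /\ (T_FC L gam < +oo)%E).
Proof.
move=> L0 sf Rad0 ext flow.
have gE := grad_extension L0 sf Rad0 ext.
have g0 x : gam x 0 = x by case: (flow x).
have dg1 x (t : R) : is_derive t 1 (fun t => (gam x t).1) (- grad gt ft (gam x t)).1.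
  by apply: is_derive_fst; case: (flow x).
have cV : continuous (derive1 f) := smooth_continuous (smooth_derive1 sf).
have da x (t : R) : derivable (fun t => (gam x t).1) t 1 by case: (dg1 x t).
have aV x t : cyl L (gam x t) ->
    derive1 (fun t => (gam x t).1) t = - derive1 f (gam x t).1.
  by move=> xt; rewrite (is_derive_derive1 (dg1 x t)); have [_ _ ->] := gE _ xt.
have FC_neq0 : FC L gam -> forall s : R, 0 <= s <= L -> derive1 f s != 0.
  move=> [T [_ fl]] s sL; apply/eqP => f0.
  have xL : cyl L (s, 0) by [].
  have [d1 d2 _] := gE _ xL; rewrite /= f0 in d1.
  have [t [/andP[t0 _]]] := fl _ xL; apply.
  have [rg _ C11 _ _] := ext.
  by rewrite (flow_stationary rg C11 flow d1 d2 (ltW t0)).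
have main : (forall s : R, 0 <= s <= L -> derive1 f s != 0) ->
    forall T, flushes L gam T <-> `|Rint 0 L (fun s => (derive1 f s)^-1)| < T.
  move=> f0 T.
  have sgn (V : R -> R) : continuous V -> (forall s : R, 0 <= s <= L -> V s != 0) -> 0 <= V 0 ->
      forall s, 0 <= s <= L -> 0 < V s.
    move=> cV' V0 V00 s /andP[s0 sL]; rewrite ltNge; apply/negP => Vs.
    have [u /andP[u0 us] [Vu _]] := first_hit cV' s0 V00 Vs.
    by have := V0 u; rewrite u0 (le_trans us)// Vu eqxx => /(_ isT).
  have [p0|n0] := leP 0 (derive1 f 0).
    have fp := sgn _ cV f0 p0; rewrite (flushes_pos T L0 cV fp g0 da aV) ger0_norm//.
    by apply: Rint_ge0 => s sL; rewrite invr_ge0 ltW// fp.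
  have cVN : continuous (fun s => - derive1 f s) by move=> s; apply: cvgN; exact: cV.
  have fn s : 0 <= s <= L -> derive1 f s < 0.
    move=> sL; rewrite -oppr_gt0; apply: (sgn (fun s => - derive1 f s)) => //.
      by move=> r rL; rewrite oppr_eq0 f0.
    by rewrite oppr_ge0 ltW.
  rewrite (flushes_neg T L0 cV fn g0 da aV) -normrN ger0_norm//.
  rewrite -mulN1r -(@RintZ _ L)//; last exact: bm_inv.
  by apply: Rint_ge0 => s sL; rewrite mulN1r -invrN invr_ge0 oppr_ge0 ltW// fn.
split; first split => //.
  move=> f0; exists (`|Rint 0 L (fun s => (derive1 f s)^-1)| + 1).
  by apply/main => //; rewrite ltrDl.
move=> fc; have f0 := FC_neq0 fc.
have bV : bm L (fun s => (derive1 f s)^-1) by exact: bm_inv.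
rewrite (EFin_Rint bV (lexx 0) (lexx L)).
have -> : T_FC L gam = (`|Rint 0 L (fun s => (derive1 f s)^-1)|%:E)%E.
  rewrite /T_FC; apply/eqP; rewrite eq_le; apply/andP; split.
    apply/lee_addgt0Pr => e e0; apply: ereal_inf_lbound.
    exists (`|Rint 0 L (fun s => (derive1 f s)^-1)| + e) => //.
    by apply/main => //; rewrite ltrDl.
  by apply: le_ereal_inf_tmp => _ [T fT <-]; rewrite lee_fin ltW//; apply/main.
by rewrite ltry.
Qed.

End Flushing.

(** * The radius *)

Section Radius.
Context {R : realType}.
Implicit Types (b d N L s x : R).

(* A smooth positive function on R which is squeezed between
   (s + d)^2 / (1 + d^2) and (s + d)^2 for s >= 0. *)
Definition tau d s : R := ((s + d) ^+ 2 + d ^+ 4) / (1 + d ^+ 2).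

Definition profile b d s : R := tau d s `^ (- (b / 2)).

(* The factor expR (N s (L / 4 - s)) is at least 1 on [0, L / 4], is at most 1 near the other
   end, and makes the function as small as wanted in the middle of the interval. *)
Definition inv_radius b d N L s : R :=
  profile b d s * expR (N * (s * (L / 4 - s))) +
  profile b d (L - s) * expR (N * ((L - s) * (L / 4 - (L - s)))).

Lemma tau_gt0 d s : 0 < d -> 0 < tau d s.
Proof.
move=> d0; apply: divr_gt0; last by rewrite ltr_wpDr ?sqr_ge0.
by rewrite ltr_wpDl ?sqr_ge0 ?exprn_gt0.
Qed.

Lemma powR_sqr_half b x : 0 < x -> (x ^+ 2) `^ (- (b / 2)) = x `^ (- b).
Proof.
move=> x0; rewrite -powR_mulrn ?(ltW x0)// -powRrM; congr (_ `^ _).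
by rewrite mulrN mulrC divfK.
Qed.

Lemma powRN_le b x y : 0 <= b -> 0 < x -> x <= y -> y `^ (- b) <= x `^ (- b).
Proof.
move=> b0 x0 xy; have y0 := lt_le_trans x0 xy.
rewrite !powRN lef_pV2 ?posrE ?powR_gt0//.
by apply: ge0_ler_powR => //; rewrite nnegrE ltW.
Qed.

(** Reduces to d^2 <= (s + d)^2, thanks to the term d^4 of [tau]. *)
Lemma profile_ge b d s : 0 <= b -> 0 < d -> 0 <= s -> (s + d) `^ (- b) <= profile b d s.
Proof.
move=> b0 d0 s0; have sd : 0 < s + d by rewrite ltr_wpDl.
rewrite -powR_sqr_half//; apply: powRN_le; rewrite ?divr_ge0 ?tau_gt0//.
have D0 : 0 < 1 + d ^+ 2 by rewrite ltr_wpDr ?sqr_ge0.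
rewrite /tau ler_pdivrMr// mulrDr mulr1 lerD2l.
have -> : d ^+ 4 = d ^+ 2 * d ^+ 2 by ring.
apply: ler_wpM2r; first exact: sqr_ge0.
by rewrite ler_pXn2r ?nnegrE ?lerDr ?(ltW sd) ?(ltW d0).
Qed.

(** Dividing by 1 + d^2 in [tau] costs the factor (1 + d^2)^(b / 2) <= exp(b d^2 / 2). *)
Lemma profile_le b d s : 0 <= b -> 0 < d -> 0 <= s ->
  profile b d s <= (s + d) `^ (- b) * expR (b / 2 * d ^+ 2).
Proof.
move=> b0 d0 s0; have sd : 0 < s + d by rewrite ltr_wpDl.
have D0 : 0 < 1 + d ^+ 2 by rewrite ltr_wpDr ?sqr_ge0.
apply: (@le_trans _ _ (((s + d) ^+ 2 / (1 + d ^+ 2)) `^ (- (b / 2)))).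
  apply: powRN_le; rewrite ?divr_ge0 ?divr_gt0 ?exprn_gt0//.
  by rewrite /tau ler_pM2r ?invr_gt0// lerDl exprn_ge0// ltW.
rewrite powRM ?sqr_ge0 ?invr_ge0 ?(ltW D0)// powR_sqr_half//.
apply: ler_wpM2l; first exact: powR_ge0.
rewrite -powR_inv1 ?(ltW D0)// -powRrM mulN1r opprK.
rewrite /powR gt_eqF// ler_expR; apply: ler_wpM2l; first by rewrite divr_ge0.
by apply: le_ln1Dx; apply: lt_le_trans (sqr_ge0 d); rewrite oppr_lt0.
Qed.

Lemma profile_gt0 b d s : 0 < d -> 0 < profile b d s.
Proof. by move=> d0; rewrite powR_gt0// tau_gt0. Qed.

Lemma inv_radius_gt0 b d N L s : 0 < d -> 0 < inv_radius b d N L s.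
Proof. by move=> d0; rewrite addr_gt0// mulr_gt0 ?profile_gt0 ?expR_gt0. Qed.

Lemma inv_radius_sym b d N L s : inv_radius b d N L (L - s) = inv_radius b d N L s.
Proof. by rewrite /inv_radius subKr addrC. Qed.

Lemma smooth_inv_radius b d N L : 0 < d -> smooth (inv_radius b d N L).
Proof.
move=> d0; apply/smoothP => n.
have c0 m : Ck m (fun s => s + d) := CkD (Ck_id m) (Ck_cst m d).
have c1 m : Ck m (fun s => s * (L / 4 - s)).
  by apply: CkM; [exact: Ck_id|apply: CkB; [exact: Ck_cst|exact: Ck_id]].
have c2 m : Ck m (fun s => profile b d s * expR (N * (s * (L / 4 - s)))).
  apply: CkM.
    apply: Ck_powR; first by move=> s; exact: tau_gt0.
    apply: CkM; last exact: Ck_cst.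
    apply: CkD; last exact: Ck_cst.
    exact: (CkM (c0 m) (c0 m)).
  apply: Ck_comp; first by move=> j; exact: Ck_expR.
  by apply: CkM; [exact: Ck_cst|exact: c1].
have c3 : Ck n (fun s => L - s) by apply: CkB; [exact: Ck_cst|exact: Ck_id].
exact: (CkD (c2 n) (Ck_comp c2 c3)).
Qed.

Lemma inv_radius_ge b d N L s : 0 <= b -> 0 < d -> 0 <= N -> 0 <= s <= L / 4 ->
  (s + d) `^ (- b) <= inv_radius b d N L s.
Proof.
move=> b0 d0 N0 /andP[s0 sL].
rewrite -[leLHS]addr0; apply: lerD; last by rewrite mulr_ge0 ?expR_ge0// ltW// profile_gt0.
apply: le_trans (profile_ge b0 d0 s0) _; rewrite ler_peMr ?(ltW (profile_gt0 _ _ d0))//.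
by rewrite one_le_expR// !mulr_ge0// subr_ge0.
Qed.


(* The bound away from the end s = 0 of the part of the inverse radius which blows up there. *)
Definition far_cst b (d0 L : R) : R := (3 * L / 8) `^ (- b) * expR (b / 2 * d0 ^+ 2).

Lemma profile_far b d (d0 L s : R) : 0 <= b -> 0 < d -> d <= d0 -> 0 < L -> 3 * L / 8 <= s ->
  profile b d s <= far_cst b d0 L.
Proof.
move=> b0 dp dd L0 sL; have l0 : 0 < 3 * L / 8 by rewrite divr_gt0 ?mulr_gt0.
have s0 : 0 <= s by rewrite (le_trans _ sL)// ltW.
apply: le_trans (profile_le b0 dp s0) _; apply: ler_pM; rewrite ?powR_ge0 ?expR_ge0//.
  by apply: powRN_le => //; rewrite (le_trans sL)// lerDl ltW.
rewrite ler_expR; apply: ler_wpM2l; first by rewrite divr_ge0.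
by rewrite ler_pXn2r// nnegrE ltW// (lt_le_trans dp).
Qed.

Lemma expR_neg_le (X Y : R) : 0 < Y -> Y <= X -> expR (- X) <= Y^-1.
Proof.
move=> Y0 YX; rewrite expRN lef_pV2 ?posrE ?expR_gt0//.
by apply: le_trans YX (le_trans _ (expR_ge1Dx _)); rewrite lerDr.
Qed.

(** For r >= 3 L / 8 the exponent satisfies r (L / 4 - r) <= - (3 L / 8) (L / 8) = - 3 L^2 / 64, and
    both s and L - s are such r. *)
Lemma inv_radius_mid b d (d0 L N Y s : R) : 0 <= b -> 0 < d -> d <= d0 -> 0 < L -> 0 < Y ->
  Y <= N * (3 * L ^+ 2 / 64) -> 3 * L / 8 <= s <= 5 * L / 8 ->
  inv_radius b d N L s <= 2 * far_cst b d0 L / Y.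
Proof.
move=> b0 dp dd L0 Y0 YN sI.
have N0 : 0 < N by move: (lt_le_trans Y0 YN); rewrite pmulr_lgt0// divr_gt0 ?mulr_gt0 ?exprn_gt0.
have half r : 3 * L / 8 <= r -> profile b d r * expR (N * (r * (L / 4 - r))) <= far_cst b d0 L / Y.
  move=> rL; apply: ler_pM; rewrite ?expR_ge0//; first exact: ltW (profile_gt0 _ _ dp).
    exact: profile_far.
  rewrite -[N * _]opprK; apply: expR_neg_le => //; apply: le_trans YN _.
  rewrite -mulrN; apply: ler_wpM2l; first exact: ltW.
  by clear -rL L0; nra.
rewrite -mulrA mulr_natl mulr2n; apply: lerD; apply: half; clear -sI; lra.
Qed.

(** With x = s + d, the part singular at 0 exceeds x^(-b) by a factor exp(O(x)). The other part is
    bounded by [far_cst], and b >= 1 gives x^b <= x (L + d0)^(b - 1), so a constant is O(x) times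
    x^(-b). *)
Lemma inv_radius_le b d (d0 L N s : R) : 1 <= b -> 0 < d -> d <= d0 -> 0 < L -> 0 <= N ->
  0 <= s <= L / 4 ->
  inv_radius b d N L s <= (s + d) `^ (- b) *
    expR ((b / 2 * d0 + N * L / 4 + far_cst b d0 L * (L + d0) `^ (b - 1)) * (s + d)).
Proof.
move=> b1 dp dd L0 N0 /andP[s0 sL]; set x := s + d.
have b0 : 0 <= b by apply: le_trans b1.
have x0 : 0 < x by rewrite ltr_wpDl.
have xX : x <= L + d0 by apply: lerD dd; clear -sL L0; lra.
have xb := powR_gt0 b x0; have xbN := powR_gt0 (- b) x0.
set y := (b / 2 * d0 + N * L / 4) * x; set w := far_cst b d0 L * (L + d0) `^ (b - 1) * x.
have far0 : 0 <= far_cst b d0 L by rewrite mulr_ge0 ?powR_ge0 ?expR_ge0.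
have y0 : 0 <= y.
    rewrite /y; apply: mulr_ge0 (ltW x0); have d00 := lt_le_trans dp dd.
    apply: addr_ge0; last by rewrite divr_ge0// mulr_ge0// ltW.
    by apply: mulr_ge0 (ltW d00); rewrite divr_ge0.
have w0 : 0 <= w by rewrite /w !mulr_ge0 ?powR_ge0// ltW.
have h1 : profile b d s * expR (N * (s * (L / 4 - s))) <= x `^ (- b) * expR y.
  have h := ler_wpM2r (expR_ge0 (N * (s * (L / 4 - s)))) (profile_le b0 dp s0).
  apply: le_trans h _; rewrite -[leLHS]mulrA -expRD ler_pM2l// ler_expR /y mulrDl; apply: lerD.
    rewrite -[leRHS]mulrA; apply: ler_wpM2l; first by rewrite divr_ge0.
    by rewrite expr2; apply: ler_pM; rewrite ?(ltW dp)// /x lerDr.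
  rewrite -!mulrA; apply: ler_wpM2l => //; rewrite /x.
  by clear -s0 sL dp L0; nra.
have h2 : profile b d (L - s) * expR (N * ((L - s) * (L / 4 - (L - s)))) <= x `^ (- b) * w.
  apply: (@le_trans _ _ (far_cst b d0 L)).
    rewrite -[leRHS]mulr1; apply: ler_pM; rewrite ?expR_ge0//; first exact: ltW (profile_gt0 _ _ dp).
      by apply: profile_far => //; clear -sL L0; lra.
    rewrite -[leRHS]expR0 ler_expR; apply: mulr_ge0_le0 => //.
    by clear -sL s0 L0; nra.
  have e : x `^ b <= x * (L + d0) `^ (b - 1).
    rewrite -(mulr_powRB1 (ltW x0) (lt_le_trans ltr01 b1)); apply: ler_wpM2l; first exact: ltW.
    by apply: ge0_ler_powR; rewrite ?nnegrE ?subr_ge0// ltW// (lt_le_trans x0).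
  rewrite powRN ler_pdivlMl// mulrC /w -mulrA; apply: ler_wpM2l => //.
  by rewrite [leRHS]mulrC.
apply: le_trans (lerD h1 h2) _; rewrite -mulrDr mulrDl -/y -/w; apply: ler_wpM2l; first exact: ltW.
rewrite expRD; apply: (@le_trans _ _ (expR y * (1 + w))).
  by rewrite mulrDr mulr1 lerD2l ler_peMl// one_le_expR.
by apply: ler_wpM2l; [exact: expR_ge0|exact: expR_ge1Dx].
Qed.

Lemma radius_bounds b d (d0 L N s : R) : 1 <= b -> 0 < d -> d <= d0 -> 0 < L -> 0 <= N ->
  0 <= s <= L / 4 ->
  (s + d) `^ b * (1 - (b / 2 * d0 + N * L / 4 + far_cst b d0 L * (L + d0) `^ (b - 1)) * (s + d))
    <= (inv_radius b d N L s)^-1 <= (s + d) `^ b.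
Proof.
move=> b1 dp dd L0 N0 sI; have b0 : 0 <= b by apply: le_trans b1.
have x0 : 0 < s + d by case/andP: sI => s0 _; rewrite ltr_wpDl.
have xb := powR_gt0 b x0; have xbN := powR_gt0 (- b) x0.
have Z0 := inv_radius_gt0 b N L s dp.
apply/andP; split; last first.
  by rewrite -[leRHS]invrK -powRN lef_pV2 ?posrE//; exact: inv_radius_ge.
have := inv_radius_le b1 dp dd L0 N0 sI.
move: (_ + _ + far_cst _ _ _ * _) => K ZK.
apply: (@le_trans _ _ ((s + d) `^ b * expR (- (K * (s + d))))).
  by apply: ler_wpM2l; [exact: ltW|exact: expR_ge1Dx].
have -> : (s + d) `^ b * expR (- (K * (s + d))) = ((s + d) `^ (- b) * expR (K * (s + d)))^-1.
  by rewrite invfM powRN invrK expRN.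
by rewrite lef_pV2 ?posrE// mulr_gt0// expR_gt0.
Qed.

End Radius.

(** * Choice of the parameters and the lower bound on the time *)

Section LowerBound.
Context {R : realType}.
Implicit Types (b d N L s T : R).

Lemma mean_value_in (F F' : R -> R) (x y : R) : x <= y ->
  (forall s : R, x <= s <= y -> is_derive s 1 F (F' s)) ->
  exists2 c, x <= c <= y & F y - F x = F' c * (y - x).
Proof.
move=> xy dF; have [||c] := @MVT_segment R F F' x y xy.
- by move=> s; rewrite in_itv /= => /andP[xs sy]; apply: dF; rewrite !ltW.
- apply: derivable_within_continuous => s; rewrite in_itv /= => sI.
  by have [] := dF s sI.
by rewrite in_itv /= => cI e; exists c.
Qed.

(** Adding (s + d)^(1 - b) / (b - 1), whose derivative is - (s + d)^(-b), to zeta gives a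
    nondecreasing function on [0, s1]. *)
Lemma inv_radius_primitive_ge b d N L (zeta : R -> R) (s1 : R) : 1 < b -> 0 < d -> 0 <= N ->
  0 <= s1 <= L / 4 -> zeta 0 = 0 -> (forall s : R, is_derive s 1 zeta (inv_radius b d N L s)) ->
  (d `^ (b - 1))^-1 * (b - 1)^-1 - ((s1 + d) `^ (b - 1))^-1 * (b - 1)^-1 <= zeta s1.
Proof.
move=> b1 d0 N0 /andP[s10 s1L] z0 dz.
have p0 : 0 < b - 1 by rewrite subr_gt0.
pose F s := zeta s + (s + d) `^ (- (b - 1)) * (b - 1)^-1.
have dF (s : R) : 0 <= s <= s1 -> is_derive s 1 F (inv_radius b d N L s - (s + d) `^ (- b)).
  move=> /andP[s0 _]; have sd : 0 < s + d by rewrite ltr_wpDl.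
  have d1 := is_derive1D (is_derive1_id s) (is_derive1_cst d s).
  have d2 := @is_derive1_o R (fun y => y `^ (- (b - 1))) (fun y => y + d) s _ _
    (is_derive1_powR (- (b - 1)) sd) d1.
  apply: is_derive_congr (is_derive1D (dz s) (is_derive1M d2 (is_derive1_cst (b - 1)^-1 s))) _.
  have -> : - (b - 1) - 1 = - b by ring.
  by field; rewrite gt_eqF.
have [c cI] := mean_value_in s10 dF; rewrite subr0 => e.
have : 0 <= F s1 - F 0.
  rewrite e; apply: mulr_ge0 => //; rewrite subr_ge0; apply: inv_radius_ge => //; first exact: le_trans ler01 (ltW b1).
  by move: cI => /andP[-> cs]; rewrite (le_trans cs).
by rewrite /F z0 !add0r !powRN; lra.
Qed.

Lemma inv_radius_primitive_sym b d N L (zeta : R -> R) (s : R) : 0 <= s ->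
  (forall s : R, is_derive s 1 zeta (inv_radius b d N L s)) -> zeta 0 = 0 ->
  zeta L - zeta (L - s) = zeta s.
Proof.
move=> s0 dz z0.
have d1 (r : R) : is_derive r 1 (fun r => zeta r + zeta (L - r)) 0.
  have e := is_derive1B (is_derive1_cst L r) (is_derive1_id r).
  apply: is_derive_congr (is_derive1D (dz r) (@is_derive1_o R zeta (fun y => L - y) r _ _ (dz (L - r)) e)) _.
  by rewrite inv_radius_sym; ring.
have [c _] := mean_value s0 d1; rewrite mul0r !subr0 z0 add0r; lra.
Qed.

(** With mu = a m, the factor a drops out of the conditions of [not_observable] on Z and s1, and the
    time condition becomes T a m^2 / 2 < zeta(s1) - m s1: Z and s1 can be chosen from m alone, a
    afterwards. As d <= s1, points within 2 s1 of an end satisfy s + d <= 3 s1, whence the factor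
    3. *)
Lemma inv_radius_not_observable (f q : R -> R) (L b d N m a s1 B T : R) :
  0 < L -> smooth f -> bm L q -> (forall s, 0 <= s <= L -> `|q s| <= B) ->
  1 < b -> 0 < d -> 0 <= N -> 0 < m -> 0 < a -> 0 < s1 -> 8 * s1 <= L -> d <= s1 ->
  3 / 2 * m <= (3 * s1) `^ (- b) ->
  (forall s, 3 * L / 8 <= s <= 5 * L / 8 -> inv_radius b d N L s <= m / 3) ->
  (forall s, 0 <= s <= L -> `|derive1 f s| <= a * m) ->
  0 < T -> T * (a * m ^+ 2) / 2 + m * s1 + (s1 `^ (b - 1))^-1 * (b - 1)^-1 <
    (d `^ (b - 1))^-1 * (b - 1)^-1 ->
  forall K0 epsm : R, 0 < epsm -> exists2 eps : R, 0 < eps < epsm &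
    ~ observable L (rot_metric (fun s => (inv_radius b d N L s)^-1)) (fun x => f x.1) q T K0 eps.
Proof.
move=> L0 sf bq qB b1 d0 N0 m0 a0 s10 s1L ds1 hs1 mid fa T0 hT.
have sZ := @smooth_inv_radius R b d N L d0.
have Z0 s := inv_radius_gt0 b N L s d0.
have [zeta [z0 dz]] := primitive_exists 0 (smooth_continuous sZ).
have b0 : 0 <= b by exact: le_trans ler01 (ltW b1).
have p0 : 0 < b - 1 by rewrite subr_gt0.
have near0 s : 0 <= s <= 2 * s1 -> 3 / 2 * (a * m) <= a * inv_radius b d N L s.
  move=> /andP[s0 ss1]; rewrite mulrCA ler_pM2l//; apply: le_trans hs1 _.
  apply: (@le_trans _ _ ((s + d) `^ (- b))).
    by apply: powRN_le => //; [exact: ltr_wpDl|clear -ss1 ds1; lra].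
  by apply: inv_radius_ge => //; rewrite s0/=; clear -ss1 s1L; lra.
have zs1 : T * (a * m) ^+ 2 / 2 < a * zeta s1 - a * m * s1.
  have -> : T * (a * m) ^+ 2 / 2 = a * (T * (a * m ^+ 2) / 2) by ring.
  have -> : a * zeta s1 - a * m * s1 = a * (zeta s1 - m * s1) by ring.
  rewrite ltr_pM2l//.
  have s1I : 0 <= s1 <= L / 4 by clear -s10 s1L; lra.
  have h1 := inv_radius_primitive_ge b1 d0 N0 s1I z0 dz.
  have h2 : ((s1 + d) `^ (b - 1))^-1 * (b - 1)^-1 <= (s1 `^ (b - 1))^-1 * (b - 1)^-1.
    rewrite ler_pM2r ?invr_gt0// -!powRN; apply: powRN_le => //; first exact: ltW.
    by rewrite lerDl ltW.
  by clear -h1 h2 hT; lra.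
apply: (@not_observable _ f _ q zeta L B a (a * m) s1 (3 * L / 8) (5 * L / 8)) => //.
- exact: mulr_gt0.
- by clear -s1L s10; lra.
- by clear -L0; lra.
- by clear -L0; lra.
- by clear -L0; lra.
- move=> s sI; rewrite -inv_radius_sym; apply: near0; clear -sI; lra.
- move=> s sI; have h := mid s sI; have h0 := ltW (Z0 s).
  rewrite !exprMn -[leRHS]mulrA; apply: ler_wpM2l; first exact: sqr_ge0.
  by clear -h h0 m0; nra.
by rewrite (inv_radius_primitive_sym (ltW s10) dz z0).
Qed.

End LowerBound.

Lemma grad_rot (R : realType) (Rad f : R -> R) (x : R * R) : Rad x.1 != 0 ->
  grad (rot_metric Rad) (fun x => f x.1) x = (derive1 f x.1, 0).
Proof.
move=> Rn.
have e1 : ds (fun x => f x.1) x = derive1 f x.1 by rewrite dsE.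
have e2 : dth (fun x : R * R => f x.1) x = 0.
  by rewrite dthE; exact: is_derive_derive1 (is_derive1_cst (f x.1) x.2).
rewrite /grad /sharp e1 e2 /iss /ist /itt /gdet /=.
rewrite !mulr0 !addr0 mul1r expr0n /= subr0 oppr0 mul0r.
by rewrite divff ?mul1r ?mul0r// expf_neq0.
Qed.

Lemma powR_large (R : realType) (b A L : R) : 0 < b -> 0 < A -> 0 < L ->
  exists s : R, [/\ 0 < s, 8 * s <= L & A <= (3 * s) `^ (- b)].
Proof.
move=> b0 A0 L0; pose c := A `^ (- b^-1).
have c0 : 0 < c by exact: powR_gt0.
have ec : c `^ (- b) = A by rewrite -powRrM mulrNN mulVf ?powRr1// ?gt_eqF// ltW.
pose s := Num.min (L / 8) (c / 3).
have s0 : 0 < s by rewrite lt_min !divr_gt0.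
have sL : s <= L / 8 by rewrite ge_min lexx.
have sc : s <= c / 3 by rewrite ge_min lexx orbT.
exists s; split => //; first by clear -sL; lra.
rewrite -[leLHS]ec; apply: powRN_le; rewrite ?mulr_gt0//; first exact: ltW.
by clear -sc; lra.
Qed.

Theorem corollary1p11 (R : realType) (L : R) (hL : 0 < L)
    (f : R -> R) (hf : smooth f)
    (q : R -> R) (hqm : measurable_fun `[0, L] q)
    (hqb : exists B : R, forall s : R, 0 <= s <= L -> `|q s| <= B) :
  forall gamma delta0 : R, 2 < gamma -> 0 < delta0 ->
  exists2 C : R, 0 < C &
  forall delta : R, 0 < delta <= delta0 ->
  exists Rad : R -> R,
    let g := rot_metric Rad in
    let M := sup [set `|derive1 f s| ^+ 2 / 4 | s in `[0, L]] in
    let fS := fun x : R * R => f x.1 in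
    (smooth Rad /\ forall s : R, 0 <= s <= L -> 0 < Rad s) /\
    [/\ (forall x, cyl L x -> grad g fS x = (derive1 f x.1, 0)),
        (forall (gt : metric R) (ft : R * R -> R) (gam : R * R -> R -> R * R),
           extension L g fS gt ft -> neg_gradient_flow gt ft gam ->
           (FC L gam <-> (forall s : R, 0 <= s <= L -> derive1 f s != 0)) /\
           (FC L gam ->
              T_FC L gam =
                `| \int[lebesgue_measure]_(s in `[0%R, L]) ((derive1 f s)^-1)%:E |%E
              /\ (T_FC L gam < +oo)%E)),
        ((M%:E^-1 *
            ((delta `^ (gamma / 2 - 1))^-1 * (gamma / 2 - 1)^-1 - C)%R%:E
          <= T_unif L g fS q)%E) &
        (forall s : R, 0 <= s <= L / 4 ->
           (s + delta) `^ (gamma / 2) * (1 - C * (s + delta)) <= Rad s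
             <= (s + delta) `^ (gamma / 2)) /\
        (forall s : R, 3 * L / 4 <= s <= L ->
           (L - s + delta) `^ (gamma / 2) * (1 - C * (L - s + delta)) <= Rad s
             <= (L - s + delta) `^ (gamma / 2))].
Proof.
move=> gamma delta0 hg hd0; set b := gamma / 2.
have b1 : 1 < b by rewrite /b; clear -hg; lra.
have b0 : 0 < b by apply: lt_trans b1.
have b0' := ltW b0; have b1' := ltW b1.
have p0 : 0 < b - 1 by rewrite subr_gt0.
set M := sup _.
have [fK fK0 fKP] := continuous_bounded 0 L (smooth_continuous (smooth_derive1 hf)).
have fM s : 0 <= s <= L -> `|derive1 f s| ^+ 2 / 4 <= M.
  move=> sL; apply: ub_le_sup; last by exists s => //=; rewrite in_itv.
  exists (fK ^+ 2 / 4) => y [r rI <-]; rewrite /= in_itv /= in rI.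
  by rewrite ler_pM2r ?invr_gt0// ler_pXn2r ?nnegrE ?normr_ge0 ?(ltW fK0)// fKP//.
have M0 : 0 <= M.
  apply: le_trans (fM 0 _); first by rewrite divr_ge0 ?sqr_ge0.
  by rewrite lexx ltW.
(* Half the maximum of |f'|, so that mu = 2 m will be this maximum; if f' = 0 any positive number
   will do, since a remains free. *)
pose m := if 0 < M then Num.sqrt M else 1.
have m0 : 0 < m by rewrite /m; case: ifP => // Mp; rewrite sqrtr_gt0.
have A0 : 0 < 3 / 2 * m by rewrite mulr_gt0// divr_gt0.
have [s1 [s10 s1L hs1]] := powR_large b0 A0 hL.
pose far := far_cst b delta0 L.
have far0 : 0 < far.
  by rewrite mulr_gt0 ?expR_gt0// powR_gt0// divr_gt0// mulr_gt0.
(* Makes the bound 2 far / Y of [inv_radius_mid] equal to m / 3. *)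
pose Y := 6 * far / m.
have Y0 : 0 < Y by rewrite divr_gt0// mulr_gt0.
have l0 : 0 < 3 * L ^+ 2 / 64 by rewrite divr_gt0// mulr_gt0// exprn_gt0.
pose N := Y / (3 * L ^+ 2 / 64).
have N0 : 0 <= N by rewrite divr_ge0// ltW.
pose C4 := b / 2 * delta0 + N * L / 4 + far * (L + delta0) `^ (b - 1).
have C40 : 0 <= C4.
  apply: addr_ge0; last by rewrite mulr_ge0 ?powR_ge0// ltW.
  apply: addr_ge0; last by rewrite divr_ge0// mulr_ge0// ltW.
  by apply: mulr_ge0 (ltW hd0); rewrite divr_ge0.
pose D s := (s `^ (b - 1))^-1 * (b - 1)^-1.
have D0 s : 0 < s -> 0 < D s.
  by move=> s0; rewrite mulr_gt0// invr_gt0// powR_gt0.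
have mL0 : 0 < m * L by exact: mulr_gt0.
have Ds10 := D0 _ s10.
(* [C4] serves the bounds on the radius. The rest covers the losses in the lower bound on the time:
   m s1 from the drift, and D(s1) from the upper end of the integral of (s + delta)^(-b) over
   [0, s1]. *)
exists (C4 + (m * L + D s1)); first by rewrite ltr_wpDl// addr_gt0.
move=> d /andP[d0 dd0].
have sZ := @smooth_inv_radius R b d N L d0.
have Z0 s := inv_radius_gt0 b N L s d0.
exists (fun s => (inv_radius b d N L s)^-1) => g M' fS.
have sRad := smooth_inv Z0 sZ.
have Rad0 s : 0 < (inv_radius b d N L s)^-1 by rewrite invr_gt0.
have bounds s : 0 <= s <= L / 4 ->
    (s + d) `^ b * (1 - (C4 + (m * L + D s1)) * (s + d)) <= (inv_radius b d N L s)^-1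
      <= (s + d) `^ b.
  move=> sI; have /andP[h1 h2] := radius_bounds b1' d0 dd0 hL N0 sI.
  rewrite h2 andbT; apply: le_trans h1; apply: ler_wpM2l; first exact: powR_ge0.
  rewrite lerD2l lerN2; apply: ler_wpM2r.
    by case/andP: sI => s0 _; rewrite addr_ge0// ltW.
  by rewrite lerDl addr_ge0// ltW.
split; first by split.
split.
- by move=> x _; apply: grad_rot; rewrite gt_eqF.
- by move=> gt ft gam ext flow; exact: (flushing hL hf (fun s _ => Rad0 s) ext flow).
- apply: le_ereal_inf_tmp => _ [T [T0 [K0 [eps0 [K00 eps00 obs]]]] <-].
  rewrite leNgt; apply/negP => TY.
  set Yc := (_ - _)%R in TY.
  (* If M = 0, its inverse is +oo, and the product exceeds T > 0 only if Yc > 0: otherwise it is 0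
     or -oo. *)
  have [Yc0 TM] : 0 < Yc /\ T * M < Yc.
    move: TY; rewrite inver -/M; have [M_0|Mn] := eqVneq M 0.
      have [Y1|Y1|<-] := ltgtP 0 Yc; last by rewrite mule0 lte_fin ltNge ltW.
        by rewrite M_0 mulr0.
      by rewrite lt0_mulye ?lte_fin// ltNge leNye.
    have Mp : 0 < M by rewrite lt_neqAle eq_sym Mn.
    rewrite -EFinM lte_fin mulrC ltr_pdivlMr// => h; split => //.
    by apply: lt_trans h; exact: mulr_gt0.
  have DY : Yc = D d - (C4 + (m * L + D s1)) by [].
  (* For larger d the bound to be proved is negative, against [Yc0]. *)
  have ds1 : d <= s1.
    rewrite leNgt; apply/negP => s1d.
    have : D d <= D s1.
      rewrite ler_pM2r ?invr_gt0// -!powRN; apply: powRN_le => //; exact: ltW.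
    by clear -Yc0 DY C40 mL0; lra.
  (* If M > 0, a = 2 gives a m = max |f'| and T a m^2 / 2 = T M. If M = 0, f' vanishes and a may
     depend on T: a = Yc / T makes the left-hand side half of Yc. *)
  have [a [a0 fa Ta]] : exists a : R, [/\ 0 < a,
      forall s, 0 <= s <= L -> `|derive1 f s| <= a * m & T * (a * m ^+ 2) / 2 < Yc].
    rewrite /m; case: ifP => Mp.
      exists 2; split => // [s sL|].
        rewrite -(ler_pXn2r (ltn0Sn 1)) ?nnegrE ?normr_ge0 ?mulr_ge0 ?sqrtr_ge0//.
        rewrite exprMn sqr_sqrtr//; have := fM s sL; clear; lra.
      by rewrite sqr_sqrtr//; clear -TM; lra.
    have M_0 : M = 0 by apply/eqP; rewrite eq_le M0 andbT leNgt Mp.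
    exists (Yc / T); split; first exact: divr_gt0.
      move=> s sL; have := fM s sL; rewrite M_0 pmulr_lle0 ?invr_gt0// => h.
      have : `|derive1 f s| ^+ 2 == 0 by rewrite eq_le h sqr_ge0.
      by rewrite sqrf_eq0 => /eqP ->; rewrite mulr1 divr_ge0 ?ltW.
    have -> : T * (Yc / T * 1 ^+ 2) / 2 = Yc / 2 by field; rewrite gt_eqF.
    by clear -Yc0; lra.
  have [B qB] := hqb.
  have bq : bm L q by split => //; exists B.
  have mid s : 3 * L / 8 <= s <= 5 * L / 8 -> inv_radius b d N L s <= m / 3.
    move=> sI; have YN : Y <= N * (3 * L ^+ 2 / 64) by rewrite /N divfK// gt_eqF.
    apply: le_trans (inv_radius_mid b0' d0 dd0 hL Y0 YN sI) _.
    rewrite -/far /Y le_eqVlt; apply/orP; left; apply/eqP; field.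
    by rewrite !gt_eqF.
  have hT : T * (a * m ^+ 2) / 2 + m * s1 + D s1 < D d.
    have : m * s1 <= m * L by apply: ler_wpM2l; [exact: ltW|clear -s1L s10; lra].
    by clear -Ta DY C40; lra.
  have [eps epsI nobs] := inv_radius_not_observable hL hf bq qB b1 d0 N0 m0 a0 s10 s1L ds1
    hs1 mid fa T0 hT K0 eps00.
  exact: nobs (obs _ epsI).
split; first exact: bounds.
move=> s sI; rewrite -inv_radius_sym; apply: bounds.
by clear -sI; lra.
Qed.
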